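(* Let $X\neq\{0\}$ be a complex Banach space with open unit ball $\mathbb{B}$ and let $\frac12\le\lambda\le 1$. Let $g:\mathbb{B}\to\mathbb{C}$ be holomorphic with $g(0)=1$, define $F(x)=g(x)x$ for $x\in\mathbb{B}$, and suppose that $F\in\widehat{\mathcal{F}}_{\lambda}(\mathbb{B})$. Then for every $x_0\in X$ with $\|x_0\|=1$ (and every $T_{x_0}\in T(x_0)$), $$|H_2(2)(F)|\le\frac{(1+2\lambda)^2(17-10\lambda)}{192(3-2\lambda)},\qquad\text{where } H_2(2)(F)=A_2A_4-A_3^2 .$$ The inequality is sharp: for every $\lambda\in[\frac12,1]$ there exist such an $F$, $x_0$ and $T_{x_0}$ for which equality holds.
   Context: $X$ is a complex Banach space with norm $\|\cdot\|$ and $\mathbb{B}=\{x\in X:\|x\|<1\}$. For $x\in X\setminus\{0\}$, $T(x)$ is the set of bounded linear functionals $T_x:X\to\mathbb{C}$ with $T_x(x)=\|x\|$ and $\|T_x\|=1$. $D^nF(x)$ denotes the $n$th Fréchet derivative of $F$ at $x$ (a bounded symmetric $n$-linear map $X^n\to X$). A holomorphic map $F:\mathbb{B}\to X$ is normalized if $F(0)=0$ and $DF(0)=I$; it is locally biholomorphic if $DF(x)$ is invertible with bounded inverse for every $x\in\mathbb{B}$. For $\frac12\le\lambda\le1$, $\widehat{\mathcal{F}}_{\lambda}(\mathbb{B})$ is the class of normalized locally biholomorphic maps $F:\mathbb{B}\to X$ such that $$\operatorname{Re}\left\{T_x\left(\frac{(DF(x))^{-1}\bigl(D^2F(x)(x,x)+DF(x)x\bigr)}{\|x\|}\right)\right\}\ge\frac12-\lambda$$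 for every $x\in\mathbb{B}\setminus\{0\}$ and every $T_x\in T(x)$. For $\|x_0\|=1$ and $T_{x_0}\in T(x_0)$, put $A_n=\frac{1}{n!}T_{x_0}\bigl(D^nF(0)(x_0,\ldots,x_0)\bigr)$ for $n=2,3,4$. *)

(* Defs.v *)
From Stdlib Require Import Reals Lra Factorial.
From Stdlib Require Import FunctionalExtensionality ProofIrrelevance ClassicalEpsilon.
From Coquelicot Require Export Coquelicot.
Open Scope R_scope.

(* Coquelicot has no normed space of bounded operators; it is built here as a
   [NormedModule], so that [filterdiff] also applies to operator-valued maps. *)
Section BoundedOperators.

Context {U V : NormedModule C_AbsRing}.

Record Lop : Type := mkLop { Lop_fun :> U -> V; Lop_is_linear : is_linear Lop_fun }.

Lemma Lop_ext (A B : Lop) : (forall v, A v = B v) -> A = B.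
Proof.
  destruct A as [a ha], B as [b hb]; simpl; intros h.
  assert (e : a = b) by (apply functional_extensionality; exact h).
  subst b; f_equal; apply proof_irrelevance.
Qed.

Lemma is_linear_Lplus (A B : Lop) : is_linear (fun v => plus (A v) (B v)).
Proof.
  destruct A as [a ha], B as [b hb]; simpl.
  exact (is_linear_comp _ _ (is_linear_prod _ _ ha hb) is_linear_plus).
Qed.

Lemma is_linear_Lopp (A : Lop) : is_linear (fun v => opp (A v)).
Proof. exact (is_linear_comp _ _ (Lop_is_linear A) is_linear_opp). Qed.

Lemma is_linear_Lscal (c : C) (A : Lop) :
  is_linear (fun v => scal (c : C_AbsRing) (A v)).
Proof.
  refine (is_linear_comp _ _ (Lop_is_linear A) (is_linear_scal_r _ _)).
  exact Cmult_comm.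
Qed.

Definition Lzero : Lop := mkLop _ is_linear_zero.
Definition Lplus (A B : Lop) : Lop := mkLop _ (is_linear_Lplus A B).
Definition Lopp (A : Lop) : Lop := mkLop _ (is_linear_Lopp A).
Definition Lscal (c : C_AbsRing) (A : Lop) : Lop := mkLop _ (is_linear_Lscal c A).

Definition Lop_AbelianMonoid_mixin : AbelianMonoid.mixin_of Lop.
Proof.
  apply (AbelianMonoid.Mixin Lop Lplus Lzero); intros; apply Lop_ext; intros v; simpl.
  - apply plus_comm.
  - apply plus_assoc.
  - apply plus_zero_r.
Defined.
Canonical Lop_AbelianMonoid := AbelianMonoid.Pack Lop Lop_AbelianMonoid_mixin Lop.

Definition Lop_AbelianGroup_mixin : AbelianGroup.mixin_of Lop_AbelianMonoid.
Proof.
  apply (AbelianGroup.Mixin Lop_AbelianMonoid Lopp).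
  intros A; apply Lop_ext; intros v; exact (plus_opp_r (A v)).
Defined.
Canonical Lop_AbelianGroup :=
  AbelianGroup.Pack Lop (AbelianGroup.Class _ _ Lop_AbelianGroup_mixin) Lop.

Definition Lop_ModuleSpace_mixin : ModuleSpace.mixin_of C_AbsRing Lop_AbelianGroup.
Proof.
  apply (ModuleSpace.Mixin C_AbsRing Lop_AbelianGroup Lscal);
    intros; apply Lop_ext; intros w.
  - exact (scal_assoc _ _ _).
  - exact (scal_one _).
  - exact (scal_distr_l _ _ _).
  - exact (scal_distr_r _ _ _).
Defined.
Canonical Lop_ModuleSpace :=
  ModuleSpace.Pack C_AbsRing Lop (ModuleSpace.Class _ _ _ Lop_ModuleSpace_mixin) Lop.

Definition opnorm (A : Lop) : R :=
  real (Lub_Rbar (fun r => exists v : U, norm v <= 1 /\ r = norm (A v))).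

Lemma norm_scal_RtoC {W : NormedModule C_AbsRing} (t : R) (w : W) :
  0 < t -> norm (scal (RtoC t : C_AbsRing) w) = t * norm w.
Proof.
  intros ht.
  assert (hle : forall (s : R) (u : W), 0 < s ->
            norm (scal (RtoC s : C_AbsRing) u) <= s * norm u).
  { intros s u hs.
    assert (h : norm (scal (RtoC s : C_AbsRing) u) <= Cmod (RtoC s) * norm u)
      by exact (norm_scal (K := C_AbsRing) (RtoC s) u).
    rewrite Cmod_R, Rabs_pos_eq in h by lra; exact h. }
  apply Rle_antisym; [now apply hle|].
  pose proof (hle (/ t) (scal (RtoC t : C_AbsRing) w) (Rinv_0_lt_compat _ ht)) as h.
  rewrite scal_assoc in h.
  replace (mult (RtoC (/ t) : C_AbsRing) (RtoC t : C_AbsRing))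
    with (one : C_AbsRing) in h.
  2:{ change (RtoC 1 = Cmult (RtoC (/ t)) (RtoC t)).
      rewrite <- RtoC_mult; f_equal; field; lra. }
  rewrite scal_one in h.
  apply (Rmult_le_compat_l t) in h; [|lra].
  rewrite <- Rmult_assoc, Rinv_r, Rmult_1_l in h by lra; exact h.
Qed.

Lemma opnorm_correct (A : Lop) :
  is_lub (fun r => exists v : U, norm v <= 1 /\ r = norm (A v)) (opnorm A).
Proof.
  unfold opnorm.
  set (E := fun r => _).
  assert (h0 : E 0).
  { exists zero; rewrite norm_zero; split; [lra|].
    rewrite (linear_zero _ (Lop_is_linear A)), norm_zero; reflexivity. }
  destruct (linear_norm _ (Lop_is_linear A)) as [M [hM hb]].
  destruct (Lub_Rbar_correct E) as [hub hlub].
  assert (hM' : is_ub_Rbar E M).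
  { intros r [v [hv ->]]; simpl.
    apply Rle_trans with (1 := hb v).
    rewrite <- (Rmult_1_r M) at 2; apply Rmult_le_compat_l; lra. }
  pose proof (hlub _ hM') as hle.
  pose proof (hub _ h0) as hge.
  destruct (Lub_Rbar E) as [l| |]; simpl in *; try contradiction.
  split.
  - intros r hr; exact (hub r hr).
  - intros b hb'; exact (hlub (Finite b) (fun r hr => hb' r hr)).
Qed.

Lemma opnorm_ge0 (A : Lop) : 0 <= opnorm A.
Proof.
  destruct (opnorm_correct A) as [h _]; apply h; exists zero.
  rewrite (linear_zero _ (Lop_is_linear A)), !norm_zero; split; lra.
Qed.

Lemma opnorm_bound (A : Lop) (v : U) : norm (A v) <= opnorm A * norm v.
Proof.
  destruct (Req_dec (norm v) 0) as [h|h].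
  - apply norm_eq_zero in h; subst v.
    rewrite (linear_zero _ (Lop_is_linear A)), !norm_zero; lra.
  - assert (hp : 0 < norm v) by (pose proof (norm_ge_0 v); lra).
    assert (hi := Rinv_0_lt_compat _ hp).
    destruct (opnorm_correct A) as [hub _].
    assert (hr : norm (A (scal (RtoC (/ norm v) : C_AbsRing) v)) <= opnorm A).
    { apply hub; eexists; split; [|reflexivity].
      rewrite norm_scal_RtoC by exact hi; rewrite Rinv_l; lra. }
    rewrite (linear_scal _ (Lop_is_linear A)), norm_scal_RtoC in hr by exact hi.
    apply (Rmult_le_compat_r (norm v)) in hr; [|lra].
    replace (/ norm v * norm (A v) * norm v) with (norm (A v)) in hr by (field; lra).
    exact hr.
Qed.

Lemma opnorm_le (A : Lop) (c : R) :
  0 <= c -> (forall v, norm (A v) <= c * norm v) -> opnorm A <= c.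
Proof.
  intros hc h; destruct (opnorm_correct A) as [_ hl]; apply hl.
  intros r [v [hv ->]]; apply Rle_trans with (1 := h v).
  rewrite <- (Rmult_1_r c) at 2; apply Rmult_le_compat_l; lra.
Qed.

Lemma opnorm_triangle (A B : Lop) : opnorm (plus A B) <= opnorm A + opnorm B.
Proof.
  apply opnorm_le; [pose proof (opnorm_ge0 A); pose proof (opnorm_ge0 B); lra|].
  intros v; change (norm (plus (A v) (B v)) <= (opnorm A + opnorm B) * norm v).
  apply Rle_trans with (1 := norm_triangle _ _).
  pose proof (opnorm_bound A v); pose proof (opnorm_bound B v); lra.
Qed.

Lemma opnorm_scal (c : C_AbsRing) (A : Lop) : opnorm (scal c A) <= abs c * opnorm A.
Proof.
  apply opnorm_le; [apply Rmult_le_pos; [apply abs_ge_0 | apply opnorm_ge0]|].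
  intros v; change (norm (scal c (A v)) <= abs c * opnorm A * norm v).
  apply Rle_trans with (1 := norm_scal _ _); rewrite Rmult_assoc.
  apply Rmult_le_compat_l; [apply abs_ge_0 | apply opnorm_bound].
Qed.

Lemma opnorm_opp (A : Lop) : opnorm (opp A) <= opnorm A.
Proof.
  apply opnorm_le; [apply opnorm_ge0|]; intros v.
  change (norm (opp (A v)) <= opnorm A * norm v).
  rewrite norm_opp; apply opnorm_bound.
Qed.

Lemma opnorm_eq0 (A : Lop) : opnorm A = 0 -> A = zero.
Proof.
  intros h; apply Lop_ext; intros v; change (A v = zero).
  apply norm_eq_zero; pose proof (opnorm_bound A v) as hb.
  rewrite h in hb; pose proof (norm_ge_0 (A v)); lra.
Qed.

Definition Lop_UniformSpace_mixin : UniformSpace.mixin_of Lop.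
Proof.
  apply (UniformSpace.Mixin Lop zero (fun A e B => opnorm (minus B A) < e)).
  - intros A e; rewrite minus_eq_zero.
    apply Rle_lt_trans with 0; [|apply cond_pos].
    apply opnorm_le; [lra|]; intros v; change (norm (zero : V) <= 0 * norm v).
    rewrite norm_zero; lra.
  - intros A B e h; rewrite <- opp_minus.
    apply Rle_lt_trans with (1 := opnorm_opp _); exact h.
  - intros A B D e1 e2 h1 h2; rewrite (minus_trans B).
    apply Rle_lt_trans with (1 := opnorm_triangle _ _); lra.
Defined.
Canonical Lop_UniformSpace := UniformSpace.Pack Lop Lop_UniformSpace_mixin Lop.

Canonical Lop_NormedModuleAux :=
  NormedModuleAux.Pack C_AbsRing Lop
    (NormedModuleAux.Class C_AbsRing Lop
       (ModuleSpace.Class _ _ _ Lop_ModuleSpace_mixin) Lop_UniformSpace_mixin) Lop.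

Definition Lop_NormedModule_mixin : NormedModule.mixin_of C_AbsRing Lop_NormedModuleAux.
Proof.
  apply (NormedModule.Mixin C_AbsRing Lop_NormedModuleAux opnorm 1).
  - exact opnorm_triangle.
  - exact opnorm_scal.
  - intros A B e h; exact h.
  - intros A B e h; rewrite Rmult_1_l; exact h.
  - exact opnorm_eq0.
Defined.
Canonical Lop_NormedModule :=
  NormedModule.Pack C_AbsRing Lop (NormedModule.Class _ _ _ Lop_NormedModule_mixin) Lop.

(* Like the total derivatives of the library: junk value where [f] is not
   Fréchet differentiable (over C). *)
Definition fderiv (f : U -> V) (x : U) : Lop :=
  epsilon (inhabits Lzero) (fun L : Lop => filterdiff f (locally x) L).

Lemma fderiv_correct (f : U -> V) (x : U) :
  ex_filterdiff f (locally x) -> filterdiff f (locally x) (fderiv f x).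
Proof.
  intros [l hl]; unfold fderiv.
  apply (epsilon_spec (inhabits Lzero) (fun L : Lop => filterdiff f (locally x) L)).
  exists (mkLop l (proj1 hl)); exact hl.
Qed.

End BoundedOperators.

Arguments Lop : clear implicits.
Arguments Lop_NormedModule : clear implicits.

(* D^n F(x) is an element of L(X, L(X, ..., L(X, X))), the usual isometric model
   of the bounded n-linear maps. *)
Fixpoint Lmulti (X : NormedModule C_AbsRing) (n : nat) : NormedModule C_AbsRing :=
  match n with
  | O => X
  | S m => Lop_NormedModule X (Lmulti X m)
  end.

Fixpoint nderiv {X : NormedModule C_AbsRing} (F : X -> X) (n : nat) : X -> Lmulti X n :=
  match n return X -> Lmulti X n with
  | O => F
  | S m => fderiv (nderiv F m)
  end.

Fixpoint diag {X : NormedModule C_AbsRing} (n : nat) : Lmulti X n -> X -> X :=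
  match n return Lmulti X n -> X -> X with
  | O => fun y _ => y
  | S m => fun (L : Lop X (Lmulti X m)) x => diag m (L x) x
  end.

Definition is_inverse {X : NormedModule C_AbsRing} (A B : Lop X X) : Prop :=
  (forall v, B (A v) = v) /\ (forall v, A (B v) = v).

Definition Linv {X : NormedModule C_AbsRing} (A : Lop X X) : Lop X X :=
  epsilon (inhabits Lzero) (is_inverse A).

(* Maps on the unit ball are total functions on X of which only the values on
   the ball matter; as the ball is open, these determine the derivatives there. *)
Definition holomorphic_on_ball {X Y : NormedModule C_AbsRing} (f : X -> Y) : Prop :=
  forall x : X, norm x < 1 -> ex_filterdiff f (locally x).

Definition normalized {X : NormedModule C_AbsRing} (F : X -> X) : Prop :=
  F zero = zero /\ forall v : X, fderiv F zero v = v.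

Definition locally_biholomorphic {X : NormedModule C_AbsRing} (F : X -> X) : Prop :=
  holomorphic_on_ball F /\
  forall x : X, norm x < 1 -> exists B : Lop X X, is_inverse (fderiv F x) B.

Definition support_functional {X : NormedModule C_AbsRing} (x : X)
    (T : Lop X C_NormedModule) : Prop :=
  T x = RtoC (norm x) /\ norm T = 1.

Definition class_F {X : NormedModule C_AbsRing} (lambda : R) (F : X -> X) : Prop :=
  normalized F /\ locally_biholomorphic F /\
  forall x : X, norm x < 1 -> x <> zero ->
  forall T : Lop X C_NormedModule, support_functional x T ->
    Re (T (scal (RtoC (/ norm x) : C_AbsRing)
             (Linv (fderiv F x)
                (plus (diag 2 (nderiv F 2 x) x) (fderiv F x x)))))
    >= 1 / 2 - lambda.

Definition coef {X : NormedModule C_AbsRing} (F : X -> X) (x0 : X)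
    (T : Lop X C_NormedModule) (n : nat) : C :=
  (RtoC (/ INR (fact n)) * T (diag n (nderiv F n zero) x0))%C.

Definition H22 {X : NormedModule C_AbsRing} (F : X -> X) (x0 : X)
    (T : Lop X C_NormedModule) : C :=
  (coef F x0 T 2 * coef F x0 T 4 - coef F x0 T 3 * coef F x0 T 3)%C.

(* Main.v *)
Require Import Defs.
From Stdlib Require Import Reals Ranalysis5 Lra Lia List Factorial ClassicalEpsilon FunctionalExtensionality ProofIrrelevance.
From mathcomp Require classical_sets.
From Coquelicot Require Import Coquelicot.
Open Scope R_scope.

(** On the ray of a unit vector [x0] one has [F (s x0) = psi s * x0], the
    derivatives of [F] along [x0] are those of [psi], and with
    [mu = lambda + 1/2] the class condition reads
    [Re (s psi'' / psi') >= - mu].  Equivalently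
    [v = psi'' / (2 mu psi' + s psi'')] satisfies [|s v| <= 1], and
    [H22 = mu^2/18 (3 a c + (2+mu) a^2 b - 2 b^2 + (1+mu-2mu^2) a^4)] where
    [v = a + b s + c s^2 + ...].  A function bounded by one acts by
    multiplication as a contraction, so its Taylor coefficients satisfy
    [|b| <= 1 - |a|^2] and [|c| + |b|^2 / (1 + |a|) <= 1 - |a|^2]; the resulting
    real bound is increasing in [|b|] and, for [|b| = 1 - |a|^2], maximal at
    [|a|^2 = 1 / (4 (2 - mu))].

    Equality holds for [v = (c - s) / (1 - c s)] with [c] this maximizing value of
    [|a|], that is for [f' = (1 - 2 c z + z^2)^(-mu)], through
    [F x = f (l x) / (l x) * x] with a norming functional [l] of [x0].
    Here [f (z) / z] has no zero: in the coordinate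
    [zeta = log ((1 - z / e) / (1 - z e))], where [c = Re e] and [|e| = 1], [f] is a
    constant times the primitive of [sinh (zeta/2 + i arg e) ^ (2 mu - 2)], whose
    values lie in an open half-plane because [2 mu - 2 <= 1].

    Fréchet differentiability of the derivatives of [F] follows from Goursat's
    theorem on rectangles, transported to circles by the exponential, and from the
    Cauchy estimates, which are applied to second differences of [F]. *)

(** * Linear identities and Fréchet derivatives *)

(** Derivatives up to order four must exist as operators, while holomorphy grants only one.
    Vector-valued contour integrals are avoided: each vector estimate is pulled back to a scalar
    function on a complex line by a norming functional, which puts the Hahn-Banach theorem at the
    base.

    The point [- 2 mu] is the mirror image of [0] in the line [Re = - mu]. Hence [w / (2 mu + w)],
    with [w = s psi'' / psi'], carries the half-plane of the class condition into the unit disc and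
    vanishes with [s], so that [s] can be divided out.

    Nothing is lost at [v = (c - s) / (1 - c s)]: its coefficients are [c], [- (1 - c^2)] and
    [- c (1 - c^2)], all four terms of the form are nonpositive, and the triangle inequality becomes
    an equality.

    For [F x = G (l x) * x] with [G z = f z / z], the derivative acts as [G (l x)] on the kernel of
    [l] and multiplies [l] by [f' (l x)]. Once this kernel is nonzero, local biholomorphy demands
    that [G] be free of zeros as well as [f']; this is the delicate half of sharpness. *)

Section ModuleExpressions.

Context {V : ModuleSpace C_Ring}.

(** Syntax for a reflective normal form of linear combinations. Scalars stay semantic, so an
    identity between vectors becomes one equation in [C] per atom. *)
Inductive mexp : Type :=
  | MVar (n : nat) | MZero | MPlus (a b : mexp) | MOpp (a : mexp) | MScal (c : C) (a : mexp).

Fixpoint meval (l : list V) (e : mexp) : V :=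
  match e with
  | MVar n => nth n l zero
  | MZero => zero
  | MPlus a b => plus (meval l a) (meval l b)
  | MOpp a => opp (meval l a)
  | MScal c a => scal (c : C_Ring) (meval l a)
  end.

Fixpoint mcoef (e : mexp) (n : nat) : C :=
  match e with
  | MVar m => if Nat.eqb m n then RtoC 1 else RtoC 0
  | MZero => RtoC 0
  | MPlus a b => Cplus (mcoef a n) (mcoef b n)
  | MOpp a => Copp (mcoef a n)
  | MScal c a => Cmult c (mcoef a n)
  end.

Fixpoint mlin (cs : nat -> C) (l : list V) : V :=
  match l with
  | nil => zero
  | v :: l' => plus (scal (cs O : C_Ring) v) (mlin (fun n => cs (S n)) l')
  end.

Fixpoint mcoefs_eq (cs ds : nat -> C) (l : list V) : Prop :=
  match l with
  | nil => True
  | v :: l' => cs O = ds O /\ mcoefs_eq (fun n => cs (S n)) (fun n => ds (S n)) l'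
  end.

Lemma mlin_eq (l : list V) : forall cs ds, mcoefs_eq cs ds l -> mlin cs l = mlin ds l.
Proof.
  induction l as [|v l IH]; simpl; intros cs ds h; [reflexivity|].
  destruct h as [h1 h2]; rewrite h1, (IH _ _ h2); reflexivity.
Qed.

Lemma mlin_zero (l : list V) : forall cs, (forall n, cs n = RtoC 0) -> mlin cs l = zero.
Proof.
  induction l as [|v l IH]; simpl; intros cs h; [reflexivity|].
  rewrite IH by (intros; apply h); rewrite h.
  change (RtoC 0 : C_Ring) with (zero : C_Ring).
  rewrite (scal_zero_l v); apply plus_zero_l.
Qed.

Lemma plus_shuffle {G : AbelianMonoid} (a b c d : G) :
  plus (plus a b) (plus c d) = plus (plus a c) (plus b d).
Proof.
  rewrite <- !plus_assoc; f_equal; rewrite !plus_assoc; f_equal; apply plus_comm.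
Qed.

Lemma mlin_plus (l : list V) : forall cs ds,
  mlin (fun n => Cplus (cs n) (ds n)) l = plus (mlin cs l) (mlin ds l).
Proof.
  induction l as [|v l IH]; simpl; intros cs ds; [symmetry; apply plus_zero_l|].
  rewrite IH.
  change (Cplus (cs O) (ds O)) with (plus (cs O : C_Ring) (ds O : C_Ring)).
  rewrite (scal_distr_r (K := C_Ring)); apply plus_shuffle.
Qed.

Lemma mlin_scal (c : C) (l : list V) : forall cs,
  mlin (fun n => Cmult c (cs n)) l = scal (c : C_Ring) (mlin cs l).
Proof.
  induction l as [|v l IH]; simpl; intros cs; [symmetry; apply (scal_zero_r (K := C_Ring))|].
  rewrite IH, (scal_distr_l (K := C_Ring)); f_equal.
  change (Cmult c (cs O)) with (mult (c : C_Ring) (cs O)).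
  symmetry; apply (scal_assoc (K := C_Ring)).
Qed.

Lemma mlin_var (l : list V) : forall m,
  mlin (fun n => if Nat.eqb m n then RtoC 1 else RtoC 0) l = nth m l zero.
Proof.
  induction l as [|v l IH]; intros m; simpl; [destruct m; reflexivity|].
  destruct m as [|m]; simpl.
  - rewrite mlin_zero by reflexivity.
    change (RtoC 1 : C_Ring) with (one : C_Ring).
    rewrite (scal_one (K := C_Ring)); apply plus_zero_r.
  - rewrite IH; change (RtoC 0 : C_Ring) with (zero : C_Ring).
    rewrite (scal_zero_l v); apply plus_zero_l.
Qed.

Lemma meval_mlin (l : list V) (e : mexp) : meval l e = mlin (mcoef e) l.
Proof.
  induction e as [n| |a IHa b IHb|a IHa|c a IHa]; simpl.
  - symmetry; apply (mlin_var l n).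
  - symmetry; apply mlin_zero; reflexivity.
  - rewrite IHa, IHb; symmetry; apply mlin_plus.
  - rewrite IHa, <- (scal_opp_one (K := C_Ring)).
    change (opp (one : C_Ring)) with (Copp (RtoC 1)).
    rewrite <- mlin_scal; apply mlin_eq.
    generalize (mcoef a); clear; induction l as [|v l IH]; simpl; intros cs; [exact I|].
    split; [ring | apply (IH (fun n => cs (S n)))].
  - rewrite IHa; symmetry; apply mlin_scal.
Qed.

Lemma meval_eq (l : list V) (a b : mexp) :
  mcoefs_eq (mcoef a) (mcoef b) l -> meval l a = meval l b.
Proof. rewrite !meval_mlin; apply mlin_eq. Qed.

End ModuleExpressions.

(** Atoms are identified up to unification and not only syntactically, because one vector may be
    displayed through different canonical structures. *)
Ltac mod_lookup x l :=
  lazymatch l with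
  | @nil _ => constr:(None : option nat)
  | cons ?y ?l' =>
      match constr:(Set) with
      | _ => let _ := match constr:(Set) with _ => first [constr_eq x y | unify x y] end in constr:(Some O)
      | _ => let r := mod_lookup x l' in
             lazymatch r with
             | Some ?n => constr:(Some (S n))
             | None => constr:(None : option nat)
             end
      end
  end.

Ltac mod_atoms t l :=
  lazymatch t with
  | @plus _ ?a ?b => let l1 := mod_atoms a l in mod_atoms b l1
  | @minus _ ?a ?b => let l1 := mod_atoms a l in mod_atoms b l1
  | @opp _ ?a => mod_atoms a l
  | @scal _ _ ?c ?a => mod_atoms a l
  | @zero _ => l
  | _ => let r := mod_lookup t l in
         lazymatch r with
         | Some _ => l
         | None => lazymatch type of l with
                   | list ?T => let x := constr:(t) in
                       lazymatch l with
                       | @nil _ => constr:(@cons T x (@nil T))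
                       | _ => mod_append l x T
                       end
                   end
         end
  end
with mod_append l x T :=
  lazymatch l with
  | @nil _ => constr:(@cons T x (@nil T))
  | cons ?y ?l' => let r := mod_append l' x T in constr:(@cons T y r)
  end.

Ltac mod_reify t l :=
  lazymatch t with
  | @plus _ ?a ?b => let u := mod_reify a l in let v := mod_reify b l in constr:(MPlus u v)
  | @minus _ ?a ?b =>
      let u := mod_reify a l in let v := mod_reify b l in constr:(MPlus u (MOpp v))
  | @opp _ ?a => let u := mod_reify a l in constr:(MOpp u)
  | @scal _ _ ?c ?a => let u := mod_reify a l in constr:(MScal c u)
  | @zero _ => constr:(MZero)
  | _ => let r := mod_lookup t l in
         lazymatch r with Some ?n => constr:(MVar n) end
  end.

Ltac c_unfold :=
  change (@plus C_AbelianMonoid) with Cplus in *;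
  change (@opp C_AbelianGroup) with Copp in *;
  change (@zero C_AbelianMonoid) with (RtoC 0) in *;
  change (@mult C_Ring) with Cmult in *;
  change (@one C_Ring) with (RtoC 1) in *.

(* Decides equations between linear combinations in a complex module, given
   that [ring] (or [field]) decides the equations between the coefficients. *)
Ltac module_with V tac :=
  lazymatch goal with
  | |- @eq _ ?a ?b =>
      let l0 := constr:(@nil (ModuleSpace.sort C_Ring V)) in
      let l1 := mod_atoms a l0 in
      let l2 := mod_atoms b l1 in
      let u := mod_reify a l2 in
      let v := mod_reify b l2 in
      change (@meval V l2 u = @meval V l2 v);
      apply meval_eq; cbn [mcoefs_eq mcoef Nat.eqb];
      repeat (split; [tac|]); exact I
  end.
Ltac module V := module_with V ltac:(c_unfold; ring).

(** * Norms under complex scalars *)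

Section Norms.

Context {V : NormedModule C_AbsRing}.
Implicit Types u v w : V.

(** The axioms of a normed module bound the norm of a multiple only from above; the same bound for
    the inverse scalar yields the reverse inequality. *)
Lemma norm_scalC (c : C) v : norm (scal (c : C_AbsRing) v) = Cmod c * norm v.
Proof.
  assert (hle : forall (d : C) w, norm (scal (d : C_AbsRing) w) <= Cmod d * norm w)
    by (intros; apply (norm_scal (K := C_AbsRing))).
  apply Rle_antisym; [apply hle|].
  destruct (Ceq_dec c 0) as [->|hc].
  { rewrite Cmod_0, Rmult_0_l; apply norm_ge_0. }
  pose proof (hle (/ c)%C (scal (c : C_AbsRing) v)) as h.
  replace (scal (/ c : C_AbsRing)%C (scal (c : C_AbsRing) v)) with v in h.
  2:{ symmetry; rewrite scal_assoc.
      change (mult (/ c : C_AbsRing)%C (c : C_AbsRing)) with (/ c * c)%C.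
      rewrite Cinv_l by exact hc; exact (scal_one v). }
  assert (hp : 0 < Cmod c) by (apply Cmod_gt_0; exact hc).
  rewrite Cmod_inv in h by exact hc.
  apply (Rmult_le_compat_l (Cmod c)) in h; [|lra].
  rewrite <- Rmult_assoc, Rinv_r, Rmult_1_l in h by lra; exact h.
Qed.

Lemma norm_minus_sym u v : norm (minus u v) = norm (minus v u).
Proof. rewrite <- (norm_opp (minus v u)), opp_minus; reflexivity. Qed.

Lemma norm_minus_triangle u v : norm (minus u v) <= norm u + norm v.
Proof. unfold minus; rewrite <- (norm_opp v); apply norm_triangle. Qed.

Lemma norm_minus_trans u v w : norm (minus u w) <= norm (minus u v) + norm (minus v w).
Proof. rewrite (minus_trans v); apply norm_triangle. Qed.

Lemma norm_le_add u v : norm u <= norm v + norm (minus u v).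
Proof.
  replace u with (plus v (minus u v)) at 1; [apply norm_triangle|].
  module (NormedModule.ModuleSpace C_AbsRing V).
Qed.

Lemma minus_zero_iff u v : minus u v = zero <-> u = v.
Proof.
  split; [|intros ->; apply minus_eq_zero]; intros h.
  replace u with (plus (minus u v) v); [rewrite h; apply plus_zero_l|].
  module (NormedModule.ModuleSpace C_AbsRing V).
Qed.

Lemma norm_eq0_of_le v : (forall e, 0 < e -> norm v <= e) -> v = zero.
Proof.
  intros h; apply norm_eq_zero; apply Rle_antisym; [|apply norm_ge_0].
  apply Rnot_lt_le; intros hp; pose proof (h (norm v / 2)); lra.
Qed.

End Norms.

Ltac modv V := module (NormedModule.ModuleSpace C_AbsRing V).

(** * Fréchet derivatives by explicit estimates *)

Section Frechet.

Context {U V : NormedModule C_AbsRing}.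

(** Only the error estimate of [filterdiff]; linearity and boundedness of [L] are carried
    separately, mostly by the type [Lop]. *)
Definition frechet (f : U -> V) (x : U) (L : U -> V) : Prop :=
  forall eps, 0 < eps -> exists delta, 0 < delta /\ forall h, norm h < delta ->
    norm (minus (minus (f (plus x h)) (f x)) (L h)) <= eps * norm h.

Lemma locally_eps_delta (x : U) (P : U -> Prop) :
  locally x P <-> exists d, 0 < d /\ forall h, norm h < d -> P (plus x h).
Proof.
  split.
  - intros h; apply locally_norm_le_locally in h; destruct h as [d hd].
    exists d; split; [apply cond_pos|]; intros h hh; apply hd.
    unfold ball_norm; replace (minus (plus x h) x) with h; [exact hh|modv U].
  - intros [d [hd h]]; apply locally_le_locally_norm.
    exists (mkposreal d hd); intros y hy.
    replace y with (plus x (minus y x)) by modv U; apply h; exact hy.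
Qed.

Lemma filterdiff_frechet (f : U -> V) (x : U) (L : U -> V) :
  filterdiff f (locally x) L <-> is_linear L /\ frechet f x L.
Proof.
  split; intros [hL h]; split; try exact hL.
  - intros eps heps.
    destruct (proj1 (locally_eps_delta _ _) (h x (fun P hP => hP) (mkposreal eps heps)))
      as [d [hd hh]].
    exists d; split; [exact hd|]; intros k hk; specialize (hh k hk); simpl in hh.
    replace (minus (plus x k) x) with k in hh by modv U; exact hh.
  - intros y hy eps; apply is_filter_lim_locally_unique in hy; subst y.
    apply locally_eps_delta; destruct (h eps (cond_pos eps)) as [d [hd hh]].
    exists d; split; [exact hd|]; intros k hk.
    replace (minus (plus x k) x) with k by modv U; apply hh; exact hk.
Qed.

(** Along [t v] both errors are small multiples of [t]; after division by [t] the fixed vector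
    [A v - B v] has arbitrarily small norm. *)
Lemma frechet_unique (f : U -> V) (x : U) (A B : Lop U V) :
  frechet f x A -> frechet f x B -> A = B.
Proof.
  intros hA hB; apply Lop_ext; intros v; apply minus_zero_iff, norm_eq0_of_le.
  intros e he.
  assert (hn := norm_ge_0 v).
  set (e' := e / (2 * (norm v + 1))).
  assert (he' : 0 < e') by (apply Rdiv_lt_0_compat; lra).
  destruct (hA e' he') as [d1 [hd1 h1]], (hB e' he') as [d2 [hd2 h2]].
  (* Keeps the norm of [t v] below both radii; the summand [1] covers [norm v = 0]. *)
  set (t := Rmin d1 d2 / (2 * (norm v + 1))).
  assert (hm : 0 < Rmin d1 d2) by (apply Rmin_pos; lra).
  assert (ht : 0 < t) by (apply Rdiv_lt_0_compat; lra).
  set (h := scal (RtoC t : C_AbsRing) v).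
  assert (hh : norm h = t * norm v) by (apply norm_scal_RtoC; exact ht).
  assert (hl : norm h < Rmin d1 d2).
  { rewrite hh; unfold t.
    apply Rle_lt_trans with (Rmin d1 d2 * (norm v / (2 * (norm v + 1)))).
    - apply Req_le; field; lra.
    - rewrite <- (Rmult_1_r (Rmin d1 d2)) at 2; apply Rmult_lt_compat_l; [lra|].
      apply Rmult_lt_reg_r with (2 * (norm v + 1)); [lra|].
      unfold Rdiv; rewrite Rmult_assoc, Rinv_l by lra; lra. }
  pose proof (Rmin_l d1 d2); pose proof (Rmin_r d1 d2).
  specialize (h1 h ltac:(lra)); specialize (h2 h ltac:(lra)).
  assert (hs : t * norm (minus (A v) (B v)) <= t * (2 * e' * norm v)).
  { rewrite <- norm_scal_RtoC by exact ht.
    replace (scal (RtoC t : C_AbsRing) (minus (A v) (B v))) with (minus (A h) (B h)).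
    2:{ unfold h; rewrite (linear_scal _ (Lop_is_linear A)), (linear_scal _ (Lop_is_linear B)).
        modv V. }
    eapply Rle_trans; [apply (norm_minus_trans _ (minus (f (plus x h)) (f x)))|].
    rewrite norm_minus_sym; rewrite hh in h1, h2; lra. }
  apply Rmult_le_reg_l in hs; [|exact ht].
  apply Rle_trans with (1 := hs); unfold e'.
  replace (2 * (e / (2 * (norm v + 1))) * norm v) with (e * (norm v / (norm v + 1)))
    by (field; lra).
  rewrite <- (Rmult_1_r e) at 2; apply Rmult_le_compat_l; [lra|].
  apply Rmult_le_reg_r with (norm v + 1); [lra|].
  unfold Rdiv; rewrite Rmult_assoc, Rinv_l by lra; lra.
Qed.

Lemma fderiv_frechet (f : U -> V) (x : U) :
  ex_filterdiff f (locally x) -> frechet f x (fderiv f x).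
Proof. intros h; apply fderiv_correct in h; apply filterdiff_frechet in h; tauto. Qed.

Lemma ex_filterdiff_frechet (f : U -> V) (x : U) (L : Lop U V) :
  frechet f x L -> ex_filterdiff f (locally x).
Proof.
  intros h; exists L; apply filterdiff_frechet; split; [apply Lop_is_linear | exact h].
Qed.

Lemma fderiv_eq (f : U -> V) (x : U) (L : Lop U V) : frechet f x L -> fderiv f x = L.
Proof.
  intros h; apply (frechet_unique f x); [|exact h].
  apply fderiv_frechet, ex_filterdiff_frechet with L; exact h.
Qed.

Lemma frechet_ext_loc (f g : U -> V) (x : U) (L : U -> V) (d : R) :
  0 < d -> (forall h, norm h < d -> f (plus x h) = g (plus x h)) ->
  frechet f x L -> frechet g x L.
Proof.
  intros hd he h e hep; destruct (h e hep) as [d' [hd' h']].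
  exists (Rmin d d'); split; [apply Rmin_pos; assumption|]; intros k hk.
  pose proof (Rmin_l d d'); pose proof (Rmin_r d d').
  rewrite <- (he k) by lra.
  assert (h0 : f x = g x).
  { pose proof (he zero) as h0; rewrite plus_zero_r in h0; apply h0; rewrite norm_zero; lra. }
  rewrite <- h0; apply h'; lra.
Qed.

Lemma frechet_continuous (f : U -> V) (x : U) (L : Lop U V) :
  frechet f x L -> forall e, 0 < e -> exists d, 0 < d /\
    forall h, norm h < d -> norm (minus (f (plus x h)) (f x)) <= e.
Proof.
  intros h e he; destruct (h 1 Rlt_0_1) as [d [hd hh]].
  pose proof (opnorm_ge0 L).
  assert (hp : 0 < e / (opnorm L + 1)) by (apply Rdiv_lt_0_compat; lra).
  exists (Rmin d (e / (opnorm L + 1))); split; [apply Rmin_pos; assumption|].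
  intros k hk; pose proof (Rmin_l d (e / (opnorm L + 1)));
    pose proof (Rmin_r d (e / (opnorm L + 1))).
  specialize (hh k ltac:(lra)); pose proof (opnorm_bound L k) as hb.
  eapply Rle_trans; [apply (norm_le_add _ (L k))|].
  apply Rle_trans with ((opnorm L + 1) * norm k); [lra|].
  apply Rle_trans with ((opnorm L + 1) * (e / (opnorm L + 1)));
    [apply Rmult_le_compat_l; lra|apply Req_le; field; lra].
Qed.

End Frechet.

(** * The Hahn-Banach theorem *)

Section HahnBanach.

Context {V : NormedModule C_AbsRing}.
Implicit Types (u v w : V) (p q : V -> R).

Definition rscal (t : R) (v : V) : V := scal (RtoC t : C_AbsRing) v.

(** Homogeneity is asked for positive real factors only: the complex structure enters after a real
    linear functional has been found. *)
Definition sublinear q : Prop :=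
  (forall u v, q (plus u v) <= q u + q v) /\
  (forall t u, 0 < t -> q (rscal t u) = t * q u).

Lemma sublinear_norm : sublinear norm.
Proof.
  split; [exact norm_triangle|]; intros t u ht; apply norm_scal_RtoC; exact ht.
Qed.

Lemma sublinear_zero q : sublinear q -> q zero = 0.
Proof.
  intros [_ h]; pose proof (h 2 zero ltac:(lra)) as h2.
  replace (rscal 2 zero) with (zero : V) in h2 by (unfold rscal; modv V); lra.
Qed.

Lemma sublinear_opp q : sublinear q -> forall u, - q (opp u) <= q u.
Proof.
  intros hq u; pose proof (sublinear_zero q hq) as h0; destruct hq as [h _].
  pose proof (h u (opp u)) as h1; replace (plus u (opp u)) with (zero : V) in h1 by modv V; lra.
Qed.

Lemma sublinear_eq0 q u : sublinear q -> u = zero -> q u = 0.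
Proof. intros hq ->; apply sublinear_zero; exact hq. Qed.

Lemma rscal_plus t u v : rscal t (plus u v) = plus (rscal t u) (rscal t v).
Proof. unfold rscal; modv V. Qed.

Lemma rscal_rscal s t u : rscal s (rscal t u) = rscal (s * t) u.
Proof. unfold rscal; rewrite RtoC_mult; modv V. Qed.

Lemma rscal_plus_l s t u : rscal (s + t) u = plus (rscal s u) (rscal t u).
Proof. unfold rscal; rewrite RtoC_plus; modv V. Qed.

(* Meaningful only for nonempty sets that are bounded below: [real] maps
   infinite values to [0]. *)
Definition inf (E : R -> Prop) : R := - real (Lub_Rbar (fun x => E (- x))).

Lemma inf_spec (E : R -> Prop) (m : R) :
  (exists x, E x) -> (forall x, E x -> m <= x) ->
  (forall x, E x -> inf E <= x) /\ (forall b, (forall x, E x -> b <= x) -> b <= inf E).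
Proof.
  intros [x0 hx0] hm; unfold inf.
  destruct (Lub_Rbar_correct (fun x => E (- x))) as [hub hlub].
  assert (h1 : Rbar_le (Lub_Rbar (fun x => E (- x))) (- m)).
  { apply hlub; intros x hx; simpl; pose proof (hm _ hx); lra. }
  assert (h2 : Rbar_le (- x0) (Lub_Rbar (fun x => E (- x)))).
  { apply hub; rewrite Ropp_involutive; exact hx0. }
  destruct (Lub_Rbar (fun x => E (- x))) as [l| |]; simpl in *; try contradiction.
  split.
  - intros x hx; assert (h : - x <= l); [apply (hub (- x))|lra].
    rewrite Ropp_involutive; exact hx.
  - intros b hb; assert (h : l <= - b); [|lra].
    apply (hlub (Finite (- b))); intros x hx; simpl; pose proof (hb _ hx); lra.
Qed.

(* Lowers [q] along the ray of [y]; a minimal [q] is left unchanged, and this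
   forces it to be additive. *)
Definition ray_inf q (y u : V) : R :=
  inf (fun r => exists t, 0 < t /\ r = q (plus u (rscal t y)) - t * q y).

Section RayInf.

Context (q : V -> R) (hq : sublinear q) (y : V).

(** The infimum is finite: subadditivity applied to [t y = (u + t y) + (- u)] bounds every term from
    below by [- q (- u)]. *)
Lemma ray_inf_spec u :
  (forall t, 0 < t -> ray_inf q y u <= q (plus u (rscal t y)) - t * q y) /\
  (forall b, (forall t, 0 < t -> b <= q (plus u (rscal t y)) - t * q y) -> b <= ray_inf q y u).
Proof.
  destruct (inf_spec (fun r => exists t, 0 < t /\ r = q (plus u (rscal t y)) - t * q y)
              (- q (opp u))) as [h1 h2].
  - eexists; exists 1; split; [lra|reflexivity].
  - intros x [t [ht ->]]; destruct hq as [hs hh].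
    pose proof (hs (plus u (rscal t y)) (opp u)) as h; rewrite <- (hh t y ht).
    replace (plus (plus u (rscal t y)) (opp u)) with (rscal t y) in h by modv V; lra.
  - split.
    + intros t ht; apply h1; exists t; split; [exact ht|reflexivity].
    + intros b hb; apply h2; intros x [t [ht ->]]; auto.
Qed.

Lemma ray_inf_le u : ray_inf q y u <= q u.
Proof.
  pose proof (proj1 (ray_inf_spec u) 1 Rlt_0_1) as h; destruct hq as [hs hh].
  pose proof (hs u (rscal 1 y)) as h1; rewrite (hh 1 y Rlt_0_1) in h1; lra.
Qed.

Lemma sublinear_ray_inf : sublinear (ray_inf q y).
Proof.
  destruct hq as [hs hh].
  assert (hscal : forall t u, 0 < t -> t * ray_inf q y u <= ray_inf q y (rscal t u)).
  { intros t u ht; apply (proj2 (ray_inf_spec _)); intros s hst.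
    assert (hd : 0 < s / t) by (apply Rdiv_lt_0_compat; lra).
    pose proof (proj1 (ray_inf_spec u) (s / t) hd) as h.
    apply (Rmult_le_compat_l t) in h; [|lra].
    apply Rle_trans with (1 := h); rewrite Rmult_minus_distr_l, <- hh by exact ht.
    rewrite rscal_plus, rscal_rscal.
    replace (t * (s / t)) with s by (field; lra).
    replace (t * (s / t * q y)) with (s * q y) by (field; lra); apply Rle_refl. }
  split.
  - intros u v.
    (* Parameter [t] for [u] and parameter [s] for [v] are matched with parameter [t + s] for the
       sum. *)
    assert (h : forall t, 0 < t ->
      ray_inf q y (plus u v) - (q (plus u (rscal t y)) - t * q y) <= ray_inf q y v).
    { intros t ht; apply (proj2 (ray_inf_spec _)); intros s hst.
      pose proof (proj1 (ray_inf_spec (plus u v)) (t + s) ltac:(lra)) as h.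
      pose proof (hs (plus u (rscal t y)) (plus v (rscal s y))) as h1.
      replace (plus (plus u (rscal t y)) (plus v (rscal s y)))
        with (plus (plus u v) (rscal (t + s) y)) in h1
        by (rewrite rscal_plus_l; modv V).
      lra. }
    assert (h' : ray_inf q y (plus u v) - ray_inf q y v <= ray_inf q y u); [|lra].
    apply (proj2 (ray_inf_spec _)); intros t ht; pose proof (h t ht); lra.
  - intros t u ht; apply Rle_antisym; [|apply hscal; exact ht].
    pose proof (hscal (/ t) (rscal t u) (Rinv_0_lt_compat _ ht)) as h.
    rewrite rscal_rscal, Rinv_l in h by lra.
    replace (rscal 1 u) with u in h by (symmetry; apply (scal_one u)).
    apply (Rmult_le_compat_l t) in h; [|lra].
    rewrite <- Rmult_assoc, Rinv_r, Rmult_1_l in h by lra; exact h.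
Qed.

(** The parameter [t = 1] suffices. The norm is lowered along [x] before minimizing, so that every
    additive functional below satisfies [q (- x) <= - norm x] and therefore attains [norm x] at
    [x]. *)
Lemma ray_inf_opp : ray_inf q y (opp y) <= - q y.
Proof.
  pose proof (proj1 (ray_inf_spec (opp y)) 1 Rlt_0_1) as h.
  match type of h with _ <= q ?z - _ =>
    rewrite (sublinear_eq0 q z hq) in h by (unfold rscal; modv V) end.
  lra.
Qed.

End RayInf.

Lemma minimal_sublinear_additive q :
  sublinear q -> (forall q', sublinear q' -> (forall u, q' u <= q u) -> q' = q) ->
  forall u v, q (plus u v) = q u + q v.
Proof.
  intros hq hmin u y; apply Rle_antisym; [apply hq|].
  pose proof (hmin _ (sublinear_ray_inf q hq y) (ray_inf_le q hq y)) as he.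
  pose proof (proj1 (ray_inf_spec q hq y u) 1 Rlt_0_1) as h; rewrite he in h.
  replace (rscal 1 y) with y in h by (symmetry; apply (scal_one y)); lra.
Qed.

(** Zorn's lemma. The pointwise infimum of a chain is finite, since each member is at least
    [- p (- u)], and it is subadditive, since the smaller of two members of a chain serves both
    arguments. *)
Lemma exists_minimal_sublinear p : sublinear p ->
  exists q, sublinear q /\ (forall u, q u <= p u) /\
    (forall q', sublinear q' -> (forall u, q' u <= q u) -> q' = q).
Proof.
  intros hp.
  set (T := {q : V -> R | sublinear q /\ forall u, q u <= p u}).
  set (P := fun a b : T => forall u, proj1_sig b u <= proj1_sig a u).
  (* The order is reversed, so that a maximal element is a minimal functional, and it is decided
     classically to obtain a boolean relation. *)
  set (rel := fun a b : T => if excluded_middle_informative (P a b) then true else false).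
  assert (hr : forall a b, is_true (rel a b) <-> P a b).
  { intros a b; unfold rel; destruct excluded_middle_informative; split; auto.
    discriminate. }
  assert (hext : forall a b : T, proj1_sig a = proj1_sig b -> a = b).
  { intros [a ha] [b hb]; simpl; intros ->; f_equal; apply proof_irrelevance. }
  destruct (classical_sets.Zorn (T := T) (R := rel)) as [m hm].
  - intros t; apply hr; intros u; lra.
  - intros a b c h1 h2; apply hr in h1, h2; apply hr; intros u.
    specialize (h1 u); specialize (h2 u); lra.
  - intros a b h1 h2; apply hr in h1, h2; apply hext, functional_extensionality.
    intros u; apply Rle_antisym; auto.
  - intros A hA.
    destruct (classic (exists a, A a)) as [[a0 ha0]|hne].
    2:{ exists (exist _ p (conj hp (fun u => Rle_refl _))); intros s hs; exfalso; eauto. }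
    set (E := fun u r => exists a : T, A a /\ r = proj1_sig a u).
    assert (hE : forall u, (forall a, A a -> inf (E u) <= proj1_sig a u) /\
              (forall b, (forall a, A a -> b <= proj1_sig a u) -> b <= inf (E u))).
    { intros u; destruct (inf_spec (E u) (- p (opp u))) as [h1 h2].
      - exists (proj1_sig a0 u), a0; auto.
      - intros x [a [ha ->]]; destruct (proj2_sig a) as [hs hl].
        pose proof (sublinear_opp _ hs u); pose proof (hl (opp u)); lra.
      - split.
        + intros a ha; apply h1; exists a; auto.
        + intros b hb; apply h2; intros x [a [ha ->]]; auto. }
    assert (hs : sublinear (fun u => inf (E u))).
    { split.
      - intros u v.
        assert (h : forall a b, A a -> A b ->
                  inf (E (plus u v)) <= proj1_sig a u + proj1_sig b v).
        { assert (h : forall a b, A a -> A b -> P a b ->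
                  inf (E (plus u v)) <= proj1_sig a u + proj1_sig b v /\
                  inf (E (plus u v)) <= proj1_sig b u + proj1_sig a v).
          { intros a b ha hb hab; pose proof (hab u); pose proof (hab v).
            pose proof (proj1 (hE (plus u v)) b hb) as h1.
            destruct (proj2_sig b) as [[h2 _] _]; specialize (h2 u v); lra. }
          intros a b ha hb; destruct (hA a b ha hb) as [hab|hab]; apply hr in hab.
          - apply (h a b ha hb hab).
          - apply (h b a hb ha hab). }
        assert (h' : inf (E (plus u v)) - inf (E v) <= inf (E u)); [|lra].
        apply hE; intros a ha.
        assert (h' : inf (E (plus u v)) - proj1_sig a u <= inf (E v)); [|lra].
        apply hE; intros b hb; pose proof (h a b ha hb); lra.
      - assert (hle : forall t u, 0 < t -> t * inf (E u) <= inf (E (rscal t u))).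
        { intros t u ht; apply hE; intros a ha; destruct (proj2_sig a) as [[_ h2] _].
          rewrite h2 by exact ht; apply Rmult_le_compat_l; [lra|]; apply hE; exact ha. }
        intros t u ht; apply Rle_antisym; [|apply hle; exact ht].
        pose proof (hle (/ t) (rscal t u) (Rinv_0_lt_compat _ ht)) as h.
        rewrite rscal_rscal, Rinv_l in h by lra.
        replace (rscal 1 u) with u in h by (symmetry; apply (scal_one u)).
        apply (Rmult_le_compat_l t) in h; [|lra].
        rewrite <- Rmult_assoc, Rinv_r, Rmult_1_l in h by lra; exact h. }
    assert (hl : forall u, inf (E u) <= p u).
    { intros u; apply Rle_trans with (proj1_sig a0 u); [apply hE; exact ha0|].
      apply (proj2_sig a0). }
    exists (exist _ (fun u => inf (E u)) (conj hs hl)).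
    intros s hA'; apply hr; intros u; apply hE; exact hA'.
  - exists (proj1_sig m); destruct (proj2_sig m) as [h1 h2]; split; [exact h1|].
    split; [exact h2|]; intros q' hq' hle.
    assert (hl : forall u, q' u <= p u) by (intros u; eapply Rle_trans; [apply hle|apply h2]).
    specialize (hm (exist _ q' (conj hq' hl))).
    change q' with (proj1_sig (exist (fun q => sublinear q /\ forall u, q u <= p u)
      q' (conj hq' hl))).
    f_equal; apply hm, hr; exact hle.
Qed.

(** A minimal sublinear functional below the norm is additive, hence real linear. It is the real
    part of a complex linear functional, whose modulus is controlled by rotating the argument. *)
Theorem hahn_banach_norming (x : V) :
  exists phi : Lop V C_NormedModule,
    phi x = RtoC (norm x) /\ forall v, Cmod (phi v) <= norm v.
Proof.
  destruct (exists_minimal_sublinear _ (sublinear_ray_inf _ sublinear_norm x))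
    as [q [hq [hle hmin]]].
  assert (hadd := minimal_sublinear_additive q hq hmin).
  assert (hn : forall u, q u <= norm u).
  { intros u; eapply Rle_trans; [apply hle|apply ray_inf_le, sublinear_norm]. }
  assert (hopp : forall u, q (opp u) = - q u).
  { intros u; pose proof (hadd u (opp u)) as h; replace (plus u (opp u)) with (zero : V) in h by modv V.
    rewrite (sublinear_zero q hq) in h; lra. }
  assert (hR : forall t u, q (rscal t u) = t * q u).
  { intros t u; destruct (Rtotal_order t 0) as [h|[->|h]].
    - replace (rscal t u) with (opp (rscal (- t) u)).
      2:{ unfold rscal; rewrite RtoC_opp; modv V. }
      rewrite hopp, (proj2 hq) by lra; lra.
    - rewrite (sublinear_eq0 q (rscal 0 u) hq) by (unfold rscal; modv V); lra.
    - apply hq; exact h. }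
  assert (hqx : q x = norm x).
  { apply Rle_antisym; [apply hn|].
    pose proof (hle (opp x)) as h; rewrite hopp in h.
    pose proof (ray_inf_opp _ sublinear_norm x); lra. }
  (* The only complex linear functional with real part [q]. *)
  set (phi := fun v => (q v, - q (scal (Ci : C_AbsRing) v)) : C).
  assert (hscal : forall (c : C) v, q (scal (c : C_AbsRing) v) =
            Re c * q v + Im c * q (scal (Ci : C_AbsRing) v)).
  { intros [a b] v; simpl.
    replace (scal ((a, b) : C_AbsRing) v)
      with (plus (rscal a v) (rscal b (scal (Ci : C_AbsRing) v))).
    - rewrite hadd, !hR; reflexivity.
    - unfold rscal; module_with (NormedModule.ModuleSpace C_AbsRing V)
        ltac:(apply injective_projections; simpl; ring). }
  assert (hphis : forall (c : C) v, phi (scal (c : C_AbsRing) v) = (c * phi v)%C).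
  { intros [a b] v; unfold phi; rewrite (hscal (a, b)).
    replace (scal (Ci : C_AbsRing) (scal ((a, b) : C_AbsRing) v))
      with (scal ((- b, a) : C_AbsRing) v)
      by (module_with (NormedModule.ModuleSpace C_AbsRing V)
        ltac:(apply injective_projections; simpl; ring)).
    rewrite (hscal (- b, a)); apply injective_projections; simpl; ring. }
  assert (hb : forall v, Cmod (phi v) <= norm v).
  { intros v; destruct (Req_dec (Cmod (phi v)) 0) as [h0|h0];
      [rewrite h0; apply norm_ge_0|].
    assert (hp : 0 < Cmod (phi v)) by (pose proof (Cmod_ge_0 (phi v)); lra).
    (* The rotation making [phi (c v)] equal to [Cmod (phi v)], so that the modulus is a value of
       [q]. *)
    set (c := (Cconj (phi v) / RtoC (Cmod (phi v)))%C).
    assert (hne : RtoC (Cmod (phi v)) <> 0%C) by (intros h; injection h; exact h0).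
    assert (hc : Cmod c = 1).
    { unfold c; rewrite Cmod_div, Cmod_conj, Cmod_R, Rabs_pos_eq by (assumption || lra).
      field; exact h0. }
    assert (hcv : phi (scal (c : C_AbsRing) v) = RtoC (Cmod (phi v))).
    { rewrite hphis; unfold c.
      replace (Cconj (phi v) / RtoC (Cmod (phi v)) * phi v)%C
        with (phi v * Cconj (phi v) / RtoC (Cmod (phi v)))%C by (unfold Cdiv; ring).
      rewrite <- Cmod2_conj, RtoC_pow; simpl; rewrite Cmult_1_r.
      unfold Cdiv; rewrite <- Cmult_assoc, Cinv_r by exact hne; ring. }
    apply Rle_trans with (q (scal (c : C_AbsRing) v)).
    - change (Cmod (phi v) <= Re (phi (scal (c : C_AbsRing) v))); rewrite hcv; simpl; lra.
    - eapply Rle_trans; [apply hn|]; rewrite norm_scalC, hc; lra. }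
  assert (hlin : is_linear (phi : V -> C_NormedModule)).
  { split.
    - intros u v; apply injective_projections; [exact (hadd u v)|].
      assert (he : q (scal (Ci : C_AbsRing) (plus u v)) =
                q (scal (Ci : C_AbsRing) u) + q (scal (Ci : C_AbsRing) v))
        by (rewrite <- hadd; f_equal; modv V).
      change (- q (scal (Ci : C_AbsRing) (plus u v)) =
        - q (scal (Ci : C_AbsRing) u) + - q (scal (Ci : C_AbsRing) v)); rewrite he; ring.
    - intros c v; apply hphis.
    - exists 1; split; [lra|]; intros v; rewrite Rmult_1_l; apply hb. }
  exists (mkLop _ hlin); split; [|exact hb]; simpl.
  pose proof (hb x) as h; unfold phi in *; rewrite hqx in *.
  (* The real part of [phi x] already exhausts the bound [norm x], which forces the imaginary part
     to vanish. *)
  assert (hz : q (scal (Ci : C_AbsRing) x) = 0).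
  { pose proof (norm_ge_0 x); unfold Cmod in h; simpl in h.
    assert (h2 : norm x * norm x + q (scal (Ci : C_AbsRing) x) * q (scal (Ci : C_AbsRing) x)
              <= norm x * norm x).
    { apply Rsqr_incr_1 in h; [|apply sqrt_pos|lra].
      rewrite Rsqr_sqrt in h by nra; unfold Rsqr in h; lra. }
    nra. }
  rewrite hz; unfold RtoC; f_equal; ring.
Qed.

End HahnBanach.

(** * Complex derivatives *)

Ltac c_type :=
  repeat match goal with
  | x : NormedModule.sort C_AbsRing C_NormedModule |- _ =>
      change (NormedModule.sort C_AbsRing C_NormedModule) with C in x
  | x : AbsRing.sort C_AbsRing |- _ => change (AbsRing.sort C_AbsRing) with C in x
  end.
Ltac cring := c_type; cbv beta; lazymatch goal with |- @eq _ ?a ?b => change (@eq C a b); ring end.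
Ltac cfield := c_type; cbv beta; lazymatch goal with |- @eq _ ?a ?b => change (@eq C a b); field end.

Section FrechetChain.

Context {U V W : NormedModule C_AbsRing}.

Definition Lcomp (B : Lop V W) (A : Lop U V) : Lop U W :=
  mkLop _ (is_linear_comp _ _ (Lop_is_linear A) (Lop_is_linear B)).

Lemma frechet_comp (f : U -> V) (g : V -> W) (x : U) (A : Lop U V) (B : Lop V W) :
  frechet f x A -> frechet g (f x) B -> frechet (fun u => g (f u)) x (Lcomp B A).
Proof.
  intros hf hg.
  assert (hf' : filterdiff f (locally x) A)
    by (apply filterdiff_frechet; split; [apply Lop_is_linear|exact hf]).
  assert (hg' : filterdiff g (locally (f x)) B)
    by (apply filterdiff_frechet; split; [apply Lop_is_linear|exact hg]).
  pose proof (filterdiff_comp' f g x A B hf' hg') as h.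
  apply filterdiff_frechet in h; exact (proj2 h).
Qed.

Lemma frechet_linear (A : Lop U V) (x : U) : frechet A x A.
Proof.
  intros e he; exists 1; split; [lra|]; intros h _.
  rewrite (linear_plus _ (Lop_is_linear A)).
  replace (minus (minus (plus (A x) (A h)) (A x)) (A h)) with (zero : V) by modv V.
  rewrite norm_zero; apply Rmult_le_pos; [lra|apply norm_ge_0].
Qed.

Lemma frechet_plus (f g : U -> V) (x : U) (A B : Lop U V) :
  frechet f x A -> frechet g x B -> frechet (fun u => plus (f u) (g u)) x (plus A B).
Proof.
  intros hf hg e he.
  destruct (hf (e / 2) ltac:(lra)) as [d1 [hd1 h1]], (hg (e / 2) ltac:(lra)) as [d2 [hd2 h2]].
  exists (Rmin d1 d2); split; [apply Rmin_pos; assumption|]; intros h hh.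
  pose proof (Rmin_l d1 d2); pose proof (Rmin_r d1 d2).
  specialize (h1 h ltac:(lra)); specialize (h2 h ltac:(lra)).
  change ((plus A B : Lop U V) h) with (plus (A h) (B h)).
  replace (minus (minus (plus (f (plus x h)) (g (plus x h))) (plus (f x) (g x))) (plus (A h) (B h)))
    with (plus (minus (minus (f (plus x h)) (f x)) (A h)) (minus (minus (g (plus x h)) (g x)) (B h)))
    by modv V.
  eapply Rle_trans; [apply norm_triangle|]; lra.
Qed.

Lemma frechet_const (v : V) (x : U) : frechet (fun _ : U => v) x (zero : Lop U V).
Proof.
  intros e he; exists 1; split; [lra|]; intros h _.
  change ((zero : Lop U V) h) with (zero : V).
  replace (minus (minus v v) (zero : V)) with (zero : V) by modv V.
  rewrite norm_zero; apply Rmult_le_pos; [lra|apply norm_ge_0].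
Qed.

End FrechetChain.

Section ComplexDerivative.

Context {V : NormedModule C_AbsRing}.

Lemma is_linear_ray (d : V) : is_linear (fun h : C_NormedModule => scal (h : C_AbsRing) d).
Proof.
  split.
  - intros x y; change (plus x y) with (plus (x : C_Ring) (y : C_Ring)).
    exact (scal_distr_r (x : C_AbsRing) y d).
  - intros c x; change (scal c x) with (mult (c : C_Ring) (x : C_Ring)).
    symmetry; exact (scal_assoc (c : C_AbsRing) x d).
  - exists (norm d + 1); split; [pose proof (norm_ge_0 d); lra|]; intros x.
    rewrite norm_scalC; change (norm x) with (Cmod x).
    pose proof (Cmod_ge_0 x); pose proof (norm_ge_0 d); nra.
Qed.

Definition Lray (d : V) : Lop C_NormedModule V := mkLop _ (is_linear_ray d).

(** One notion for scalar and vector values: the derivative [d] stands for the linear map taking [h]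
    to [h d], so the rules for [frechet] are inherited. *)
Definition hasd (f : C -> V) (z : C) (d : V) : Prop := frechet (f : C_NormedModule -> V) z (Lray d).

Lemma hasd_unique (f : C -> V) z (d d' : V) : hasd f z d -> hasd f z d' -> d = d'.
Proof.
  intros h h'; pose proof (frechet_unique f z _ _ h h') as he.
  assert (h1 : Lray d (RtoC 1) = Lray d' (RtoC 1)) by (rewrite he; reflexivity); simpl in h1.
  etransitivity; [symmetry; exact (scal_one d)|]; etransitivity; [exact h1|exact (scal_one d')].
Qed.

Lemma hasd_eq (f : C -> V) z (d d' : V) : hasd f z d -> d = d' -> hasd f z d'.
Proof. intros h <-; exact h. Qed.

Lemma hasd_ext_loc (f g : C -> V) z (d : V) (r : R) :
  0 < r -> (forall h : C, Cmod h < r -> f (z + h)%C = g (z + h)%C) -> hasd f z d -> hasd g z d.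
Proof.
  intros hr he; refine (frechet_ext_loc (U := C_NormedModule) f g z _ r hr _).
  intros h hh; apply he; exact hh.
Qed.

Lemma frechet_hasd (f : C_NormedModule -> V) z (L : Lop C_NormedModule V) :
  frechet f z L -> hasd f z (L (RtoC 1)).
Proof.
  intros h; unfold hasd; replace (Lray (L (RtoC 1))) with L; [exact h|].
  apply Lop_ext; intros c; simpl.
  rewrite <- (linear_scal _ (Lop_is_linear L) (c : C_AbsRing) (RtoC 1)); f_equal.
  change (c = c * 1)%C; cring.
Qed.

End ComplexDerivative.

Lemma hasd_comp_linear {V W : NormedModule C_AbsRing} (f : C -> V) (A : Lop V W) z d :
  hasd f z d -> hasd (fun s => A (f s)) z (A d).
Proof.
  intros h; eapply hasd_eq.
  - apply (frechet_hasd (V := W)); apply (frechet_comp (U := C_NormedModule) f A z _ A h).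
    apply frechet_linear.
  - simpl; f_equal; exact (scal_one d).
Qed.

Lemma frechet_line {U V : NormedModule C_AbsRing} (f : U -> V) (L : Lop U V) (p q : U) (s : C) :
  frechet f (plus p (scal (s : C_AbsRing) q)) L ->
  hasd (fun t : C => f (plus p (scal (t : C_AbsRing) q))) s (L q).
Proof.
  intros h; eapply hasd_eq.
  - apply (frechet_hasd (V := V)).
    apply (frechet_comp (U := C_NormedModule) (fun t => plus p (scal (t : C_AbsRing) q)) f s
      (plus (zero : Lop C_NormedModule U) (Lray q)) L); [|exact h].
    apply frechet_plus; [apply frechet_const|apply (frechet_linear (Lray q))].
  - simpl; f_equal; change (plus (zero : U) (scal (RtoC 1 : C_AbsRing) q) = q).
    etransitivity; [apply plus_zero_l|exact (scal_one q)].
Qed.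

(** * Differentiation rules for scalar functions *)

Section ScalarDerivative.

Implicit Types f g : C -> C.
Notation hasd := (hasd (V := C_NormedModule)).

Lemma hasd_iff f z d : hasd f z d <->
  forall e, 0 < e -> exists r, 0 < r /\ forall h : C, Cmod h < r ->
    Cmod (f (z + h) - f z - h * d)%C <= e * Cmod h.
Proof. split; intros h; exact h. Qed.

Lemma hasd_cont f z d : hasd f z d -> forall e, 0 < e -> exists r, 0 < r /\
  forall h : C, Cmod h < r -> Cmod (f (z + h) - f z)%C <= e.
Proof. intros h; exact (frechet_continuous (U := C_NormedModule) f z (Lray d) h). Qed.

Lemma hasd_const (c z : C) : hasd (fun _ => c) z (RtoC 0).
Proof.
  apply hasd_iff; intros e he; exists 1; split; [lra|]; intros h _.
  replace (c - c - h * 0)%C with (RtoC 0) by cring; rewrite Cmod_0.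
  apply Rmult_le_pos; [lra|apply Cmod_ge_0].
Qed.

Lemma hasd_id (z : C) : hasd (fun s => s) z (RtoC 1).
Proof.
  apply hasd_iff; intros e he; exists 1; split; [lra|]; intros h _.
  replace (z + h - z - h * 1)%C with (RtoC 0) by cring; rewrite Cmod_0.
  apply Rmult_le_pos; [lra|apply Cmod_ge_0].
Qed.

Lemma hasd_plus f g z d d' : hasd f z d -> hasd g z d' ->
  hasd (fun s => (f s + g s)%C) z (d + d')%C.
Proof.
  intros h h'; eapply hasd_eq.
  - apply frechet_hasd; exact (frechet_plus (U := C_NormedModule) f g z _ _ h h').
  - change (1 * d + 1 * d' = d + d')%C; cring.
Qed.

Lemma hasd_mult f g z d d' : hasd f z d -> hasd g z d' ->
  hasd (fun s => (f s * g s)%C) z (d * g z + f z * d')%C.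
Proof.
  intros hf hg; apply hasd_iff; intros e he.
  set (F := Cmod (f z)); set (G := Cmod (g z)); set (D := Cmod d); set (D' := Cmod d').
  assert (hF : 0 <= F) by apply Cmod_ge_0; assert (hG : 0 <= G) by apply Cmod_ge_0.
  assert (hD : 0 <= D) by apply Cmod_ge_0; assert (hD' : 0 <= D') by apply Cmod_ge_0.
  assert (h1 : 0 < e / (3 * (G + 1))) by (apply Rdiv_lt_0_compat; lra).
  assert (h2 : 0 < e / (3 * (F + 1))) by (apply Rdiv_lt_0_compat; lra).
  destruct (proj1 (hasd_iff _ _ _) hf _ h1) as [r1 [hr1 k1]].
  destruct (proj1 (hasd_iff _ _ _) hg _ h2) as [r2 [hr2 k2]].
  destruct (proj1 (hasd_iff _ _ _) hf 1 Rlt_0_1) as [r3 [hr3 k3]].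
  assert (h4 : 0 < e / (3 * (D + 1))) by (apply Rdiv_lt_0_compat; lra).
  destruct (hasd_cont _ _ _ hg _ h4) as [r4 [hr4 k4]].
  exists (Rmin (Rmin r1 r2) (Rmin r3 r4)); split; [repeat apply Rmin_pos; assumption|].
  intros h hh; set (m := Rmin _ _) in hh.
  assert (hm : m <= r1 /\ m <= r2 /\ m <= r3 /\ m <= r4).
  { unfold m; pose proof (Rmin_l (Rmin r1 r2) (Rmin r3 r4));
    pose proof (Rmin_r (Rmin r1 r2) (Rmin r3 r4));
    pose proof (Rmin_l r1 r2); pose proof (Rmin_r r1 r2);
    pose proof (Rmin_l r3 r4); pose proof (Rmin_r r3 r4); lra. }
  specialize (k1 h ltac:(lra)); specialize (k2 h ltac:(lra)).
  specialize (k3 h ltac:(lra)); specialize (k4 h ltac:(lra)).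
  replace (f (z + h) * g (z + h) - f z * g z - h * (d * g z + f z * d'))%C with
    ((f (z + h) - f z) * (g (z + h) - g z) + ((f (z + h) - f z - h * d) * g z
      + f z * (g (z + h) - g z - h * d')))%C by cring.
  assert (hh0 := Cmod_ge_0 h).
  eapply Rle_trans; [apply Cmod_triangle|].
  eapply Rle_trans; [apply Rplus_le_compat_l, Cmod_triangle|].
  rewrite !Cmod_mult; fold F G.
  assert (a1 : Cmod (f (z + h) - f z)%C <= (D + 1) * Cmod h).
  { replace (f (z + h) - f z)%C with ((f (z + h) - f z - h * d) + h * d)%C by cring.
    eapply Rle_trans; [apply Cmod_triangle|]; rewrite Cmod_mult; fold D; lra. }
  assert (b1 : Cmod (f (z + h) - f z)%C * Cmod (g (z + h) - g z)%C <= e / 3 * Cmod h).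
  { apply Rle_trans with ((D + 1) * Cmod h * (e / (3 * (D + 1)))).
    - apply Rmult_le_compat; try apply Cmod_ge_0; assumption.
    - apply Req_le; field; lra. }
  assert (b2 : Cmod (f (z + h) - f z - h * d)%C * G <= e / 3 * Cmod h).
  { apply Rle_trans with (e / (3 * (G + 1)) * Cmod h * (G + 1)).
    - apply Rmult_le_compat; try apply Cmod_ge_0; try assumption; lra.
    - apply Req_le; field; lra. }
  assert (b3 : F * Cmod (g (z + h) - g z - h * d')%C <= e / 3 * Cmod h).
  { apply Rle_trans with ((F + 1) * (e / (3 * (F + 1)) * Cmod h)).
    - apply Rmult_le_compat; try apply Cmod_ge_0; try assumption; lra.
    - apply Req_le; field; lra. }
  lra.
Qed.

Lemma hasd_scal (c : C) f z d : hasd f z d -> hasd (fun s => (c * f s)%C) z (c * d)%C.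
Proof.
  intros h; eapply hasd_eq; [apply hasd_mult; [apply hasd_const|exact h]|]; cring.
Qed.

Lemma hasd_opp f z d : hasd f z d -> hasd (fun s => (- f s)%C) z (- d)%C.
Proof.
  intros h; apply (hasd_ext_loc (fun s => (- (1) * f s)%C) _ _ _ 1 Rlt_0_1).
  - intros; cring.
  - eapply hasd_eq; [apply hasd_scal, h|]; cring.
Qed.

Lemma hasd_minus f g z d d' : hasd f z d -> hasd g z d' ->
  hasd (fun s => (f s - g s)%C) z (d - d')%C.
Proof. intros h h'; exact (hasd_plus _ _ _ _ _ h (hasd_opp _ _ _ h')). Qed.

Lemma hasd_comp f g z d d' : hasd f z d -> hasd g (f z) d' ->
  hasd (fun s => g (f s)) z (d * d')%C.
Proof.
  intros hf hg; eapply hasd_eq.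
  - apply frechet_hasd; exact (frechet_comp (U := C_NormedModule) (V := C_NormedModule) f g z _ _ hf hg).
  - change (1 * d * d' = d * d')%C; cring.
Qed.

Lemma hasd_inv (z : C) : z <> 0%C -> hasd (fun s => (/ s)%C) z (- / (z * z))%C.
Proof.
  intros hz; apply hasd_iff; intros e he.
  assert (hp : 0 < Cmod z) by (apply Cmod_gt_0; exact hz).
  set (m := Cmod z) in *.
  assert (hm3 : 0 < e * (m * m * m) / 2) by (apply Rdiv_lt_0_compat; [|lra]; repeat apply Rmult_lt_0_compat; lra).
  (* The first radius keeps [Cmod (z + h)] above [m / 2]; the second then bounds the exact remainder
     [h^2 / ((z + h) z^2)] by [e * Cmod h]. *)
  exists (Rmin (m / 2) (e * (m * m * m) / 2)); split; [apply Rmin_pos; lra|]; intros h hh.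
  pose proof (Rmin_l (m / 2) (e * (m * m * m) / 2)); pose proof (Rmin_r (m / 2) (e * (m * m * m) / 2)).
  assert (hzh : m / 2 <= Cmod (z + h)).
  { pose proof (Cmod_triangle (z + h) (- h)) as ht; rewrite Cmod_opp in ht.
    replace (z + h + - h)%C with z in ht by cring; fold m in ht; lra. }
  assert (hne : (z + h)%C <> 0%C) by (intros hc; rewrite hc, Cmod_0 in hzh; lra).
  replace (/ (z + h) - / z - h * - / (z * z))%C with (h * h / ((z + h) * (z * z)))%C
    by (cfield; split; assumption).
  assert (hne2 : ((z + h) * (z * z))%C <> 0%C) by (repeat apply Cmult_neq_0; assumption).
  rewrite Cmod_div, !Cmod_mult by exact hne2; fold m.
  assert (hh0 := Cmod_ge_0 h).
  apply Rmult_le_reg_r with (Cmod (z + h) * (m * m)); [apply Rmult_lt_0_compat; nra|].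
  unfold Rdiv; rewrite Rmult_assoc, Rinv_l, Rmult_1_r by (apply Rgt_not_eq, Rmult_lt_0_compat; nra).
  apply Rle_trans with (e * Cmod h * (m / 2 * (m * m))).
  - replace (e * Cmod h * (m / 2 * (m * m))) with (e * (m * m * m) / 2 * Cmod h) by field.
    apply Rmult_le_compat_r; lra.
  - apply Rmult_le_compat_l; [apply Rmult_le_pos; lra|]; apply Rmult_le_compat_r; nra.
Qed.

Lemma hasd_div f g z d d' : hasd f z d -> hasd g z d' -> g z <> 0%C ->
  hasd (fun s => (f s / g s)%C) z ((d - f z / g z * d') / g z)%C.
Proof.
  intros hf hg hne; eapply hasd_eq.
  - apply hasd_mult; [exact hf|]; apply (hasd_comp g (fun s => (/ s)%C) z d' (- / (g z * g z))%C hg).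
    apply hasd_inv; exact hne.
  - cfield; exact hne.
Qed.

Lemma hasd_line f (p q : C) (s d : C) : hasd f (p + s * q)%C d ->
  hasd (fun t => f (p + t * q)%C) s (q * d)%C.
Proof.
  intros h; apply hasd_comp; [|exact h].
  eapply hasd_eq; [apply hasd_plus; [apply hasd_const|apply hasd_mult; [apply hasd_id|apply hasd_const]]|].
  cring.
Qed.

End ScalarDerivative.

(** * Complex integrals *)

Notation hasdC := (hasd (V := C_NormedModule)).

Lemma Re_le_Cmod (z : C) : Re z <= Cmod z.
Proof. pose proof (re_le_Cmod z); pose proof (Rle_abs (Re z)); lra. Qed.

Lemma im_le_Cmod (z : C) : Rabs (Im z) <= Cmod z.
Proof. eapply Rle_trans; [apply Rmax_r|exact (Rmax_Cmod z)]. Qed.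

Lemma exists_rotation (z : C) : exists c : C, Cmod c = 1 /\ (c * z)%C = RtoC (Cmod z).
Proof.
  destruct (Ceq_dec z 0) as [->|hz].
  - exists (RtoC 1); rewrite Cmod_1, Cmod_0; split; [reflexivity|ring].
  - assert (hp : 0 < Cmod z) by (apply Cmod_gt_0; exact hz).
    assert (hne : RtoC (Cmod z) <> 0%C) by (intros h; injection h; lra).
    exists (Cconj z / RtoC (Cmod z))%C; split.
    + rewrite Cmod_div, Cmod_conj, Cmod_R, Rabs_pos_eq by (assumption || lra); field; lra.
    + replace (Cconj z / RtoC (Cmod z) * z)%C with (z * Cconj z / RtoC (Cmod z))%C
        by (unfold Cdiv; ring).
      rewrite <- Cmod2_conj, RtoC_pow; simpl; field; exact hne.
Qed.

Lemma real_derive_eps_delta (f : R -> R) (t l : R) :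
  (forall e, 0 < e -> exists r, 0 < r /\ forall h, Rabs h < r ->
     Rabs (f (t + h) - f t - h * l) <= e * Rabs h) -> is_derive f t l.
Proof.
  intros hf; apply is_derive_Reals; intros e he.
  destruct (hf (e / 2) ltac:(lra)) as [r [hr h]]; exists (mkposreal r hr); intros k hk hkr.
  specialize (h k hkr); assert (hp : 0 < Rabs k) by (apply Rabs_pos_lt; exact hk).
  replace ((f (t + k) - f t) / k - l) with ((f (t + k) - f t - k * l) / k) by (field; exact hk).
  unfold Rdiv; rewrite Rabs_mult, Rabs_inv.
  apply Rle_lt_trans with (e / 2 * Rabs k * / Rabs k).
  - apply Rmult_le_compat_r; [left; apply Rinv_0_lt_compat; exact hp|exact h].
  - rewrite Rmult_assoc, Rinv_r by lra; lra.
Qed.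

Lemma hasd_derive_Re (f : C -> C) (t : R) (d : C) :
  hasdC f (RtoC t) d -> is_derive (fun s => Re (f (RtoC s))) t (Re d).
Proof.
  intros h; apply real_derive_eps_delta; intros e he.
  destruct (proj1 (hasd_iff _ _ _) h e he) as [r [hr k]]; exists r; split; [exact hr|]; intros s hs.
  specialize (k (RtoC s)); rewrite Cmod_R, <- RtoC_plus in k; specialize (k hs).
  eapply Rle_trans; [|exact k]; eapply Rle_trans; [|apply re_le_Cmod].
  right; f_equal; c_type; unfold Re, Im; simpl; ring.
Qed.

Lemma hasd_derive_Im (f : C -> C) (t : R) (d : C) :
  hasdC f (RtoC t) d -> is_derive (fun s => Im (f (RtoC s))) t (Im d).
Proof.
  intros h; apply real_derive_eps_delta; intros e he.
  destruct (proj1 (hasd_iff _ _ _) h e he) as [r [hr k]]; exists r; split; [exact hr|]; intros s hs.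
  specialize (k (RtoC s)); rewrite Cmod_R, <- RtoC_plus in k; specialize (k hs).
  eapply Rle_trans; [|exact k]; eapply Rle_trans; [|apply im_le_Cmod].
  right; f_equal; c_type; unfold Re, Im; simpl; ring.
Qed.

(** The mean value theorem fails for complex values. Its real part survives, and suffices whenever
    the increment has been turned to the real axis. *)
Lemma hasd_mean_value (f : C -> C) (d : R -> C) :
  (forall t, 0 <= t <= 1 -> hasdC f (RtoC t) (d t)) ->
  exists t, 0 <= t <= 1 /\ Re (f (RtoC 1)) - Re (f (RtoC 0)) = Re (d t).
Proof.
  intros h.
  destruct (MVT_gen (fun s => Re (f (RtoC s))) 0 1 (fun t => Re (d t))) as [t [ht he]].
  - intros t ht; rewrite Rmin_left, Rmax_right in ht by lra.
    apply hasd_derive_Re, h; lra.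
  - intros t ht; rewrite Rmin_left, Rmax_right in ht by lra.
    apply continuity_pt_filterlim, (ex_derive_continuous (K := R_AbsRing) (V := R_NormedModule)).
    eexists; apply hasd_derive_Re, h; lra.
  - rewrite Rmin_left, Rmax_right in ht by lra; exists t; split; [exact ht|].
    rewrite he; ring.
Qed.

(** A norming functional of the increment makes it a nonnegative real number, to which the mean
    value theorem for real parts applies. *)
Lemma segment_bound {V : NormedModule C_AbsRing} (f : C -> V) (d : R -> V) (M : R) :
  (forall t, 0 <= t <= 1 -> hasd f (RtoC t) (d t)) ->
  (forall t, 0 <= t <= 1 -> norm (d t) <= M) ->
  norm (minus (f (RtoC 1)) (f (RtoC 0))) <= M.
Proof.
  intros h hM; destruct (hahn_banach_norming (minus (f (RtoC 1)) (f (RtoC 0)))) as [phi [h1 h2]].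
  destruct (hasd_mean_value (fun s => phi (f s)) (fun t => phi (d t))) as [t [ht he]].
  { intros t ht; apply (hasd_comp_linear f phi), h; exact ht. }
  assert (h3 : phi (minus (f (RtoC 1)) (f (RtoC 0))) = (phi (f (RtoC 1)) - phi (f (RtoC 0)))%C).
  { unfold minus; rewrite (linear_plus _ (Lop_is_linear phi)), (linear_opp _ _ (Lop_is_linear phi)).
    reflexivity. }
  rewrite h3 in h1; apply (f_equal Re) in h1; simpl in h1.
  pose proof (Re_le_Cmod (phi (d t))); pose proof (h2 (d t)); pose proof (hM t ht).
  unfold Re in *; lra.
Qed.

Section ComplexIntegral.

Implicit Types (u v : R -> C) (a b c : R).

Definition is_Cint u a b (l : C) : Prop :=
  is_RInt (fun t => Re (u t)) a b (Re l) /\ is_RInt (fun t => Im (u t)) a b (Im l).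

Definition Cint u a b : C := (RInt (fun t => Re (u t)) a b, RInt (fun t => Im (u t)) a b).

Definition ccont u (t : R) : Prop :=
  forall e, 0 < e -> exists r, 0 < r /\ forall h, Rabs h < r -> Cmod (u (t + h)%R - u t)%C <= e.

Lemma is_Cint_unique u a b l : is_Cint u a b l -> Cint u a b = l.
Proof.
  intros [h1 h2]; unfold Cint; apply injective_projections; simpl; apply is_RInt_unique; assumption.
Qed.

Lemma real_continuous_eps_delta (f : R -> R) (t : R) :
  (forall e, 0 < e -> exists r, 0 < r /\ forall h, Rabs h < r -> Rabs (f (t + h) - f t) <= e) ->
  continuous f t.
Proof.
  intros hf; apply filterlim_locally; intros e.
  destruct (hf (e / 2)) as [r [hr h]]; [pose proof (cond_pos e); lra|].
  exists (mkposreal r hr); intros s hs.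
  change (Rabs (f s - f t) < e); change (Rabs (s - t) < r) in hs.
  replace s with (t + (s - t)) by ring.
  eapply Rle_lt_trans; [apply h; exact hs|]; pose proof (cond_pos e); lra.
Qed.

Lemma ccont_Re u t : ccont u t -> continuous (fun s => Re (u s)) t.
Proof.
  intros h; apply real_continuous_eps_delta; intros e he; destruct (h e he) as [r [hr k]].
  exists r; split; [exact hr|]; intros s hs; eapply Rle_trans; [|apply (k s hs)].
  eapply Rle_trans; [|apply re_le_Cmod]; right; f_equal.
Qed.

Lemma ccont_Im u t : ccont u t -> continuous (fun s => Im (u s)) t.
Proof.
  intros h; apply real_continuous_eps_delta; intros e he; destruct (h e he) as [r [hr k]].
  exists r; split; [exact hr|]; intros s hs; eapply Rle_trans; [|apply (k s hs)].
  eapply Rle_trans; [|apply im_le_Cmod]; right; f_equal.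
Qed.

Lemma is_Cint_cont u a b : a <= b -> (forall t, a <= t <= b -> ccont u t) ->
  is_Cint u a b (Cint u a b).
Proof.
  intros hab h; split; apply (RInt_correct (V := R_CompleteNormedModule));
    apply (ex_RInt_continuous (V := R_CompleteNormedModule)); intros t ht;
    rewrite Rmin_left, Rmax_right in ht by exact hab; [apply ccont_Re|apply ccont_Im]; apply h; exact ht.
Qed.

Lemma is_Cint_plus u v a b l m :
  is_Cint u a b l -> is_Cint v a b m -> is_Cint (fun t => (u t + v t)%C) a b (l + m)%C.
Proof.
  intros [h1 h2] [h3 h4]; split.
  - exact (is_RInt_plus (V := R_NormedModule) _ _ _ _ _ _ h1 h3).
  - exact (is_RInt_plus (V := R_NormedModule) _ _ _ _ _ _ h2 h4).
Qed.

Lemma is_Cint_scal (k : C) u a b l :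
  is_Cint u a b l -> is_Cint (fun t => (k * u t)%C) a b (k * l)%C.
Proof.
  intros [h1 h2]; split.
  - exact (is_RInt_minus (V := R_NormedModule) _ _ _ _ _ _
      (is_RInt_scal (V := R_NormedModule) _ _ _ (Re k) _ h1)
      (is_RInt_scal (V := R_NormedModule) _ _ _ (Im k) _ h2)).
  - exact (is_RInt_plus (V := R_NormedModule) _ _ _ _ _ _
      (is_RInt_scal (V := R_NormedModule) _ _ _ (Re k) _ h2)
      (is_RInt_scal (V := R_NormedModule) _ _ _ (Im k) _ h1)).
Qed.

Lemma is_Cint_ext u v a b l : a <= b -> (forall t, a <= t <= b -> u t = v t) ->
  is_Cint u a b l -> is_Cint v a b l.
Proof.
  intros hab h [h1 h2]; split; eapply is_RInt_ext; try eassumption; intros t ht;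
    rewrite Rmin_left, Rmax_right in ht by exact hab; cbv beta; f_equal; apply h; lra.
Qed.

Lemma is_Cint_minus u v a b l m :
  a <= b -> is_Cint u a b l -> is_Cint v a b m -> is_Cint (fun t => (u t - v t)%C) a b (l - m)%C.
Proof.
  intros hab h1 h2; replace (l - m)%C with (l + (- (1)) * m)%C by ring.
  apply is_Cint_ext with (fun t => (u t + (- (1)) * v t)%C); [exact hab|intros; ring|].
  apply is_Cint_plus; [exact h1|apply is_Cint_scal; exact h2].
Qed.

Lemma is_Cint_Chasles u a b c l m :
  is_Cint u a b l -> is_Cint u b c m -> is_Cint u a c (l + m)%C.
Proof.
  intros [h1 h2] [h3 h4]; split.
  - exact (is_RInt_Chasles (V := R_NormedModule) _ _ _ _ _ _ h1 h3).
  - exact (is_RInt_Chasles (V := R_NormedModule) _ _ _ _ _ _ h2 h4).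
Qed.

Lemma is_Cint_Re_le u v a b l m : a <= b -> is_Cint u a b l -> is_Cint v a b m ->
  (forall t, a <= t <= b -> Re (u t) <= Re (v t)) -> Re l <= Re m.
Proof.
  intros hab [h1 _] [h2 _] h.
  apply (is_RInt_le _ _ a b _ _ hab h1 h2); intros t ht; apply h; lra.
Qed.

Lemma is_Cint_const (k : C) a b : is_Cint (fun _ => k) a b (RtoC (b - a) * k)%C.
Proof.
  split.
  - replace (Re (RtoC (b - a) * k)%C) with (scal (b - a) (Re k))
      by (unfold scal; simpl; unfold mult; simpl; unfold Re; ring).
    apply (is_RInt_const (V := R_NormedModule)).
  - replace (Im (RtoC (b - a) * k)%C) with (scal (b - a) (Im k))
      by (unfold scal; simpl; unfold mult; simpl; unfold Im; ring).
    apply (is_RInt_const (V := R_NormedModule)).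
Qed.

(** The integrand is multiplied by the rotation that makes the integral real and nonnegative; its
    real part is then compared with [M]. *)
Lemma is_Cint_bound u a b l M : a <= b -> is_Cint u a b l ->
  (forall t, a <= t <= b -> Cmod (u t) <= M) -> Cmod l <= M * (b - a).
Proof.
  intros hab hl hM; destruct (exists_rotation l) as [c [hc he]].
  pose proof (is_Cint_Re_le _ _ a b _ _ hab (is_Cint_scal c _ _ _ _ hl) (is_Cint_const (RtoC M) a b)) as h.
  rewrite he, <- RtoC_mult in h; simpl in h; rewrite Rmult_comm in h; apply h.
  intros t ht; eapply Rle_trans; [apply (Re_le_Cmod (c * u t)%C)|].
  rewrite Cmod_mult, hc, Rmult_1_l; apply hM; exact ht.
Qed.

Lemma is_Cint_derive (f : C -> C) (v : R -> C) a b : a <= b ->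
  (forall t, a <= t <= b -> hasdC f (RtoC t) (v t)) ->
  (forall t, a <= t <= b -> ccont v t) ->
  is_Cint v a b (f (RtoC b) - f (RtoC a))%C.
Proof.
  intros hab hd hc; split.
  - apply (is_RInt_derive (V := R_CompleteNormedModule) (fun t => Re (f (RtoC t)))); intros t ht;
      rewrite Rmin_left, Rmax_right in ht by exact hab.
    + apply hasd_derive_Re, hd; exact ht.
    + apply ccont_Re, hc; exact ht.
  - apply (is_RInt_derive (V := R_CompleteNormedModule) (fun t => Im (f (RtoC t)))); intros t ht;
      rewrite Rmin_left, Rmax_right in ht by exact hab.
    + apply hasd_derive_Im, hd; exact ht.
    + apply ccont_Im, hc; exact ht.
Qed.

End ComplexIntegral.

(** * Goursat's theorem *)

Section DyadicSubdivision.

Context (P : nat -> R -> R -> Prop) (A B : R) (hA : 0 <= A) (hB : 0 <= B).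

Let dA n := A / 2 ^ n.
Let dB n := B / 2 ^ n.

Lemma dyadic_half (D : R) n : D / 2 ^ n = D / 2 ^ S n + D / 2 ^ S n.
Proof. simpl; field; apply pow_nonzero; lra. Qed.

Lemma dyadic_ge0 (D : R) n : 0 <= D -> 0 <= D / 2 ^ n.
Proof.
  intros h; apply Rmult_le_pos; [exact h|left; apply Rinv_0_lt_compat, pow_lt; lra].
Qed.

(** Compactness by bisection, with [P n x y] speaking of the rectangle with corner [(x, y)] and
    sides [A / 2^n], [B / 2^n]. If [P 0 a b] failed, some quarter would fail at every level, and
    these nested rectangles would contain a common point at which the local hypothesis is
    violated. *)
Lemma dyadic_induction (a b : R) :
  (forall n x y, P (S n) x y -> P (S n) (x + dA (S n)) y -> P (S n) x (y + dB (S n)) ->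
     P (S n) (x + dA (S n)) (y + dB (S n)) -> P n x y) ->
  (forall x0 y0, a <= x0 <= a + A -> b <= y0 <= b + B -> exists n, forall x y,
     a <= x -> x + dA n <= a + A -> b <= y -> y + dB n <= b + B ->
     x <= x0 <= x + dA n -> y <= y0 <= y + dB n -> P n x y) ->
  P 0 a b.
Proof.
  intros hsplit hloc; apply NNPP; intros hn.
  set (bad := fun (n : nat) (c c' : R * R) =>
    ~ P (S n) (fst c') (snd c') /\
    (fst c' = fst c \/ fst c' = fst c + dA (S n)) /\
    (snd c' = snd c \/ snd c' = snd c + dB (S n))).
  set (s := fix s (n : nat) : R * R :=
    match n with O => (a, b) | S n => epsilon (inhabits (0, 0)) (bad n (s n)) end).
  assert (hs : forall n, ~ P n (fst (s n)) (snd (s n))).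
  { induction n as [|n IH]; [exact hn|].
    assert (hex : exists c', bad n (s n) c').
    { apply NNPP; intros hne; apply IH.
      assert (hall : forall x y, (x = fst (s n) \/ x = fst (s n) + dA (S n)) ->
        (y = snd (s n) \/ y = snd (s n) + dB (S n)) -> P (S n) x y).
      { intros x y hx hy; apply NNPP; intros hp; apply hne; exists (x, y); split; auto. }
      apply hsplit; apply hall; auto. }
    apply (proj1 (epsilon_spec (inhabits (0, 0)) (bad n (s n)) hex)). }
  assert (hstep : forall n, bad n (s n) (s (S n))).
  { intros n; apply (epsilon_spec (inhabits (0, 0)) (bad n (s n))).
    apply NNPP; intros hne; apply (hs n).
    assert (hall : forall x y, (x = fst (s n) \/ x = fst (s n) + dA (S n)) ->
      (y = snd (s n) \/ y = snd (s n) + dB (S n)) -> P (S n) x y).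
    { intros x y hx hy; apply NNPP; intros hp; apply hne; exists (x, y); split; auto. }
    apply hsplit; apply hall; auto. }
  (* Nested intervals in one coordinate; the two coordinates of the bad corners are treated
     independently. *)
  assert (hlim : forall (x : nat -> R) (D c : R), 0 <= D -> x O = c ->
    (forall n, x (S n) = x n \/ x (S n) = x n + D / 2 ^ S n) ->
    exists x0, c <= x0 <= c + D /\
      forall n, (c <= x n /\ x n + D / 2 ^ n <= c + D) /\ x n <= x0 <= x n + D / 2 ^ n).
  { intros x D c hD hc hx.
    assert (hm : forall n k, x n <= x (n + k)%nat /\
              x (n + k)%nat + D / 2 ^ (n + k) <= x n + D / 2 ^ n).
    { intros n k; induction k as [|k IH]; [rewrite Nat.add_0_r; lra|].
      rewrite Nat.add_succ_r; pose proof (dyadic_half D (n + k)) as hh.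
      pose proof (dyadic_ge0 D (S (n + k)) hD).
      destruct (hx (n + k)%nat) as [h|h]; rewrite h; lra. }
    assert (hle : forall n m, x n <= x m + D / 2 ^ m).
    { intros n m; destruct (Nat.le_ge_cases n m) as [h|h].
      - pose proof (hm n (m - n)%nat) as h1; replace (n + (m - n))%nat with m in h1 by lia.
        pose proof (dyadic_ge0 D m hD); lra.
      - pose proof (hm m (n - m)%nat) as h1; replace (m + (n - m))%nat with n in h1 by lia.
        pose proof (dyadic_ge0 D n hD); lra. }
    destruct (completeness (fun r => exists n, r = x n)) as [x0 [h1 h2]].
    - exists (x O + D / 2 ^ 0); intros r [n ->]; apply hle.
    - exists (x O), O; reflexivity.
    - assert (hx0 : forall n, x n <= x0 <= x n + D / 2 ^ n).
      { intros n; split; [apply h1; exists n; reflexivity|].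
        apply h2; intros r [k ->]; apply hle. }
      exists x0; split; [pose proof (hx0 O) as h; rewrite hc in h; simpl in h; lra|].
      intros n; split; [|apply hx0]; pose proof (hm O n) as h; simpl in h; rewrite hc in h; lra. }
  destruct (hlim (fun n => fst (s n)) A a hA eq_refl) as [x0 [hx0 hx]].
  { intros n; apply (hstep n). }
  destruct (hlim (fun n => snd (s n)) B b hB eq_refl) as [y0 [hy0 hy]].
  { intros n; apply (hstep n). }
  destruct (hloc x0 y0 hx0 hy0) as [n hP]; apply (hs n), hP;
    solve [apply (hx n)|apply (hy n)].
Qed.

End DyadicSubdivision.

(** * Boundary integrals of rectangles *)

Section Goursat.

Implicit Types (H F K : C -> C) (a b c d : R).

Definition hol_rect H a b c d : Prop :=
  forall x y, a <= x <= b -> c <= y <= d -> exists l, hasdC H (x, y) l.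

(** The counterclockwise boundary integral, with each pair of opposite sides parametrized in the
    same direction. *)
Definition Jrect H a b c d : C :=
  (Cint (fun x => H (x, c)) a b - Cint (fun x => H (x, d)) a b
   + Ci * (Cint (fun y => H (b, y)) c d - Cint (fun y => H (a, y)) c d))%C.

Lemma hol_rect_sub H a b c d a' b' c' d' : a <= a' -> b' <= b -> c <= c' -> d' <= d ->
  hol_rect H a b c d -> hol_rect H a' b' c' d'.
Proof. intros h1 h2 h3 h4 h x y hx hy; apply h; lra. Qed.

Lemma ccont_horizontal H x y l : hasdC H (x, y) l -> ccont (fun t => H (t, y)) x.
Proof.
  intros h e he; destruct (hasd_cont _ _ _ h e he) as [r [hr k]]; exists r; split; [exact hr|].
  intros s hs; specialize (k (RtoC s)); rewrite Cmod_R in k; specialize (k hs).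
  replace ((x, y) + RtoC s)%C with ((x + s, y) : C) in k; [exact k|].
  apply injective_projections; simpl; ring.
Qed.

Lemma ccont_vertical H x y l : hasdC H (x, y) l -> ccont (fun t => H (x, t)) y.
Proof.
  intros h e he; destruct (hasd_cont _ _ _ h e he) as [r [hr k]]; exists r; split; [exact hr|].
  intros s hs; specialize (k (Ci * RtoC s)%C).
  rewrite Cmod_mult, Cmod_R, Cmod_Ci, Rmult_1_l in k; specialize (k hs).
  replace ((x, y) + Ci * RtoC s)%C with ((x, y + s) : C) in k; [exact k|].
  apply injective_projections; simpl; ring.
Qed.

Lemma is_Cint_horizontal H a b c d y : a <= b -> c <= y <= d -> hol_rect H a b c d ->
  is_Cint (fun x => H (x, y)) a b (Cint (fun x => H (x, y)) a b).
Proof.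
  intros hab hy h; apply is_Cint_cont; [exact hab|]; intros t ht.
  destruct (h t y ht hy) as [l hl]; apply (ccont_horizontal _ _ _ l hl).
Qed.

Lemma is_Cint_vertical H a b c d x : c <= d -> a <= x <= b -> hol_rect H a b c d ->
  is_Cint (fun y => H (x, y)) c d (Cint (fun y => H (x, y)) c d).
Proof.
  intros hcd hx h; apply is_Cint_cont; [exact hcd|]; intros t ht.
  destruct (h x t hx ht) as [l hl]; apply (ccont_vertical _ _ _ l hl).
Qed.

Lemma Jrect_split_x H a m b c d : a <= m <= b -> c <= d -> hol_rect H a b c d ->
  Jrect H a b c d = (Jrect H a m c d + Jrect H m b c d)%C.
Proof.
  intros hm hcd h; unfold Jrect.
  assert (h1 : hol_rect H a m c d) by (apply hol_rect_sub with a b c d; lra || exact h).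
  assert (h2 : hol_rect H m b c d) by (apply hol_rect_sub with a b c d; lra || exact h).
  assert (hs : forall y, c <= y <= d -> Cint (fun x => H (x, y)) a b =
    (Cint (fun x => H (x, y)) a m + Cint (fun x => H (x, y)) m b)%C).
  { intros y hy; apply is_Cint_unique, is_Cint_Chasles with m;
      [apply is_Cint_horizontal with c d|apply is_Cint_horizontal with c d]; lra || assumption. }
  rewrite !hs by lra; ring.
Qed.

Lemma Jrect_split_y H a b c m d : a <= b -> c <= m <= d -> hol_rect H a b c d ->
  Jrect H a b c d = (Jrect H a b c m + Jrect H a b m d)%C.
Proof.
  intros hab hm h; unfold Jrect.
  assert (h1 : hol_rect H a b c m) by (apply hol_rect_sub with a b c d; lra || exact h).
  assert (h2 : hol_rect H a b m d) by (apply hol_rect_sub with a b c d; lra || exact h).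
  assert (hs : forall x, a <= x <= b -> Cint (fun y => H (x, y)) c d =
    (Cint (fun y => H (x, y)) c m + Cint (fun y => H (x, y)) m d)%C).
  { intros x hx; apply is_Cint_unique, is_Cint_Chasles with m;
      [apply is_Cint_vertical with a b|apply is_Cint_vertical with a b]; lra || assumption. }
  rewrite !hs by lra; ring.
Qed.

Lemma Jrect_minus H K a b c d : a <= b -> c <= d -> hol_rect H a b c d -> hol_rect K a b c d ->
  Jrect (fun s => (H s - K s)%C) a b c d = (Jrect H a b c d - Jrect K a b c d)%C.
Proof.
  intros hab hcd hH hK; unfold Jrect.
  rewrite !(is_Cint_unique _ _ _ _ (is_Cint_minus _ _ _ _ _ _ hab
    (is_Cint_horizontal H a b c d _ hab (conj (Rle_refl c) hcd) hH)
    (is_Cint_horizontal K a b c d _ hab (conj (Rle_refl c) hcd) hK))).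
  rewrite !(is_Cint_unique _ _ _ _ (is_Cint_minus _ _ _ _ _ _ hab
    (is_Cint_horizontal H a b c d _ hab (conj hcd (Rle_refl d)) hH)
    (is_Cint_horizontal K a b c d _ hab (conj hcd (Rle_refl d)) hK))).
  rewrite !(is_Cint_unique _ _ _ _ (is_Cint_minus _ _ _ _ _ _ hcd
    (is_Cint_vertical H a b c d _ hcd (conj (Rle_refl a) hab) hH)
    (is_Cint_vertical K a b c d _ hcd (conj (Rle_refl a) hab) hK))).
  rewrite !(is_Cint_unique _ _ _ _ (is_Cint_minus _ _ _ _ _ _ hcd
    (is_Cint_vertical H a b c d _ hcd (conj hab (Rle_refl b)) hH)
    (is_Cint_vertical K a b c d _ hcd (conj hab (Rle_refl b)) hK))).
  ring.
Qed.

Lemma Cint_horizontal_primitive H F a b y : a <= b ->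
  (forall x, a <= x <= b -> hasdC F (x, y) (H (x, y)) /\ exists l, hasdC H (x, y) l) ->
  Cint (fun x => H (x, y)) a b = (F (b, y) - F (a, y))%C.
Proof.
  intros hab h; apply is_Cint_unique.
  assert (he : forall t : R, ((0, y) + RtoC t * 1)%C = ((t, y) : C))
    by (intros t; apply injective_projections; simpl; ring).
  rewrite <- (he a), <- (he b).
  apply (is_Cint_derive (fun s => F ((0, y) + s * 1)%C)); [exact hab| |].
  - intros t ht; eapply hasd_eq; [apply hasd_line; rewrite he; apply h; exact ht|cring].
  - intros t ht; destruct (h t ht) as [_ [l hl]]; apply (ccont_horizontal _ _ _ l hl).
Qed.

Lemma Cint_vertical_primitive H F c d x : c <= d ->
  (forall y, c <= y <= d -> hasdC F (x, y) (H (x, y)) /\ exists l, hasdC H (x, y) l) ->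
  (Ci * Cint (fun y => H (x, y)) c d)%C = (F (x, d) - F (x, c))%C.
Proof.
  intros hcd h.
  assert (he : forall t : R, ((x, 0) + RtoC t * Ci)%C = ((x, t) : C))
    by (intros t; apply injective_projections; simpl; ring).
  assert (hc : forall t, c <= t <= d -> ccont (fun y => H (x, y)) t).
  { intros t ht; destruct (h t ht) as [_ [l hl]]; apply (ccont_vertical _ _ _ l hl). }
  rewrite <- (he c), <- (he d).
  rewrite <- (is_Cint_unique _ _ _ _ (is_Cint_scal Ci _ _ _ _ (is_Cint_cont _ _ _ hcd hc))).
  apply is_Cint_unique.
  apply (is_Cint_derive (fun s => F ((x, 0) + s * Ci)%C)); [exact hcd| |].
  - intros t ht; apply hasd_line; rewrite he; apply h; exact ht.
  - intros t ht e hep; destruct (hc t ht e hep) as [r [hr k]]; exists r; split; [exact hr|].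
    intros s hs; replace (Ci * H (x, (t + s)%R) - Ci * H (x, t))%C with (Ci * (H (x, (t + s)%R) - H (x, t)))%C by ring.
    rewrite Cmod_mult, Cmod_Ci, Rmult_1_l; apply k; exact hs.
Qed.

Lemma Jrect_primitive H F a b c d : a <= b -> c <= d ->
  (forall x y, a <= x <= b -> c <= y <= d ->
     hasdC F (x, y) (H (x, y)) /\ exists l, hasdC H (x, y) l) ->
  Jrect H a b c d = 0%C.
Proof.
  intros hab hcd h; unfold Jrect.
  replace (Ci * (Cint (fun y => H (b, y)) c d - Cint (fun y => H (a, y)) c d))%C with
    (Ci * Cint (fun y => H (b, y)) c d - Ci * Cint (fun y => H (a, y)) c d)%C by ring.
  rewrite !(Cint_horizontal_primitive H F), !(Cint_vertical_primitive H F);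
    try assumption; try (intros; apply h; lra); ring.
Qed.

Lemma hasd_affine (k l z : C) : hasdC (fun s => (k + s * l)%C) z l.
Proof.
  eapply hasd_eq; [apply hasd_plus; [apply hasd_const|apply hasd_mult; [apply hasd_id|apply hasd_const]]|].
  cring.
Qed.

Lemma Jrect_affine (k l : C) a b c d : a <= b -> c <= d ->
  Jrect (fun s => (k + s * l)%C) a b c d = 0%C.
Proof.
  intros hab hcd; apply Jrect_primitive with (fun s => (s * (k + s * (l / 2)))%C); try assumption.
  intros x y _ _; split; [|exists l; apply hasd_affine].
  eapply hasd_eq; [apply hasd_mult; [apply hasd_id|apply hasd_affine]|].
  cbv beta; set (z := ((x, y) : C)); cfield; intros h; injection h; lra.
Qed.

Lemma Jrect_bound H a b c d M : a <= b -> c <= d -> hol_rect H a b c d ->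
  (forall x y, a <= x <= b -> c <= y <= d -> Cmod (H (x, y)) <= M) ->
  Cmod (Jrect H a b c d) <= 2 * M * ((b - a) + (d - c)).
Proof.
  intros hab hcd h hM; unfold Jrect.
  assert (h1 : forall y, c <= y <= d -> Cmod (Cint (fun x => H (x, y)) a b) <= M * (b - a)).
  { intros y hy; apply (is_Cint_bound _ a b _ M hab (is_Cint_horizontal H a b c d y hab hy h)).
    intros t ht; apply hM; assumption. }
  assert (h2 : forall x, a <= x <= b -> Cmod (Cint (fun y => H (x, y)) c d) <= M * (d - c)).
  { intros x hx; apply (is_Cint_bound _ c d _ M hcd (is_Cint_vertical H a b c d x hcd hx h)).
    intros t ht; apply hM; assumption. }
  unfold Cminus.
  eapply Rle_trans; [apply Cmod_triangle|]; rewrite Cmod_mult, Cmod_Ci.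
  pose proof (Cmod_triangle (Cint (fun x => H (x, c)) a b) (- Cint (fun x => H (x, d)) a b)) as t1.
  pose proof (Cmod_triangle (Cint (fun y => H (b, y)) c d) (- Cint (fun y => H (a, y)) c d)) as t2.
  rewrite Cmod_opp in t1, t2.
  pose proof (h1 c ltac:(lra)); pose proof (h1 d ltac:(lra)).
  pose proof (h2 a ltac:(lra)); pose proof (h2 b ltac:(lra)); lra.
Qed.

Lemma Cmod_pair_le (x y : R) : Cmod (x, y) <= Rabs x + Rabs y.
Proof.
  replace ((x, y) : C) with (RtoC x + Ci * RtoC y)%C by (apply injective_projections; simpl; ring).
  eapply Rle_trans; [apply Cmod_triangle|]; rewrite Cmod_mult, !Cmod_R, Cmod_Ci; lra.
Qed.

(** Affine functions have primitives and contribute nothing. Near a point the rest is at most [e]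
    times the distance, so a small rectangle contributes at most a multiple of [e] times its squared
    side sum, an amount that adds up exactly under quartering. *)
Theorem goursat H a b c d : a <= b -> c <= d -> hol_rect H a b c d -> Jrect H a b c d = 0%C.
Proof.
  intros hab hcd hH.
  set (A := b - a); set (B := d - c).
  assert (hA : 0 <= A) by (unfold A; lra); assert (hB : 0 <= B) by (unfold B; lra).
  assert (hJ : forall e, 0 < e -> Cmod (Jrect H a b c d) <= 2 * e * ((A + B) * (A + B))).
  2:{ apply Cmod_eq_0, Rle_antisym; [|apply Cmod_ge_0].
      apply Rnot_lt_le; intros hp.
      assert (hq : 0 < (A + B) * (A + B) + 1) by nra.
      specialize (hJ (Cmod (Jrect H a b c d) / (4 * ((A + B) * (A + B) + 1)))
        ltac:(apply Rdiv_lt_0_compat; lra)).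
      set (q := (A + B) * (A + B)) in *; set (j := Cmod _) in *.
      replace (2 * (j / (4 * (q + 1))) * q) with (j * (q / (q + 1)) / 2) in hJ by (field; lra).
      assert (hq1 : q / (q + 1) <= 1).
      { apply Rmult_le_reg_r with (q + 1); [lra|]; unfold Rdiv; rewrite Rmult_assoc, Rinv_l; lra. }
      apply (Rmult_le_compat_l j) in hq1; lra. }
  intros e he.
  (* A quarter has half the side sum, so four bounds of this quadratic form add up to the bound one
     level higher. *)
  set (P := fun (n : nat) (x y : R) => a <= x -> x + A / 2 ^ n <= b -> c <= y -> y + B / 2 ^ n <= d ->
    Cmod (Jrect H x (x + A / 2 ^ n) y (y + B / 2 ^ n))
      <= 2 * e * ((A / 2 ^ n + B / 2 ^ n) * (A / 2 ^ n + B / 2 ^ n))).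
  assert (hP : P O a c).
  2:{ unfold P in hP; simpl in hP; rewrite !Rdiv_1_r in hP.
      replace (a + A) with b in hP by (unfold A; ring).
      replace (c + B) with d in hP by (unfold B; ring); apply hP; lra. }
  apply (dyadic_induction P A B hA hB).
  - intros n x y h1 h2 h3 h4; unfold P in *; rewrite (dyadic_half A n), (dyadic_half B n).
    intros hx hx' hy hy'.
    pose proof (dyadic_ge0 A (S n) hA) as hu; pose proof (dyadic_ge0 B (S n) hB) as hv.
    set (u := A / 2 ^ S n) in *; set (v := B / 2 ^ S n) in *.
    assert (hh : hol_rect H x (x + (u + u)) y (y + (v + v)))
      by (apply hol_rect_sub with a b c d; lra || exact hH).
    rewrite (Jrect_split_x H x (x + u)); try lra; try exact hh.
    rewrite (Jrect_split_y H x (x + u) y (y + v)), (Jrect_split_y H (x + u) (x + (u + u)) y (y + v));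
      try lra; try (eapply hol_rect_sub; [| | | |exact hh]; lra).
    replace (x + (u + u)) with (x + u + u) by ring; replace (y + (v + v)) with (y + v + v) by ring.
    specialize (h1 ltac:(lra) ltac:(lra) ltac:(lra) ltac:(lra)).
    specialize (h2 ltac:(lra) ltac:(lra) ltac:(lra) ltac:(lra)).
    specialize (h3 ltac:(lra) ltac:(lra) ltac:(lra) ltac:(lra)).
    specialize (h4 ltac:(lra) ltac:(lra) ltac:(lra) ltac:(lra)).
    eapply Rle_trans; [apply Cmod_triangle|].
    eapply Rle_trans; [apply Rplus_le_compat; apply Cmod_triangle|].
    eapply Rle_trans; [apply Rplus_le_compat; apply Rplus_le_compat; eassumption|].
    right; ring.
  - intros x0 y0 hx0 hy0.
    destruct (hH x0 y0) as [l hl]; [unfold A, B in *; lra|unfold A, B in *; lra|].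
    destruct (proj1 (hasd_iff _ _ _) hl e he) as [r [hr k]].
    destruct (pow_lt_1_zero (/ 2) ltac:(rewrite Rabs_pos_eq; lra) (r / (A + B + 1))
      ltac:(apply Rdiv_lt_0_compat; lra)) as [n hn].
    specialize (hn n (le_n n)); rewrite Rabs_pos_eq in hn by (apply pow_le; lra).
    assert (hsm : A / 2 ^ n + B / 2 ^ n < r).
    { unfold Rdiv; rewrite <- pow_inv, <- Rmult_plus_distr_r.
      apply (Rmult_lt_compat_l (A + B + 1)) in hn; [|lra].
      replace ((A + B + 1) * (r / (A + B + 1))) with r in hn by (field; lra).
      assert (0 < (/ 2) ^ n) by (apply pow_lt; lra); nra. }
    exists n; intros x y h1 h2 h3 h4 hx hy; intros _ h2' _ h4'.
    pose proof (dyadic_ge0 A n hA) as hu; pose proof (dyadic_ge0 B n hB) as hv.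
    set (u := A / 2 ^ n) in *; set (v := B / 2 ^ n) in *.
    (* The affine approximation of [H] at the limit point; subtracting it does not change the
       boundary integral. *)
    set (K := fun s : C => (H (x0, y0) - (x0, y0) * l + s * l)%C).
    assert (hHr : hol_rect H x (x + u) y (y + v))
      by (apply hol_rect_sub with a b c d; lra || exact hH).
    assert (hK : hol_rect K x (x + u) y (y + v)) by (intros ? ? _ _; exists l; apply hasd_affine).
    pose proof (Jrect_minus H K x (x + u) y (y + v) ltac:(lra) ltac:(lra) hHr hK) as hm.
    unfold K at 2 in hm; rewrite Jrect_affine in hm by lra.
    replace (Jrect H x (x + u) y (y + v)) with (Jrect (fun s => (H s - K s)%C) x (x + u) y (y + v))
      by (rewrite hm; ring).
    replace (2 * e * ((u + v) * (u + v))) with (2 * (e * (u + v)) * ((x + u - x) + (y + v - y))) by ring.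
    apply Jrect_bound; try lra.
    + intros s t hs ht; destruct (hHr s t hs ht) as [l' hl']; eexists.
      apply hasd_minus; [exact hl'|apply hasd_affine].
    + intros s t hs ht; unfold K.
      assert (hd : Cmod (s - x0, t - y0) <= u + v).
      { eapply Rle_trans; [apply Cmod_pair_le|]; apply Rplus_le_compat; apply Rabs_le; lra. }
      specialize (k ((s - x0)%R, (t - y0)%R) ltac:(lra)).
      replace ((x0, y0) + ((s - x0)%R, (t - y0)%R))%C with ((s, t) : C) in k
        by (apply injective_projections; simpl; ring).
      replace (H (s, t) - (H (x0, y0) - (x0, y0) * l + (s, t) * l))%C
        with (H (s, t) - H (x0, y0) - ((s - x0)%R, (t - y0)%R) * l)%C.
      * eapply Rle_trans; [exact k|]; apply Rmult_le_compat_l; lra.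
      * replace (((s - x0)%R, (t - y0)%R) : C) with ((s, t) - (x0, y0))%C
          by (apply injective_projections; simpl; ring); ring.
Qed.

End Goursat.

(** * Means over circles *)

Lemma Cminus_eq_0 (a b : C) : (a - b)%C = 0%C -> a = b.
Proof. intros h; replace a with (a - b + b)%C by ring; rewrite h; ring. Qed.

Definition Cexp (w : C) : C := (exp (Re w) * cos (Im w), exp (Re w) * sin (Im w)).

Lemma Cexp_plus (w z : C) : Cexp (w + z) = (Cexp w * Cexp z)%C.
Proof.
  unfold Cexp, Re, Im; apply injective_projections; simpl;
    rewrite exp_plus; [rewrite cos_plus|rewrite sin_plus]; ring.
Qed.

Lemma Cexp_0 : Cexp 0 = 1%C.
Proof. unfold Cexp; simpl; rewrite exp_0, cos_0, sin_0; apply injective_projections; simpl; ring. Qed.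

Lemma Cexp_opp (w : C) : (Cexp w * Cexp (- w))%C = 1%C.
Proof. rewrite <- Cexp_plus, <- Cexp_0; f_equal; ring. Qed.

Lemma Cmod_Cexp (w : C) : Cmod (Cexp w) = exp (Re w).
Proof.
  unfold Cmod, Cexp; simpl fst; simpl snd.
  replace ((exp (Re w) * cos (Im w)) ^ 2 + (exp (Re w) * sin (Im w)) ^ 2)
    with ((exp (Re w)) ^ 2 * (Rsqr (sin (Im w)) + Rsqr (cos (Im w)))) by (unfold Rsqr; ring).
  rewrite sin2_cos2, Rmult_1_r; apply sqrt_pow2; left; apply exp_pos.
Qed.

Lemma Cexp_neq_0 (w : C) : Cexp w <> 0%C.
Proof.
  intros h; pose proof (Cmod_Cexp w) as hm; rewrite h, Cmod_0 in hm.
  pose proof (exp_pos (Re w)); lra.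
Qed.

Lemma derivable_at_0 (f : R -> R) (l : R) : derivable_pt_lim f 0 l ->
  forall e, 0 < e -> exists r, 0 < r /\ forall x, Rabs x < r -> Rabs (f x - f 0 - x * l) <= e * Rabs x.
Proof.
  intros h e he; destruct (h e he) as [[r hr] k]; simpl in k; exists r; split; [exact hr|].
  intros x hx; destruct (Req_dec x 0) as [->|hne].
  - rewrite Rabs_R0; replace (f 0 - f 0 - 0 * l) with 0 by ring; rewrite Rabs_R0; lra.
  - specialize (k x hne hx); rewrite Rplus_0_l in k.
    replace (f x - f 0 - x * l) with (((f x - f 0) / x - l) * x) by (field; exact hne).
    rewrite Rabs_mult; apply Rmult_le_compat_r; [apply Rabs_pos|lra].
Qed.

(** The functional equation moves the question to the origin, where the real derivatives of [exp],
    [cos] and [sin] decide it. *)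
Lemma hasd_Cexp (w : C) : hasdC Cexp w (Cexp w).
Proof.
  assert (h0 : forall e, 0 < e -> exists r, 0 < r /\ forall h : C, Cmod h < r ->
            Cmod (Cexp h - 1 - h) <= e * Cmod h).
  { intros e he.
    (* The errors of the two components add up to [e / 7 * (2 * Rabs x + 5 * Rabs y)], hence the
       sevenths. *)
    destruct (derivable_at_0 exp 1) with (e := e / 7) as [r1 [hr1 k1]]; [|lra|].
    { rewrite <- exp_0; apply derivable_pt_lim_exp. }
    destruct (derivable_at_0 cos 0) with (e := e / 7) as [r2 [hr2 k2]]; [|lra|].
    { replace 0 with (- sin 0) at 2 by (rewrite sin_0; ring); apply derivable_pt_lim_cos. }
    destruct (derivable_at_0 sin 1) with (e := e / 7) as [r3 [hr3 k3]]; [|lra|].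
    { rewrite <- cos_0; apply derivable_pt_lim_sin. }
    exists (Rmin (Rmin r1 (Rmin r2 r3)) (Rmin 1 (e / 7))).
    split; [repeat apply Rmin_pos; lra|]; intros [x y] hh.
    set (m := Rmin _ _) in hh.
    assert (hm : m <= r1 /\ m <= r2 /\ m <= r3 /\ m <= 1 /\ m <= e / 7).
    { unfold m; pose proof (Rmin_l (Rmin r1 (Rmin r2 r3)) (Rmin 1 (e / 7)));
      pose proof (Rmin_r (Rmin r1 (Rmin r2 r3)) (Rmin 1 (e / 7)));
      pose proof (Rmin_l r1 (Rmin r2 r3)); pose proof (Rmin_r r1 (Rmin r2 r3));
      pose proof (Rmin_l r2 r3); pose proof (Rmin_r r2 r3);
      pose proof (Rmin_l 1 (e / 7)); pose proof (Rmin_r 1 (e / 7)); lra. }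
    pose proof (re_le_Cmod (x, y)) as hx; pose proof (im_le_Cmod (x, y)) as hy; simpl in hx, hy.
    unfold Re, Im in hx, hy; simpl in hx, hy.
    specialize (k1 x ltac:(lra)); specialize (k2 y ltac:(lra)); specialize (k3 y ltac:(lra)).
    rewrite exp_0 in k1; rewrite cos_0 in k2; rewrite sin_0 in k3.
    assert (hc : Rabs (cos y) <= 1) by (apply Rabs_le; pose proof (COS_bound y); lra).
    assert (hsn : Rabs (sin y) <= 1) by (apply Rabs_le; pose proof (SIN_bound y); lra).
    assert (h1x : Rabs (1 + x) <= 2).
    { eapply Rle_trans; [apply Rabs_triang|]; rewrite Rabs_R1; lra. }
    assert (px := Rabs_pos x); assert (py := Rabs_pos y).
    eapply Rle_trans; [apply (Cmod_pair_le (exp x * cos y - 1 - x) (exp x * sin y - 0 - y))|].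
    assert (a1 : Rabs (exp x * cos y - 1 - x) <= e / 7 * Rabs x + 2 * (e / 7 * Rabs y)).
    { replace (exp x * cos y - 1 - x) with ((exp x - 1 - x * 1) * cos y + (1 + x) * (cos y - 1 - y * 0)) by ring.
      eapply Rle_trans; [apply Rabs_triang|]; rewrite !Rabs_mult.
      apply Rplus_le_compat; [|apply Rmult_le_compat; try apply Rabs_pos; assumption].
      rewrite <- (Rmult_1_r (e / 7 * Rabs x)).
      apply Rmult_le_compat; try apply Rabs_pos; assumption. }
    assert (a2 : Rabs (exp x * sin y - 0 - y) <= e / 7 * Rabs x + 2 * (e / 7 * Rabs y) + e / 7 * Rabs y).
    { replace (exp x * sin y - 0 - y)
        with ((exp x - 1 - x * 1) * sin y + (1 + x) * (sin y - 0 - y * 1) + x * y) by ring.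
      eapply Rle_trans; [apply Rabs_triang|].
      apply Rplus_le_compat; [|rewrite Rabs_mult; apply Rmult_le_compat_r; lra].
      eapply Rle_trans; [apply Rabs_triang|]; rewrite !Rabs_mult.
      apply Rplus_le_compat; [|apply Rmult_le_compat; try apply Rabs_pos; assumption].
      rewrite <- (Rmult_1_r (e / 7 * Rabs x)).
      apply Rmult_le_compat; try apply Rabs_pos; assumption. }
    apply Rle_trans with (e / 7 * (2 * Rabs x + 5 * Rabs y)); [lra|].
    apply Rle_trans with (e / 7 * (7 * Cmod (x, y))); [apply Rmult_le_compat_l; lra|lra]. }
  apply hasd_iff; intros e he; pose proof (exp_pos (Re w)) as hp.
  destruct (h0 (e / exp (Re w)) ltac:(apply Rdiv_lt_0_compat; lra)) as [r [hr k]].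
  exists r; split; [exact hr|]; intros h hh; rewrite Cexp_plus.
  replace (Cexp w * Cexp h - Cexp w - h * Cexp w)%C with (Cexp w * (Cexp h - 1 - h))%C by ring.
  rewrite Cmod_mult, Cmod_Cexp.
  replace (e * Cmod h) with (exp (Re w) * (e / exp (Re w) * Cmod h)) by (field; lra).
  apply Rmult_le_compat_l; [lra|apply k; exact hh].
Qed.

Definition circ (r t : R) : C := (r * cos t, r * sin t).

Lemma circ_Cexp (r t : R) : 0 < r -> circ r t = Cexp (ln r, t).
Proof. intros hr; unfold circ, Cexp; simpl; rewrite exp_ln by exact hr; reflexivity. Qed.

Lemma Cmod_circ (r t : R) : 0 < r -> Cmod (circ r t) = r.
Proof. intros hr; rewrite circ_Cexp, Cmod_Cexp by exact hr; simpl; apply exp_ln; exact hr. Qed.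

Lemma circ_neq_0 (r t : R) : 0 < r -> circ r t <> 0%C.
Proof. intros hr; rewrite circ_Cexp by exact hr; apply Cexp_neq_0. Qed.

Section PuncturedDisc.

Context (h : C -> C) (R0 : R).
Hypothesis hol : forall z, 0 < Cmod z < R0 -> exists l, hasdC h z l.

Lemma hol_exp_strip (a b c d : R) : exp b < R0 -> hol_rect (fun w => h (Cexp w)) a b c d.
Proof.
  intros hb x y hx hy; destruct (hol (Cexp (x, y))) as [l hl].
  - rewrite Cmod_Cexp; simpl; split; [apply exp_pos|]; apply Rle_lt_trans with (2 := hb).
    destruct (Req_dec x b) as [->|hne]; [lra|left; apply exp_increasing; lra].
  - eexists; apply (hasd_comp Cexp h _ _ _ (hasd_Cexp (x, y)) hl).
Qed.

Definition circle_int (r : R) : C := Cint (fun t => h (circ r t)) 0 (2 * PI).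

Lemma is_circle_int (r : R) : 0 < r < R0 ->
  is_Cint (fun t => h (circ r t)) 0 (2 * PI) (circle_int r).
Proof.
  intros hr; apply is_Cint_cont; [pose proof PI_RGT_0; lra|]; intros t ht.
  assert (hx : hol_rect (fun w => h (Cexp w)) (ln r) (ln r) 0 (2 * PI)).
  { apply hol_exp_strip; rewrite exp_ln; lra. }
  destruct (hx (ln r) t ltac:(lra) ht) as [l hl].
  pose proof (ccont_vertical _ _ _ _ hl) as hc; intros e he; destruct (hc e he) as [d [hd k]].
  exists d; split; [exact hd|]; intros s hs; rewrite !circ_Cexp by lra; apply k; exact hs.
Qed.

(** The exponential carries the rectangle over [[ln r, ln s]] of height [2 PI] onto the annulus. Its
    horizontal sides cancel by periodicity, and Goursat's theorem leaves the two circles,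
    parametrized by angle. *)
Lemma circle_int_const (r s : R) : 0 < r <= s -> s < R0 -> circle_int r = circle_int s.
Proof.
  intros hr hs; pose proof PI_RGT_0.
  assert (hl : ln r <= ln s) by (destruct (Req_dec r s) as [->|hne]; [lra|left; apply ln_increasing; lra]).
  pose proof (goursat (fun w => h (Cexp w)) (ln r) (ln s) 0 (2 * PI) hl ltac:(lra)
    ltac:(apply hol_exp_strip; rewrite exp_ln; lra)) as hg.
  unfold Jrect in hg.
  assert (he : forall x, Cexp (x, 2 * PI) = Cexp (x, 0)).
  { intros x; unfold Cexp; simpl; rewrite cos_2PI, sin_2PI, cos_0, sin_0; reflexivity. }
  assert (e1 : (fun x => h (Cexp (x, 2 * PI))) = (fun x => h (Cexp (x, 0))))
    by (apply functional_extensionality; intros x; rewrite he; reflexivity).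
  assert (e2 : forall r', 0 < r' -> (fun t => h (Cexp (ln r', t))) = (fun t => h (circ r' t)))
    by (intros r' hr'; apply functional_extensionality; intros t; rewrite circ_Cexp by exact hr'; reflexivity).
  rewrite e1, !e2 in hg by lra; fold (circle_int r) (circle_int s) in hg.
  assert (hz : (Ci * (circle_int s - circle_int r))%C = 0%C) by (rewrite <- hg; ring).
  replace (circle_int r) with (circle_int s + Ci * (Ci * (circle_int s - circle_int r)))%C.
  - rewrite hz; ring.
  - replace (Ci * (Ci * (circle_int s - circle_int r)))%C
      with ((Ci * Ci) * (circle_int s - circle_int r))%C by ring.
    replace (Ci * Ci)%C with (- (1))%C by (apply injective_projections; simpl; ring); ring.
Qed.

(** The mean over a circle is independent of the radius and tends to [l] as the circle shrinks. Only
    the limit of [h] at the origin enters, so difference quotients can be inserted directly. *)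
Theorem circle_mean (l : C) (r : R) : 0 < r < R0 ->
  (forall e, 0 < e -> exists d, 0 < d /\ forall z, 0 < Cmod z < d -> Cmod (h z - l) <= e) ->
  is_Cint (fun t => h (circ r t)) 0 (2 * PI) (RtoC (2 * PI) * l)%C.
Proof.
  intros hr hl; pose proof PI_RGT_0.
  replace (RtoC (2 * PI) * l)%C with (circle_int r); [apply is_circle_int; exact hr|].
  assert (hc : forall s, 0 < s < R0 -> circle_int s = circle_int r).
  { intros s hs; destruct (Rle_dec s r); [|symmetry]; apply circle_int_const; lra. }
  apply Cminus_eq_0, Cmod_eq_0, Rle_antisym; [|apply Cmod_ge_0]; apply le_epsilon; intros e he.
  rewrite Rplus_0_l.
  destruct (hl (e / (2 * PI)) ltac:(apply Rdiv_lt_0_compat; lra)) as [d [hd k]].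
  set (s := Rmin d r / 2); assert (hm : 0 < Rmin d r) by (apply Rmin_pos; lra).
  pose proof (Rmin_l d r); pose proof (Rmin_r d r).
  assert (hs : 0 < s < R0) by (unfold s; lra); rewrite <- (hc s hs).
  replace e with (e / (2 * PI) * (2 * PI - 0)) by (field; lra).
  replace (RtoC (2 * PI)) with (RtoC (2 * PI - 0)) by (f_equal; ring).
  apply (is_Cint_bound (fun t => (h (circ s t) - l)%C)); [lra| |].
  - apply is_Cint_minus; [lra|apply is_circle_int; exact hs|apply is_Cint_const].
  - intros t ht; apply k; rewrite Cmod_circ by lra; unfold s; lra.
Qed.

End PuncturedDisc.

(** The derivative at [0] is the mean of [(f z - f 0) / z] over circles of radius [r < R0].
    Subtracting [f 0] costs the factor [2]. *)
Lemma cauchy_estimate_C (f : C -> C) (R0 M : R) (d : C) : 0 < R0 ->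
  (forall z, Cmod z < R0 -> exists l, hasdC f z l) ->
  (forall z, Cmod z < R0 -> Cmod (f z) <= M) ->
  hasdC f 0 d -> Cmod d <= 2 * M / R0.
Proof.
  intros hR hol hM hd; pose proof PI_RGT_0.
  assert (hr : forall r, 0 < r < R0 -> Cmod d * r <= 2 * M).
  { intros r hr.
    assert (hi : is_Cint (fun t => ((f (circ r t) - f 0) / circ r t)%C) 0 (2 * PI) (RtoC (2 * PI) * d)%C).
    { apply (circle_mean (fun z => ((f z - f 0) / z)%C) R0); [|exact hr|].
      - intros z hz; destruct (hol z ltac:(lra)) as [l hl]; eexists; apply hasd_div.
        + apply hasd_minus; [exact hl|apply hasd_const].
        + apply hasd_id.
        + intros h0; rewrite h0, Cmod_0 in hz; lra.
      - intros e he; destruct (proj1 (hasd_iff _ _ _) hd e he) as [s [hs k]].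
        exists s; split; [exact hs|]; intros z hz; specialize (k z ltac:(lra)).
        rewrite Cplus_0_l in k.
        assert (hz0 : z <> 0%C) by (intros h0; rewrite h0, Cmod_0 in hz; lra).
        replace ((f z - f 0) / z - d)%C with ((f z - f 0 - z * d) / z)%C by (cfield; exact hz0).
        rewrite Cmod_div by exact hz0.
        apply Rmult_le_reg_r with (Cmod z); [lra|].
        unfold Rdiv; rewrite Rmult_assoc, Rinv_l, Rmult_1_r by lra; exact k. }
    pose proof (is_Cint_bound _ 0 (2 * PI) _ (2 * M / r) ltac:(lra) hi) as hb.
    rewrite Cmod_mult, Cmod_R, Rabs_pos_eq in hb by lra.
    assert (hb' : 2 * PI * Cmod d <= 2 * M / r * (2 * PI - 0)).
    { apply hb; intros t ht; rewrite Cmod_div, Cmod_circ by (lra || apply circ_neq_0; lra).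
      apply Rmult_le_compat_r; [left; apply Rinv_0_lt_compat; lra|].
      unfold Cminus; eapply Rle_trans; [apply Cmod_triangle|]; rewrite Cmod_opp.
      pose proof (hM 0%C ltac:(rewrite Cmod_0; lra)).
      pose proof (hM (circ r t) ltac:(rewrite Cmod_circ; lra)); lra. }
    replace (2 * M / r * (2 * PI - 0)) with (2 * PI * (2 * M / r)) in hb' by ring.
    apply Rmult_le_reg_l in hb'; [|lra].
    apply (Rmult_le_compat_r r) in hb'; [|lra].
    replace (2 * M / r * r) with (2 * M) in hb' by (field; lra); exact hb'. }
  apply Rmult_le_reg_r with R0; [exact hR|].
  replace (2 * M / R0 * R0) with (2 * M) by (field; lra).
  apply Rnot_lt_le; intros hlt.
  assert (hdp := Cmod_ge_0 d).
  assert (hM0 : 0 <= M) by (eapply Rle_trans; [apply Cmod_ge_0|apply (hM 0%C); rewrite Cmod_0; lra]).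
  assert (hd0 : 0 < Cmod d) by nra.
  (* If the limit bound failed, this radius would lie strictly between [2 * M / Cmod d] and [R0] and
     contradict [hr]. *)
  set (r := (2 * M / Cmod d + R0) / 2).
  assert (hq : 2 * M / Cmod d < R0).
  { apply Rmult_lt_reg_r with (Cmod d); [exact hd0|].
    replace (2 * M / Cmod d * Cmod d) with (2 * M) by (field; lra); lra. }
  assert (hq0 : 0 <= 2 * M / Cmod d) by (apply Rmult_le_pos; [lra|left; apply Rinv_0_lt_compat; lra]).
  specialize (hr r ltac:(unfold r; lra)).
  assert (h2 : 2 * M / Cmod d < r) by (unfold r; lra).
  apply (Rmult_lt_compat_l (Cmod d)) in h2; [|exact hd0].
  replace (Cmod d * (2 * M / Cmod d)) with (2 * M) in h2 by (field; lra); lra.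
Qed.

(** * Cauchy estimates *)

(** The structures on both sides are reconciled by conversion, since [scal] can reach the same
    module along several paths. *)
Ltac rewrite_norm_scal :=
  match goal with |- context [@norm ?K ?V (@scal ?R ?M ?c ?v)] =>
    replace (@norm K V (@scal R M c v)) with (Cmod c * @norm C_AbsRing V v)
      by (symmetry; exact (norm_scalC c v))
  end.

Ltac norm_lhs r :=
  match goal with
  | |- (@norm ?K ?V ?t <= _) => let E := fresh in assert (E : t = r) by modv V; rewrite E; clear E
  | |- (@norm ?K ?V ?t < _) => let E := fresh in assert (E : t = r) by modv V; rewrite E; clear E
  end.

Definition holomorphic_near {U V : NormedModule C_AbsRing} (f : U -> V) (x : U) (r : R) : Prop :=
  forall y, norm (minus y x) < r -> ex_filterdiff f (locally y).

Section FrechetOperations.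

Context {U V : NormedModule C_AbsRing}.
Implicit Types (f : U -> V) (x y h k : U).

Lemma frechet_translate f (h y : U) (L : Lop U V) :
  frechet f (plus y h) L -> frechet (fun u => f (plus u h)) y L.
Proof.
  intros hL e he; destruct (hL e he) as [d [hd k]]; exists d; split; [exact hd|]; intros v hv.
  replace (plus (plus y v) h) with (plus (plus y h) v) by modv U; apply k; exact hv.
Qed.

Lemma frechet_scal f (c : C) y (L : Lop U V) :
  frechet f y L -> frechet (fun u => scal (c : C_AbsRing) (f u)) y (scal (c : C_AbsRing) L).
Proof.
  intros hL.
  intros e he; pose proof (Cmod_ge_0 c) as hc.
  destruct (hL (e / (Cmod c + 1)) ltac:(apply Rdiv_lt_0_compat; lra)) as [d [hd k]].
  exists d; split; [exact hd|]; intros v hv; specialize (k v hv).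
  change ((scal (c : C_AbsRing) L : Lop U V) v) with (@scal (AbsRing.Ring C_AbsRing) _ c (L v)).
  norm_lhs (scal (c : C_AbsRing) (minus (minus (f (plus y v)) (f y)) (L v))).
  rewrite_norm_scal; apply Rle_trans with ((Cmod c + 1) * (e / (Cmod c + 1) * norm v)).
  - apply Rmult_le_compat; try apply norm_ge_0; try lra; exact k.
  - right; field; lra.
Qed.

Lemma frechet_minus (f g : U -> V) (x : U) (A B : Lop U V) :
  frechet f x A -> frechet g x B -> frechet (fun u => minus (f u) (g u)) x (minus A B).
Proof.
  intros hf hg e he.
  destruct (hf (e / 2) ltac:(lra)) as [d1 [hd1 h1]], (hg (e / 2) ltac:(lra)) as [d2 [hd2 h2]].
  exists (Rmin d1 d2); split; [apply Rmin_pos; assumption|]; intros h hh.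
  pose proof (Rmin_l d1 d2); pose proof (Rmin_r d1 d2).
  specialize (h1 h ltac:(lra)); specialize (h2 h ltac:(lra)).
  change ((minus A B : Lop U V) h) with (minus (A h) (B h)).
  norm_lhs (minus (minus (minus (f (plus x h)) (f x)) (A h)) (minus (minus (g (plus x h)) (g x)) (B h))).
  eapply Rle_trans; [apply norm_minus_triangle|]; lra.
Qed.

End FrechetOperations.

Section CauchyEstimates.

Context {U V : NormedModule C_AbsRing}.
Implicit Types (f : U -> V) (x y h k : U).

(** For a unit direction [v], the scalar estimate is applied on the complex line [x + z v] to the
    composition of [f] with a norming functional of [L v]. *)
Lemma cauchy_estimate f x (L : Lop U V) (r M : R) : 0 < r ->
  holomorphic_near f x r -> (forall y, norm (minus y x) < r -> norm (f y) <= M) ->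
  frechet f x L -> opnorm L <= 2 * M / r.
Proof.
  intros hr hol hM hL; destruct (opnorm_correct L) as [_ hlub]; apply hlub.
  intros b [v [hv ->]]; destruct (hahn_banach_norming (L v)) as [phi [h1 h2]].
  assert (hin : forall z : C, Cmod z < r -> norm (minus (plus x (scal (z : C_AbsRing) v)) x) < r).
  { intros z hz; norm_lhs (scal (z : C_AbsRing) v).
    rewrite_norm_scal; pose proof (Cmod_ge_0 z); pose proof (norm_ge_0 v); nra. }
  assert (h3 : Cmod (phi (L v)) <= 2 * M / r).
  { apply (cauchy_estimate_C (fun z => phi (f (plus x (scal (z : C_AbsRing) v)))) r M (phi (L v)) hr).
    - intros z hz; eexists; apply (hasd_comp_linear (fun z : C => f (plus x (scal (z : C_AbsRing) v))) phi).
      apply frechet_line, fderiv_frechet, hol, hin, hz.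
    - intros z hz; eapply Rle_trans; [apply h2|]; apply hM, hin, hz.
    - apply (hasd_comp_linear (fun z : C => f (plus x (scal (z : C_AbsRing) v))) phi), frechet_line.
      replace (plus x (scal (RtoC 0 : C_AbsRing) v)) with x by modv U; exact hL. }
  rewrite h1, Cmod_R, Rabs_pos_eq in h3 by apply norm_ge_0; exact h3.
Qed.

Lemma norm_in_ball (x y h : U) (r s : R) :
  norm (minus y x) < r -> norm h <= s -> norm (minus (plus y h) x) < r + s.
Proof.
  intros h1 h2; norm_lhs (plus (minus y x) h).
  eapply Rle_lt_trans; [apply norm_triangle|]; lra.
Qed.

Section BoundedHolomorphic.

Context (f : U -> V) (x : U) (r M : R) (hr : 0 < r).
Hypothesis hol : holomorphic_near f x r.
Hypothesis hM : forall y, norm (minus y x) < r -> norm (f y) <= M.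

Let hM0 : 0 <= M.
Proof.
  eapply Rle_trans; [apply (norm_ge_0 (f x))|apply (hM x)].
  norm_lhs (zero : U); rewrite norm_zero; exact hr.
Qed.

Lemma fderiv_bound y : norm (minus y x) < r / 2 -> opnorm (fderiv f y) <= 4 * M / r.
Proof.
  intros hy.
  replace (4 * M / r) with (2 * M / (r / 2)) by (field; lra).
  assert (hin : forall z, norm (minus z y) < r / 2 -> norm (minus z x) < r).
  { intros z hz; eapply Rle_lt_trans; [apply (norm_minus_trans _ y)|]; lra. }
  apply (cauchy_estimate f y); [lra|intros z hz; apply hol, hin, hz|intros z hz; apply hM, hin, hz|].
  apply fderiv_frechet, hol; lra.
Qed.

Lemma increment_bound y h : norm (minus y x) < r / 4 -> norm h < r / 4 ->
  norm (minus (f (plus y h)) (f y)) <= 4 * M / r * norm h.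
Proof.
  intros hy hh.
  pose proof (segment_bound (fun s : C => f (plus y (scal (s : C_AbsRing) h)))
    (fun t => fderiv f (plus y (scal (RtoC t : C_AbsRing) h)) h) (4 * M / r * norm h)) as hs.
  cbv beta in hs.
  replace (plus y (scal (RtoC 1 : C_AbsRing) h)) with (plus y h) in hs by modv U.
  replace (plus y (scal (RtoC 0 : C_AbsRing) h)) with y in hs by modv U.
  assert (hin : forall t, 0 <= t <= 1 -> norm (minus (plus y (scal (RtoC t : C_AbsRing) h)) x) < r / 2).
  { intros t ht; replace (r / 2) with (r / 4 + r / 4) by field; apply norm_in_ball; [exact hy|].
    rewrite_norm_scal; rewrite Cmod_R, Rabs_pos_eq by lra; pose proof (norm_ge_0 h); nra. }
  apply hs; intros t ht; specialize (hin t ht).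
  - apply frechet_line, fderiv_frechet, hol; lra.
  - eapply Rle_trans; [apply opnorm_bound|]; apply Rmult_le_compat_r; [apply norm_ge_0|].
    apply fderiv_bound; exact hin.
Qed.

(** The difference of the derivatives is the derivative of the increment [f (u + h) - f u], a
    holomorphic function of [u] that is bounded by a multiple of [norm h]. The Cauchy estimate thus
    yields a Lipschitz bound before any second derivative exists. *)
Lemma fderiv_increment_bound y h : norm (minus y x) < r / 8 -> norm h < r / 4 ->
  opnorm (minus (fderiv f (plus y h)) (fderiv f y)) <= 64 * M / (r * r) * norm h.
Proof.
  intros hy hh.
  replace (64 * M / (r * r) * norm h) with (2 * (4 * M / r * norm h) / (r / 8)) by (field; lra).
  assert (hin : forall z, norm (minus z y) < r / 8 -> norm (minus z x) < r / 4).
  { intros z hz; eapply Rle_lt_trans; [apply (norm_minus_trans _ y)|]; lra. }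
  assert (hin2 : forall z, norm (minus z y) < r / 8 -> norm (minus (plus z h) x) < r).
  { intros z hz; eapply Rlt_le_trans; [exact (norm_in_ball x z h _ _ (hin z hz) (Rlt_le _ _ hh))|lra]. }
  assert (hd : forall z, norm (minus z y) < r / 8 ->
    frechet (fun u => minus (f (plus u h)) (f u)) z (minus (fderiv f (plus z h)) (fderiv f z))).
  { intros z hz; apply frechet_minus.
    - apply frechet_translate, fderiv_frechet, hol, hin2, hz.
    - apply fderiv_frechet, hol; specialize (hin z hz); lra. }
  apply (cauchy_estimate (fun u => minus (f (plus u h)) (f u)) y); [lra| | |].
  - intros z hz; eapply ex_filterdiff_frechet, hd, hz.
  - intros z hz; apply increment_bound; [apply hin, hz|exact hh].
  - apply hd; norm_lhs (zero : U); rewrite norm_zero; lra.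
Qed.

(** The mean value bound for the remainder along the segment, whose derivative is controlled by the
    Lipschitz bound for [fderiv f]. *)
Lemma quadratic_bound y h : norm (minus y x) < r / 8 -> norm h < r / 4 ->
  norm (minus (minus (f (plus y h)) (f y)) (fderiv f y h)) <= 64 * M / (r * r) * (norm h * norm h).
Proof.
  intros hy hh.
  pose proof (segment_bound
    (* The linear term is written with [plus zero] to fit [frechet_line] with base point [0]. *)
    (fun s : C => minus (f (plus y (scal (s : C_AbsRing) h))) (fderiv f y (plus (zero : U) (scal (s : C_AbsRing) h))))
    (fun t => minus (fderiv f (plus y (scal (RtoC t : C_AbsRing) h)) h) (fderiv f y h))
    (64 * M / (r * r) * (norm h * norm h))) as hs.
  cbv beta in hs.
  replace (plus y (scal (RtoC 1 : C_AbsRing) h)) with (plus y h) in hs by modv U.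
  replace (plus y (scal (RtoC 0 : C_AbsRing) h)) with y in hs by modv U.
  replace (plus (zero : U) (scal (RtoC 1 : C_AbsRing) h)) with h in hs by modv U.
  replace (plus (zero : U) (scal (RtoC 0 : C_AbsRing) h)) with (zero : U) in hs by modv U.
  rewrite (linear_zero _ (Lop_is_linear (fderiv f y))) in hs.
  norm_lhs (minus (minus (f (plus y h)) (fderiv f y h)) (minus (f y) (zero : V))).
  assert (hth : forall t, 0 <= t <= 1 -> norm (scal (RtoC t : C_AbsRing) h) <= norm h).
  { intros t ht; rewrite_norm_scal; rewrite Cmod_R, Rabs_pos_eq by lra; pose proof (norm_ge_0 h); nra. }
  assert (hin : forall t, 0 <= t <= 1 -> norm (minus (plus y (scal (RtoC t : C_AbsRing) h)) x) < r).
  { intros t ht; assert (hlt : norm h < r / 4) by exact hh.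
    eapply Rlt_trans; [exact (norm_in_ball x y (scal (RtoC t : C_AbsRing) h) _ _ hy (hth t ht))|lra]. }
  apply hs; intros t ht.
  - assert (h1 : hasd (fun s : C => f (plus y (scal (s : C_AbsRing) h))) (RtoC t)
       (fderiv f (plus y (scal (RtoC t : C_AbsRing) h)) h))
      by (apply frechet_line, fderiv_frechet, hol, hin, ht).
    assert (h2 : hasd (fun s : C => fderiv f y (plus (zero : U) (scal (s : C_AbsRing) h))) (RtoC t) (fderiv f y h))
      by (apply frechet_line, frechet_linear).
    eapply hasd_eq; [apply (frechet_hasd (V := V)); exact (frechet_minus (U:=C_NormedModule) _ _ _ _ _ h1 h2)|].
    change (minus (scal (RtoC 1 : C_AbsRing) (fderiv f (plus y (scal (RtoC t : C_AbsRing) h)) h))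
      (scal (RtoC 1 : C_AbsRing) (fderiv f y h)) =
      minus (fderiv f (plus y (scal (RtoC t : C_AbsRing) h)) h) (fderiv f y h)).
    modv V.
  - change (norm ((minus (fderiv f (plus y (scal (RtoC t : C_AbsRing) h))) (fderiv f y) : Lop U V) h)
      <= 64 * M / (r * r) * (norm h * norm h)).
    eapply Rle_trans; [apply opnorm_bound|]; rewrite <- Rmult_assoc.
    apply Rmult_le_compat_r; [apply norm_ge_0|].
    specialize (hth t ht).
    eapply Rle_trans; [apply fderiv_increment_bound; [exact hy|lra]|].
    apply Rmult_le_compat_l; [|exact hth].
    apply Rmult_le_pos; [lra|left; apply Rinv_0_lt_compat; nra].
Qed.

End BoundedHolomorphic.

End CauchyEstimates.

(** * Holomorphy of the derivative *)

Definition seq_converges {V : NormedModule C_AbsRing} (u : nat -> V) (l : V) : Prop :=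
  forall e, 0 < e -> exists N, forall n, (N <= n)%nat -> norm (minus (u n) l) <= e.

(** Completeness as a predicate on normed modules, in sequential form, so that it can be transported
    up the tower of operator spaces [Lmulti X m]. *)
Definition banach (V : NormedModule C_AbsRing) : Prop :=
  forall u : nat -> V,
    (forall e, 0 < e -> exists N, forall n m, (N <= n)%nat -> (N <= m)%nat ->
       norm (minus (u n) (u m)) <= e) ->
    exists l, seq_converges u l.

(** The tails of the sequence generate a Cauchy filter; [norm_factor] translates between its balls
    and the norm. *)
Lemma complete_banach (V : CompleteNormedModule C_AbsRing) : banach V.
Proof.
  intros u hu.
  set (F := fun P : V -> Prop => exists N, forall n, (N <= n)%nat -> P (u n)).
  assert (hF : ProperFilter F).
  { constructor.
    - intros P [N h]; exists (u N); apply h; lia.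
    - constructor.
      + exists O; intros; exact I.
      + intros P Q [N h] [M h']; exists (Nat.max N M); intros n hn; split; [apply h|apply h']; lia.
      + intros P Q hPQ [N h]; exists N; intros n hn; apply hPQ, h, hn. }
  assert (hc : cauchy F).
  { intros e; destruct (hu (e / 2)) as [N h]; [pose proof (cond_pos e); lra|].
    exists (u N), N; intros n hn; apply (norm_compat1 (u N) (u n)).
    eapply Rle_lt_trans; [apply (h n N hn (le_n N))|]; pose proof (cond_pos e); lra. }
  exists (lim F); intros e he.
  assert (hn := @norm_factor_gt_0 C_AbsRing V).
  assert (hp : 0 < e / @norm_factor C_AbsRing V) by (apply Rdiv_lt_0_compat; assumption).
  destruct (complete_cauchy F hF hc (mkposreal _ hp)) as [N h]; exists N; intros n hle.
  pose proof (norm_compat2 (lim F) (u n) (mkposreal _ hp) (h n hle)) as hlt; simpl in hlt.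
  replace (@norm_factor C_AbsRing V * (e / @norm_factor C_AbsRing V)) with e in hlt by (field; lra).
  left; exact hlt.
Qed.

Section Limits.

Context {V : NormedModule C_AbsRing}.
Implicit Types (u v : nat -> V) (k l : V).

Lemma seq_converges_norm_le u l (w : V) (b : R) :
  seq_converges u l -> (exists N, forall n, (N <= n)%nat -> norm (minus (u n) w) <= b) ->
  norm (minus l w) <= b.
Proof.
  intros hu [N hN]; apply le_epsilon; intros e he; destruct (hu e he) as [M hM].
  specialize (hN (Nat.max N M) ltac:(lia)); specialize (hM (Nat.max N M) ltac:(lia)).
  eapply Rle_trans; [apply (norm_minus_trans _ (u (Nat.max N M)))|].
  rewrite norm_minus_sym; lra.
Qed.

Lemma seq_converges_unique u l k : seq_converges u l -> seq_converges u k -> l = k.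
Proof.
  intros h1 h2; apply minus_zero_iff, norm_eq0_of_le; intros e he.
  apply (seq_converges_norm_le u l k e h1); exact (h2 e he).
Qed.

Lemma seq_converges_plus u v l k : seq_converges u l -> seq_converges v k ->
  seq_converges (fun n => plus (u n) (v n)) (plus l k).
Proof.
  intros h1 h2 e he; destruct (h1 (e / 2) ltac:(lra)) as [N hN], (h2 (e / 2) ltac:(lra)) as [M hM].
  exists (Nat.max N M); intros n hn; specialize (hN n ltac:(lia)); specialize (hM n ltac:(lia)).
  norm_lhs (plus (minus (u n) l) (minus (v n) k)).
  eapply Rle_trans; [apply norm_triangle|]; lra.
Qed.

Lemma seq_converges_scal (c : C) u l : seq_converges u l ->
  seq_converges (fun n => scal (c : C_AbsRing) (u n)) (scal (c : C_AbsRing) l).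
Proof.
  intros h e he; pose proof (Cmod_ge_0 c).
  destruct (h (e / (Cmod c + 1)) ltac:(apply Rdiv_lt_0_compat; lra)) as [N hN].
  exists N; intros n hn; specialize (hN n hn).
  norm_lhs (scal (c : C_AbsRing) (minus (u n) l)); rewrite_norm_scal.
  apply Rle_trans with ((Cmod c + 1) * (e / (Cmod c + 1))); [|right; field; lra].
  apply Rmult_le_compat; try apply norm_ge_0; lra.
Qed.

Lemma seq_converges_close u v l : seq_converges u l ->
  (forall e, 0 < e -> exists N, forall n, (N <= n)%nat -> norm (minus (v n) (u n)) <= e) ->
  seq_converges v l.
Proof.
  intros h1 h2 e he; destruct (h1 (e / 2) ltac:(lra)) as [N hN], (h2 (e / 2) ltac:(lra)) as [M hM].
  exists (Nat.max N M); intros n hn; specialize (hN n ltac:(lia)); specialize (hM n ltac:(lia)).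
  eapply Rle_trans; [apply (norm_minus_trans _ (u n))|]; lra.
Qed.

End Limits.

Lemma banach_Lop (U V : NormedModule C_AbsRing) : banach V -> banach (Lop_NormedModule U V).
Proof.
  intros hV u hu.
  assert (hlim : forall x : U, exists l : V, seq_converges (fun n => (u n : Lop U V) x) l).
  { intros x; apply hV; intros e he.
    pose proof (norm_ge_0 x).
    destruct (hu (e / (norm x + 1)) ltac:(apply Rdiv_lt_0_compat; lra)) as [N h].
    exists N; intros n m hn hm; specialize (h n m hn hm).
    eapply Rle_trans; [exact (opnorm_bound (minus (u n) (u m) : Lop U V) x)|].
    apply Rle_trans with (e / (norm x + 1) * (norm x + 1)); [|right; field; lra].
    apply Rmult_le_compat; try apply opnorm_ge0; try apply norm_ge_0; [exact h|lra]. }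
  set (L := fun x : U => epsilon (inhabits (zero : V)) (fun l : V => seq_converges (fun n => (u n : Lop U V) x) l)).
  assert (hL : forall x, seq_converges (fun n => (u n : Lop U V) x) (L x))
    by (intros x; apply (epsilon_spec (inhabits (zero : V)) _ (hlim x))).
  destruct (hu 1 Rlt_0_1) as [N0 h0].
  assert (hb : forall x : U, norm (L x) <= (opnorm (u N0) + 1) * norm x).
  { intros x.
    assert (h : norm (minus (L x) ((u N0 : Lop U V) x)) <= 1 * norm x).
    { apply (seq_converges_norm_le _ _ _ _ (hL x)); exists N0; intros n hn.
      eapply Rle_trans; [exact (opnorm_bound (minus (u n) (u N0) : Lop U V) x)|].
      apply Rmult_le_compat_r; [apply norm_ge_0|]; apply h0; [exact hn|lia]. }
    eapply Rle_trans; [apply (norm_le_add _ ((u N0 : Lop U V) x))|].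
    pose proof (opnorm_bound (u N0 : Lop U V) x); lra. }
  assert (hlin : is_linear L).
  { split.
    - intros x y; refine (seq_converges_unique _ _ _ (hL (plus x y)) _).
      replace (fun n => (u n : Lop U V) (plus x y))
        with (fun n => plus ((u n : Lop U V) x) ((u n : Lop U V) y)).
      + apply seq_converges_plus; apply hL.
      + apply functional_extensionality; intros n; symmetry.
        apply (linear_plus _ (Lop_is_linear (u n : Lop U V))).
    - intros c x; refine (seq_converges_unique _ _ _ (hL (scal c x)) _).
      replace (fun n => (u n : Lop U V) (scal c x))
        with (fun n => scal c ((u n : Lop U V) x)).
      + apply (seq_converges_scal c); apply hL.
      + apply functional_extensionality; intros n; symmetry.
        apply (linear_scal _ (Lop_is_linear (u n : Lop U V))).
    - exists (opnorm (u N0) + 1); split; [|exact hb].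
      pose proof (opnorm_ge0 (u N0 : Lop U V)); lra. }
  exists (mkLop L hlin); intros e he; destruct (hu e he) as [N h]; exists N; intros n hn.
  apply opnorm_le; [lra|]; intros x.
  change (norm (minus ((u n : Lop U V) x) (L x)) <= e * norm x); rewrite norm_minus_sym.
  apply (seq_converges_norm_le _ _ _ _ (hL x)); exists N; intros m hm.
  eapply Rle_trans; [exact (opnorm_bound (minus (u m) (u n) : Lop U V) x)|].
  apply Rmult_le_compat_r; [apply norm_ge_0|]; apply h; [exact hm|exact hn].
Qed.

(** * Linear part of an approximately linear map *)

Section AlmostLinear.

Context {U W : NormedModule C_AbsRing} (hW : banach W).

Lemma eventually_small (b e : R) : 0 < e -> exists N, forall n, (N <= n)%nat -> b / INR (S n) <= e.
Proof.
  intros he; destruct (INR_unbounded (Rabs b / e)) as [N hN]; exists N; intros n hn.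
  assert (h : INR N <= INR (S n)) by (apply le_INR; lia).
  assert (hp : 0 < INR (S n)) by (apply lt_0_INR; lia).
  apply Rmult_le_reg_r with (INR (S n)); [exact hp|].
  unfold Rdiv; rewrite Rmult_assoc, Rinv_l, Rmult_1_r by lra.
  apply Rle_trans with (Rabs b); [apply Rle_abs|].
  apply (Rmult_lt_compat_l e) in hN; [|exact he].
  replace (e * (Rabs b / e)) with (Rabs b) in hN by (field; lra).
  apply Rle_trans with (1 := Rlt_le _ _ hN); apply Rmult_le_compat_l; lra.
Qed.

(* A map that is linear up to errors of second order has a linear part, its
   derivative at the origin, obtained as the limit of [n A (k / n)]. *)
Lemma almost_linear_frechet (A : U -> W) (r K : R) : 0 < r -> 0 <= K ->
  (forall k, norm k < r -> norm (A k) <= K * norm k) ->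
  (forall (c : C) k, norm k < r -> Cmod c * norm k < r ->
     norm (minus (A (scal (c : C_AbsRing) k)) (scal (c : C_AbsRing) (A k)))
       <= K * ((Cmod c * Cmod c + Cmod c) * (norm k * norm k))) ->
  (forall h k, norm h < r / 2 -> norm k < r / 2 ->
     norm (minus (A (plus h k)) (plus (A h) (A k)))
       <= K * ((norm h + norm k) * (norm h + norm k))) ->
  exists L : Lop U W, forall k, norm k < r -> norm (minus (A k) (L k)) <= 2 * K * (norm k * norm k).
Proof.
  intros hr hK hbd hhom hadd.
  set (a := fun (k : U) (n : nat) =>
    scal (RtoC (INR (S n)) : C_AbsRing) (A (scal (RtoC (/ INR (S n)) : C_AbsRing) k)) : W).
  assert (hpos : forall n, 0 < INR (S n)) by (intros n; apply lt_0_INR; lia).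
  assert (hge1 : forall n, 1 <= INR (S n)) by (intros n; apply (le_INR 1); lia).
  assert (hsm : forall (k : U) n, norm (scal (RtoC (/ INR (S n)) : C_AbsRing) k) = norm k / INR (S n)).
  { intros k n; rewrite_norm_scal.
    rewrite Cmod_R, Rabs_pos_eq by (left; apply Rinv_0_lt_compat, hpos); unfold Rdiv; ring. }
  assert (hstep : forall k n m, (n <= m)%nat -> norm k / INR (S n) < r ->
            norm (minus (a k m) (a k n)) <= 2 * K * (norm k * norm k) / INR (S n)).
  { intros k n m hnm hk.
    set (k' := scal (RtoC (/ INR (S n)) : C_AbsRing) k : U).
    (* The argument with index [m] is [c] times the one with index [n], so approximate homogeneity
       compares the two terms of the sequence. *)
    set (c := INR (S n) / INR (S m)).
    assert (hSnm : INR (S n) <= INR (S m)) by (apply le_INR; lia).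
    pose proof (hpos n) as hn; pose proof (hpos m) as hm.
    assert (hc : 0 < c <= 1).
    { split; [apply Rdiv_lt_0_compat; assumption|].
      apply Rmult_le_reg_r with (INR (S m)); [exact hm|].
      unfold c, Rdiv; rewrite Rmult_assoc, Rinv_l; lra. }
    assert (hk' : norm k' = norm k / INR (S n)) by apply hsm.
    pose proof (hhom (RtoC c) k') as h; rewrite Cmod_R, Rabs_pos_eq in h by lra.
    specialize (h ltac:(lra)); rewrite hk' in h.
    assert (hk0 : 0 <= norm k / INR (S n)) by (rewrite <- hk'; apply norm_ge_0).
    specialize (h ltac:(nra)).
    replace (minus (a k m) (a k n)) with (scal (RtoC (INR (S m)) : C_AbsRing)
      (minus (A (scal (RtoC c : C_AbsRing) k')) (scal (RtoC c : C_AbsRing) (A k')))).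
    - rewrite_norm_scal; rewrite Cmod_R, Rabs_pos_eq by lra.
      apply (Rmult_le_compat_l (INR (S m))) in h; [|lra].
      eapply Rle_trans; [exact h|].
      replace (INR (S m) * (K * ((c * c + c) * (norm k / INR (S n) * (norm k / INR (S n))))))
        with (K * (norm k * norm k) / INR (S n) * (c + 1)) by (unfold c; field; lra).
      replace (2 * K * (norm k * norm k) / INR (S n))
        with (K * (norm k * norm k) / INR (S n) * 2) by (field; lra).
      apply Rmult_le_compat_l; [|lra].
      apply Rmult_le_pos; [|left; apply Rinv_0_lt_compat, hn].
      apply Rmult_le_pos; [exact hK|]; apply Rmult_le_pos; apply norm_ge_0.
    - unfold a, k'.
      replace (scal (RtoC c : C_AbsRing) (scal (RtoC (/ INR (S n)) : C_AbsRing) k) : U)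
        with (scal (RtoC (/ INR (S m)) : C_AbsRing) k : U).
      + module_with (NormedModule.ModuleSpace C_AbsRing W) ltac:(c_unfold;
          unfold c; clear - hn hm; revert hn hm; generalize (INR (S n)) (INR (S m)); intros p q hn hm;
          apply injective_projections; simpl; field; lra).
      + module_with (NormedModule.ModuleSpace C_AbsRing U) ltac:(c_unfold;
          unfold c; clear - hn hm; revert hn hm; generalize (INR (S n)) (INR (S m)); intros p q hn hm;
          apply injective_projections; simpl; field; lra). }
  assert (hev : forall k : U, exists N, forall n, (N <= n)%nat -> norm k / INR (S n) < r / 2).
  { intros k; destruct (eventually_small (norm k) (r / 4) ltac:(lra)) as [N h]; exists N; intros n hn.
    specialize (h n hn); lra. }
  assert (hlim : forall k, exists l, seq_converges (a k) l).
  { intros k; apply hW; intros e he; destruct (hev k) as [N1 h1].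
    destruct (eventually_small (2 * K * (norm k * norm k)) e he) as [N2 h2].
    exists (Nat.max N1 N2).
    assert (hw : forall n m, (Nat.max N1 N2 <= n)%nat -> (n <= m)%nat -> norm (minus (a k m) (a k n)) <= e).
    { intros n m hn hnm; eapply Rle_trans; [apply hstep; [exact hnm|]|apply h2; lia].
      specialize (h1 n ltac:(lia)); lra. }
    intros n m hn hm; destruct (Nat.le_ge_cases n m) as [h|h].
    - rewrite norm_minus_sym; apply hw; assumption.
    - apply hw; assumption. }
  set (L := fun k : U => epsilon (inhabits (zero : W)) (fun l : W => seq_converges (a k) l)).
  assert (hL : forall k, seq_converges (a k) (L k))
    by (intros k; apply (epsilon_spec (inhabits (zero : W)) _ (hlim k))).
  assert (hmod : forall n (w : W), norm (scal (RtoC (INR (S n)) : C_AbsRing) w) = INR (S n) * norm w).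
  { intros n w; rewrite_norm_scal; rewrite Cmod_R, Rabs_pos_eq by (left; apply hpos); reflexivity. }
  assert (hlin : is_linear L).
  { split.
    - intros x y; refine (seq_converges_unique _ _ _ (hL (plus x y)) _).
      apply seq_converges_close with (fun n => plus (a x n) (a y n)); [apply seq_converges_plus; apply hL|].
      intros e he; destruct (hev x) as [N1 h1], (hev y) as [N2 h2].
      destruct (eventually_small (K * ((norm x + norm y) * (norm x + norm y))) e he) as [N3 h3].
      exists (Nat.max N1 (Nat.max N2 N3)); intros n hn.
      specialize (h1 n ltac:(lia)); specialize (h2 n ltac:(lia)); specialize (h3 n ltac:(lia)).
      rewrite <- hsm in h1, h2; pose proof (hadd _ _ h1 h2) as h; rewrite !hsm in h.
      apply (Rmult_le_compat_l (INR (S n))) in h; [|left; apply hpos].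
      rewrite <- hmod in h; pose proof (hpos n).
      apply Rle_trans with (2 := h3); eapply Rle_trans; [|eapply Rle_trans; [exact h|]].
      + right; f_equal; unfold a.
        match goal with |- minus (scal _ (A ?p)) _ = _ =>
          let E := fresh in assert (E : p = plus (scal (RtoC (/ INR (S n)) : C_AbsRing) x)
            (scal (RtoC (/ INR (S n)) : C_AbsRing) y)) by modv U; rewrite E; clear E end.
        modv W.
      + right; field; lra.
    - intros c x; refine (seq_converges_unique _ _ _ (hL (scal c x)) _).
      apply seq_converges_close with (fun n => scal c (a x n)); [apply (seq_converges_scal c); apply hL|].
      intros e he; destruct (hev x) as [N1 h1], (hev (scal c x)) as [N2 h2].
      assert (hcx : norm (scal c x) = Cmod c * norm x) by exact (norm_scalC c x).
      destruct (eventually_small (K * ((Cmod c * Cmod c + Cmod c) * (norm x * norm x))) e he) as [N3 h3].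
      exists (Nat.max N1 (Nat.max N2 N3)); intros n hn.
      specialize (h1 n ltac:(lia)); specialize (h2 n ltac:(lia)); specialize (h3 n ltac:(lia)).
      pose proof (hpos n).
      assert (h : norm (minus (A (scal c (scal (RtoC (/ INR (S n)) : C_AbsRing) x)))
                 (scal c (A (scal (RtoC (/ INR (S n)) : C_AbsRing) x))))
               <= K * ((Cmod c * Cmod c + Cmod c) * (norm x / INR (S n) * (norm x / INR (S n))))).
      { rewrite <- hsm; apply hhom.
        - eapply Rle_lt_trans; [right; apply hsm|]; lra.
        - rewrite hsm; rewrite hcx in h2; unfold Rdiv in *; rewrite <- Rmult_assoc; lra. }
      apply (Rmult_le_compat_l (INR (S n))) in h; [|left; apply hpos].
      rewrite <- hmod in h.
      apply Rle_trans with (2 := h3); eapply Rle_trans; [|eapply Rle_trans; [exact h|]].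
      + right; f_equal; unfold a.
        match goal with |- minus (scal _ (A ?p)) _ = _ =>
          let E := fresh in assert (E : p = scal c (scal (RtoC (/ INR (S n)) : C_AbsRing) x))
            by modv U; rewrite E; clear E end.
        modv W.
      + right; field; lra.
    - exists (K + 1); split; [lra|]; intros k; pose proof (norm_ge_0 k).
      replace (L k) with (minus (L k) (zero : W)) by modv W.
      apply Rle_trans with (K * norm k); [|nra].
      apply (seq_converges_norm_le _ _ _ _ (hL k)); destruct (hev k) as [N h]; exists N; intros n hn.
      specialize (h n hn); rewrite <- hsm in h.
      norm_lhs (a k n); unfold a; eapply Rle_trans; [right; apply hmod|].
      pose proof (hbd (scal (RtoC (/ INR (S n)) : C_AbsRing) k) ltac:(lra)) as hb.
      rewrite hsm in hb; pose proof (hpos n).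
      apply (Rmult_le_compat_l (INR (S n))) in hb; [|lra].
      eapply Rle_trans; [exact hb|]; right; field; lra. }
  exists (mkLop L hlin); intros k hk; rewrite norm_minus_sym.
  apply (seq_converges_norm_le _ _ _ _ (hL k)); exists O; intros n _.
  (* The term with index [0] is [A k] itself; its distance to all later terms bounds its distance to
     the limit. *)
  pose proof (hstep k O n ltac:(lia)) as h; simpl INR in h; rewrite !Rdiv_1_r in h; specialize (h hk).
  replace (A k) with (a k O); [exact h|]; unfold a; simpl INR.
  replace (scal (RtoC (/ 1) : C_AbsRing) k) with k
    by (rewrite Rinv_1; modv U).
  modv W.
Qed.

End AlmostLinear.

(** The defect from linearity of [A k = f' (x + k) - f' x] is the derivative at [x] of a combination
    of increments of [f]. First-order terms cancel in this combination, so it is uniformly of second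
    order near [x], and the Cauchy estimate transfers that order to the derivative. Completeness
    then supplies the linear part of [A]. *)
Theorem holomorphic_fderiv {U V : NormedModule C_AbsRing} (f : U -> V) (x : U) (r : R) :
  banach V -> 0 < r -> holomorphic_near f x r -> ex_filterdiff (fderiv f) (locally x).
Proof.
  intros hV hr0 hol0.
  assert (hxx : norm (minus x x) = 0).
  { replace (minus x x) with (zero : U) by modv U; apply norm_zero. }
  destruct (frechet_continuous f x _ (fderiv_frechet f x (hol0 x ltac:(rewrite hxx; exact hr0))) 1 Rlt_0_1)
    as [d [hd hc]].
  set (R0 := Rmin r d); assert (hR : 0 < R0) by (apply Rmin_pos; assumption).
  set (M := norm (f x) + 1).
  assert (hol : holomorphic_near f x R0).
  { intros y hy; apply hol0; pose proof (Rmin_l r d); unfold R0 in hy; lra. }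
  assert (hM : forall y, norm (minus y x) < R0 -> norm (f y) <= M).
  { intros y hy; pose proof (Rmin_r r d); unfold R0 in hy; specialize (hc (minus y x) ltac:(lra)).
    replace (plus x (minus y x)) with y in hc by modv U.
    pose proof (norm_le_add (f y) (f x)); unfold M; lra. }
  assert (hM0 : 0 <= M) by (pose proof (norm_ge_0 (f x)); unfold M; lra).
  set (K := 64 * M / (R0 * R0)).
  assert (hK : 0 <= K) by (apply Rmult_le_pos; [lra|left; apply Rinv_0_lt_compat; nra]).
  (* Small enough for the base points and increments below to stay within the radii [R0 / 8] and
     [R0 / 4] of the preceding bounds. *)
  set (s := R0 / 16).
  assert (hin : forall y h, norm (minus y x) < s -> norm h < s -> norm (minus (plus y h) x) < R0).
  { intros y h h1 h2; eapply Rlt_trans; [exact (norm_in_ball x y h _ _ h1 (Rlt_le _ _ h2))|unfold s; lra]. }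
  assert (hE : forall y h, norm (minus y x) < s -> norm h < s ->
    norm (minus (minus (f (plus y h)) (f y)) (fderiv f y h)) <= K * (norm h * norm h)).
  { intros y h h1 h2; apply (quadratic_bound f x R0 M hR hol hM); unfold s in *; lra. }
  assert (hfr : forall y h, norm (minus y x) < s -> norm h < s ->
    frechet (fun u => minus (f (plus u h)) (f u)) y (minus (fderiv f (plus y h)) (fderiv f y))).
  { intros y h h1 h2; apply frechet_minus; [apply frechet_translate|];
      apply fderiv_frechet, hol; [apply hin; assumption|unfold s in *; lra]. }
  set (A := fun k : U => minus (fderiv f (plus x k)) (fderiv f x) : Lop_NormedModule U V).
  (* One constant dominating the bounds [K], [2 K / s] and [4 K / s] obtained for growth,
     homogeneity and additivity. *)
  set (K' := 8 * K / s + K).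
  assert (hs : 0 < s) by (unfold s; lra).
  assert (hKs : 0 <= K / s) by (apply Rmult_le_pos; [exact hK|left; apply Rinv_0_lt_compat, hs]).
  assert (hK' : 0 <= K') by (unfold K'; unfold Rdiv in *; lra).
  destruct (almost_linear_frechet (banach_Lop U V hV) A s K' hs hK') as [L hL].
  - intros k hk; eapply Rle_trans.
    + apply (fderiv_increment_bound f x R0 M hR hol hM x k); [rewrite hxx; lra|unfold s in *; lra].
    + apply Rmult_le_compat_r; [apply norm_ge_0|]; fold K; unfold K', Rdiv in *; lra.
  - intros c k hk hck.
    assert (hck' : norm (scal (c : C_AbsRing) k) = Cmod c * norm k) by exact (norm_scalC c k).
    assert (h : norm (minus (A (scal (c : C_AbsRing) k)) (scal (c : C_AbsRing) (A k)))
             <= 2 * (K * ((Cmod c * Cmod c + Cmod c) * (norm k * norm k))) / s).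
    { apply (cauchy_estimate (fun u => minus (minus (f (plus u (scal (c : C_AbsRing) k))) (f u))
               (scal (c : C_AbsRing) (minus (f (plus u k)) (f u)))) x _ s); [exact hs| | |].
      - intros y hy; eapply ex_filterdiff_frechet, frechet_minus; [|apply frechet_scal]; apply hfr;
          try assumption; rewrite hck'; exact hck.
      - intros y hy.
        (* The terms [f' (y) (c k)] and [c f' (y) k] cancel, leaving two quadratic remainders. *)
        norm_lhs (minus (minus (minus (f (plus y (scal (c : C_AbsRing) k))) (f y))
             (scal (c : C_AbsRing) (fderiv f y k)))
            (scal (c : C_AbsRing) (minus (minus (f (plus y k)) (f y)) (fderiv f y k)))).
        eapply Rle_trans; [apply norm_minus_triangle|]; rewrite_norm_scal.
        pose proof (hE y k hy hk) as h1; pose proof (hE y (scal (c : C_AbsRing) k) hy) as h2.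
        rewrite (linear_scal _ (Lop_is_linear (fderiv f y))), hck' in h2; specialize (h2 hck).
        apply (Rmult_le_compat_l (Cmod c)) in h1; [|apply Cmod_ge_0].
        eapply Rle_trans; [apply Rplus_le_compat; [exact h2|exact h1]|]; right; ring.
      - apply frechet_minus; [|apply frechet_scal]; apply hfr; try assumption; try (rewrite hxx; exact hs).
        rewrite hck'; exact hck. }
    eapply Rle_trans; [exact h|].
    set (q := (Cmod c * Cmod c + Cmod c) * (norm k * norm k)).
    assert (hq : 0 <= q).
    { pose proof (Cmod_ge_0 c); pose proof (norm_ge_0 k).
      apply Rmult_le_pos; [|apply Rmult_le_pos; assumption].
      apply Rplus_le_le_0_compat; [apply Rmult_le_pos|]; assumption. }
    replace (2 * (K * q) / s) with (2 * (K / s) * q) by (field; lra).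
    apply Rmult_le_compat_r; [exact hq|]; unfold K', Rdiv in *; lra.
  - intros h k hh hk.
    assert (hhk : norm (plus h k) <= norm h + norm k) by apply norm_triangle.
    assert (hb : norm (minus (A (plus h k)) (plus (A h) (A k)))
             <= 2 * (K * (2 * ((norm h + norm k) * (norm h + norm k)))) / s).
    { apply (cauchy_estimate (fun u => minus (minus (f (plus u (plus h k))) (f u))
               (plus (minus (f (plus u h)) (f u)) (minus (f (plus u k)) (f u)))) x _ s); [exact hs| | |].
      - intros y hy; eapply ex_filterdiff_frechet, frechet_minus; [|apply frechet_plus]; apply hfr;
          try assumption; lra.
      - intros y hy.
        norm_lhs (minus (minus (minus (f (plus y (plus h k))) (f y))
             (plus (fderiv f y h) (fderiv f y k)))
            (plus (minus (minus (f (plus y h)) (f y)) (fderiv f y h))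
               (minus (minus (f (plus y k)) (f y)) (fderiv f y k)))).
        eapply Rle_trans; [apply norm_minus_triangle|].
        eapply Rle_trans; [apply Rplus_le_compat_l, norm_triangle|].
        pose proof (hE y h hy ltac:(lra)) as h1; pose proof (hE y k hy ltac:(lra)) as h2.
        pose proof (hE y (plus h k) hy ltac:(lra)) as h3.
        rewrite (linear_plus _ (Lop_is_linear (fderiv f y))) in h3.
        eapply Rle_trans; [apply Rplus_le_compat; [exact h3|apply Rplus_le_compat; [exact h1|exact h2]]|].
        rewrite <- !Rmult_plus_distr_l; apply Rmult_le_compat_l; [exact hK|].
        pose proof (norm_ge_0 h); pose proof (norm_ge_0 k); pose proof (norm_ge_0 (plus h k)).
        assert (norm (plus h k) * norm (plus h k) <= (norm h + norm k) * (norm h + norm k))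
          by (apply Rmult_le_compat; assumption).
        assert (0 <= norm h * norm k) by (apply Rmult_le_pos; assumption).
        eapply Rle_trans; [apply Rplus_le_compat_r; eassumption|]; lra.
      - apply frechet_minus; [|apply frechet_plus]; apply hfr; try (rewrite hxx; exact hs); lra. }
    eapply Rle_trans; [exact hb|].
    set (q := (norm h + norm k) * (norm h + norm k)).
    assert (hq : 0 <= q).
    { pose proof (norm_ge_0 h); pose proof (norm_ge_0 k); apply Rmult_le_pos; lra. }
    replace (2 * (K * (2 * q)) / s) with (4 * (K / s) * q) by (field; lra).
    apply Rmult_le_compat_r; [exact hq|]; unfold K', Rdiv in *; lra.
  - apply (ex_filterdiff_frechet (V := Lop_NormedModule U V) _ x L); intros e he.
    exists (Rmin s (e / (2 * K' + 1))); split.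
    + apply Rmin_pos; [exact hs|apply Rdiv_lt_0_compat; lra].
    + intros k hk; pose proof (Rmin_l s (e / (2 * K' + 1))); pose proof (Rmin_r s (e / (2 * K' + 1))).
      eapply Rle_trans; [apply (hL k); lra|]; rewrite <- Rmult_assoc.
      pose proof (norm_ge_0 k); apply Rmult_le_compat_r; [assumption|].
      apply Rle_trans with ((2 * K' + 1) * (e / (2 * K' + 1))); [|right; field; lra].
      apply Rmult_le_compat; lra.
Qed.

Lemma holomorphic_on_ball_near {U V : NormedModule C_AbsRing} (f : U -> V) (x : U) :
  holomorphic_on_ball f -> norm x < 1 -> holomorphic_near f x (1 - norm x).
Proof.
  intros h hx y hy; apply h; pose proof (norm_le_add y x); lra.
Qed.

Lemma holomorphic_on_ball_fderiv {U V : NormedModule C_AbsRing} (f : U -> V) :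
  banach V -> holomorphic_on_ball f -> holomorphic_on_ball (fderiv f).
Proof.
  intros hV h x hx; apply holomorphic_fderiv with (1 - norm x); [exact hV|lra|].
  apply holomorphic_on_ball_near; assumption.
Qed.

(** * Restriction to rays *)

Section Radial.

Context {X : NormedModule C_AbsRing}.

Lemma is_linear_eval {V : NormedModule C_AbsRing} (y : X) :
  is_linear (fun L : Lop_NormedModule X V => (L : Lop X V) y).
Proof.
  split; [reflexivity|reflexivity|].
  exists (norm y + 1); pose proof (norm_ge_0 y); split; [lra|]; intros L.
  eapply Rle_trans; [apply (opnorm_bound (L : Lop X V))|].
  rewrite Rmult_comm; apply Rmult_le_compat_r; [exact (opnorm_ge0 (L : Lop X V))|lra].
Qed.

Lemma is_linear_diag (y : X) (m : nat) : is_linear (fun L : Lmulti X m => diag m L y).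
Proof.
  induction m as [|m IH]; simpl.
  - split; [reflexivity|reflexivity|]; exists 1; split; [lra|]; intros x; lra.
  - exact (is_linear_comp _ _ (is_linear_eval y) IH).
Qed.

(** Evaluation on the diagonal is linear in the multilinear map, so it commutes with differentiation
    in the base point. *)
Definition Ldiag (y : X) (m : nat) : Lop (Lmulti X m) X := mkLop _ (is_linear_diag y m).

Lemma banach_Lmulti (m : nat) : banach X -> banach (Lmulti X m).
Proof. intros h; induction m as [|m IH]; simpl; [exact h|apply banach_Lop; exact IH]. Qed.

Context (hX : banach X) (F : X -> X) (hF : holomorphic_on_ball F).

Lemma holomorphic_nderiv (m : nat) : holomorphic_on_ball (nderiv F m).
Proof.
  induction m as [|m IH]; simpl; [exact hF|].
  apply holomorphic_on_ball_fderiv; [apply banach_Lmulti; exact hX|exact IH].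
Qed.

(** By [hasd_radial], the [m]-th derivative of the function taking [s] to [F (s y)]. *)
Definition radial (y : X) (m : nat) (s : C) : X := diag m (nderiv F m (scal (s : C_AbsRing) y)) y.

Lemma hasd_radial (y : X) (m : nat) (s : C) : Cmod s * norm y < 1 ->
  hasd (radial y m) s (radial y (S m) s).
Proof.
  intros hs.
  assert (he : forall t : C, plus (zero : X) (scal (t : C_AbsRing) y) = scal (t : C_AbsRing) y)
    by (intros t; modv X).
  assert (h : hasd (fun t : C => Ldiag y m (nderiv F m (plus (zero : X) (scal (t : C_AbsRing) y)))) s
            (Ldiag y m (fderiv (nderiv F m) (plus (zero : X) (scal (s : C_AbsRing) y)) y))).
  { apply (hasd_comp_linear (fun t : C => nderiv F m (plus (zero : X) (scal (t : C_AbsRing) y))) (Ldiag y m)).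
    apply frechet_line, fderiv_frechet, holomorphic_nderiv.
    rewrite he; rewrite_norm_scal; exact hs. }
  rewrite he in h.
  refine (hasd_ext_loc _ _ s _ 1 Rlt_0_1 _ h); intros t _; cbv beta; rewrite he; reflexivity.
Qed.

(** Induction on the order: the two sides agree on a neighbourhood of [s], and derivatives are
    unique. *)
Lemma radial_scalar (y : X) (p : nat -> C -> C) (N : nat) :
  (forall m s, (m < N)%nat -> Cmod s * norm y < 1 -> hasdC (p m) s (p (S m) s)) ->
  (forall s, Cmod s * norm y < 1 -> F (scal (s : C_AbsRing) y) = scal (p O s : C_AbsRing) y) ->
  forall m s, (m <= N)%nat -> Cmod s * norm y < 1 -> radial y m s = scal (p m s : C_AbsRing) y.
Proof.
  intros hp h0 m; induction m as [|m IH]; intros s hm hs; [exact (h0 s hs)|].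
  apply (hasd_unique (radial y m) s); [apply hasd_radial; exact hs|].
  pose proof (norm_ge_0 y) as hy.
  assert (hd : hasd (fun t => Lray y (p m t)) s (Lray y (p (S m) s)))
    by (apply (hasd_comp_linear (p m) (Lray y)), hp; [lia|exact hs]).
  (* A radius for which [(s + t) y] stays in the ball; the summand [1] in the denominator covers
     [y = 0]. *)
  refine (hasd_ext_loc _ _ s _ ((1 - Cmod s * norm y) / (norm y + 1)) _ _ hd).
  - apply Rdiv_lt_0_compat; lra.
  - intros t ht; symmetry; apply IH; [lia|].
    pose proof (Cmod_triangle s t).
    apply Rle_lt_trans with ((Cmod s + Cmod t) * norm y); [apply Rmult_le_compat_r; assumption|].
    apply (Rmult_lt_compat_r (norm y + 1)) in ht; [|lra].
    unfold Rdiv in ht; rewrite Rmult_assoc, Rinv_l in ht by lra.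
    pose proof (Cmod_ge_0 t); nra.
Qed.

End Radial.

(** * The class condition on a complex line *)

Section ClassF.

Context {X : NormedModule C_AbsRing} (F : X -> X).

Lemma Linv_is_inverse (A B : Lop X X) : is_inverse A B -> is_inverse A (Linv A).
Proof. intros h; apply (epsilon_spec (inhabits Lzero) (is_inverse A)); exists B; exact h. Qed.

Lemma Linv_apply (A B : Lop X X) (x : X) (a b : C) :
  is_inverse A B -> a <> 0%C -> A x = scal (a : C_AbsRing) x ->
  Linv A (scal (b : C_AbsRing) x) = scal (b / a : C_AbsRing)%C x.
Proof.
  intros hB ha hA; destruct (Linv_is_inverse A B hB) as [h _].
  replace (scal (b : C_AbsRing) x) with (A (scal (b / a : C_AbsRing)%C x)); [apply h|].
  rewrite (linear_scal _ (Lop_is_linear A)), hA.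
  module_with (NormedModule.ModuleSpace C_AbsRing X) ltac:(c_unfold; field; exact ha).
Qed.

(** Lets one functional [T], supporting at [x0], exploit the class condition at every nonzero point
    of the disc spanned by [x0]. *)
Lemma support_functional_rotate (x0 : X) (T : Lop X C_NormedModule) (s : C) :
  norm x0 = 1 -> support_functional x0 T -> s <> 0%C ->
  support_functional (scal (s : C_AbsRing) x0)
    (scal (Cconj s / RtoC (Cmod s) : C_AbsRing)%C T : Lop_NormedModule X C_NormedModule).
Proof.
  intros hx0 [h1 h2] hs.
  assert (hp : 0 < Cmod s) by (apply Cmod_gt_0; exact hs).
  assert (hne : RtoC (Cmod s) <> 0%C) by (intros h; injection h; lra).
  assert (hT : T (scal (s : C_AbsRing) x0) = s).
  { rewrite (linear_scal _ (Lop_is_linear T)), h1, hx0; change ((s * 1)%C = s); ring. }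
  split.
  - change ((Cconj s / RtoC (Cmod s) * T (scal (s : C_AbsRing) x0))%C = RtoC (norm (scal (s : C_AbsRing) x0))).
    rewrite hT; rewrite_norm_scal; rewrite hx0, Rmult_1_r.
    replace (Cconj s / RtoC (Cmod s) * s)%C with (s * Cconj s / RtoC (Cmod s))%C by (unfold Cdiv; ring).
    rewrite <- Cmod2_conj, RtoC_pow; simpl; field; exact hne.
  - rewrite_norm_scal; etransitivity; [apply f_equal; exact h2|].
    rewrite Cmod_div, Cmod_conj, Cmod_R, Rabs_pos_eq by (exact hne || lra); field; lra.
Qed.

(* On the ray of [x0] the defining inequality of the class becomes a condition
   on the one-variable function [p 0], where [F (s x0) = p 0 s * x0]. *)
Lemma class_F_ray (lambda : R) (x0 : X) (T : Lop X C_NormedModule) (p : nat -> C -> C) (s : C) :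
  class_F lambda F -> norm x0 = 1 -> support_functional x0 T ->
  (forall m, (m <= 2)%nat -> radial F x0 m s = scal (p m s : C_AbsRing) x0) -> Cmod s < 1 ->
  p 1%nat s <> 0%C /\ (s <> 0%C -> 1 / 2 - lambda <= Re (s * (p 2%nat s / p 1%nat s) + 1)%C).
Proof.
  intros [_ [[_ hinv] hF]] hx0 hT hp hs.
  set (x := scal (s : C_AbsRing) x0).
  assert (hx : norm x = Cmod s) by (unfold x; rewrite_norm_scal; rewrite hx0; ring).
  assert (hx1 : norm x < 1) by lra.
  destruct (hinv x hx1) as [B hB].
  assert (h1 : fderiv F x x0 = scal (p 1%nat s : C_AbsRing) x0) by (apply (hp 1%nat); lia).
  assert (h2 : (fderiv (fderiv F) x : Lop X (Lop_NormedModule X X)) x0 x0 = scal (p 2%nat s : C_AbsRing) x0)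
    by (apply (hp 2%nat); lia).
  assert (hne : p 1%nat s <> 0%C).
  { intros h0; rewrite h0 in h1.
    assert (hz : x0 = zero).
    { rewrite <- (proj1 hB x0), h1.
      replace (scal (RtoC 0 : C_AbsRing) x0) with (zero : X) by modv X.
      apply (linear_zero _ (Lop_is_linear B)). }
    rewrite hz, norm_zero in hx0; lra. }
  split; [exact hne|]; intros hs0.
  assert (hxz : x <> zero).
  { intros hz; apply hs0, Cmod_eq_0; rewrite <- hx, hz; exact norm_zero. }
  assert (hp0 : 0 < Cmod s) by (apply Cmod_gt_0; exact hs0).
  assert (hcne : RtoC (Cmod s) <> 0%C) by (intros h; injection h; lra).
  pose proof (hF x hx1 hxz _ (support_functional_rotate x0 T s hx0 hT hs0)) as h.
  assert (e1 : plus (diag 2 (nderiv F 2 x) x) (fderiv F x x)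
             = scal (s * s * p 2%nat s + s * p 1%nat s : C_AbsRing)%C x0).
  { change (diag 2 (nderiv F 2 x) x) with ((fderiv (fderiv F) x : Lop X (Lop_NormedModule X X)) x x).
    unfold x at 2 3 5.
    rewrite (linear_scal _ (Lop_is_linear (fderiv (fderiv F) x))), (linear_scal _ (Lop_is_linear (fderiv F x))), h1.
    change ((scal (s : C_AbsRing) ((fderiv (fderiv F) x : Lop X (Lop_NormedModule X X)) x0)
       : Lop X X) (scal (s : C_AbsRing) x0)) with
      (scal (s : C_AbsRing) (((fderiv (fderiv F) x : Lop X (Lop_NormedModule X X)) x0 : Lop X X) (scal (s : C_AbsRing) x0))).
    rewrite (linear_scal _ (Lop_is_linear ((fderiv (fderiv F) x : Lop X (Lop_NormedModule X X)) x0 : Lop X X))), h2.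
    modv X. }
  rewrite e1, (Linv_apply _ B x0 _ _ hB hne h1), hx in h.
  replace (s * (p 2%nat s / p 1%nat s) + 1)%C with
    ((Cconj s / RtoC (Cmod s)) * T (scal (RtoC (/ Cmod s) : C_AbsRing)
      (scal ((s * s * p 2%nat s + s * p 1%nat s) / p 1%nat s : C_AbsRing)%C x0)))%C.
  - apply Rge_le; exact h.
  - rewrite !(linear_scal _ (Lop_is_linear T)), (proj1 hT), hx0.
    change (Cconj s / Cmod s * (RtoC (/ Cmod s) * ((s * s * p 2%nat s + s * p 1%nat s) / p 1%nat s * 1)) =
      s * (p 2%nat s / p 1%nat s) + 1)%C.
    rewrite RtoC_inv by lra.
    replace (Cconj s / Cmod s * (/ Cmod s * ((s * s * p 2%nat s + s * p 1%nat s) / p 1%nat s * 1)))%C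
      with ((s * Cconj s) * (/ Cmod s * / Cmod s) * ((s * p 2%nat s + p 1%nat s) / p 1%nat s))%C
      by (field; split; assumption).
    rewrite <- Cmod2_conj, RtoC_pow; simpl; field; split; assumption.
Qed.

End ClassF.

(** * Coefficients of bounded functions *)

Lemma Cmod_sq (z : C) : Cmod z ^ 2 = Re (z * Cconj z)%C.
Proof. rewrite <- Cmod2_conj; reflexivity. Qed.

(* The lower triangular Toeplitz matrix with first column [(a, b, c)] has norm
   at most one. *)
Definition toeplitz_contraction (a b c : C) : Prop := forall s0 s1 s2 : C,
  Cmod (a * s0) ^ 2 + Cmod (b * s0 + a * s1) ^ 2 + Cmod (c * s0 + b * s1 + a * s2) ^ 2
    <= Cmod s0 ^ 2 + Cmod s1 ^ 2 + Cmod s2 ^ 2.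

(** A Schur complement: for fixed [s0], [s1] and [w = c s0 + b s1], the difference
    [|w + a s2|^2 - |s2|^2] is largest at [s2 = conj a * w / (1 - |a|^2)], with value
    [|w|^2 / (1 - |a|^2)]. *)
Lemma toeplitz_contraction_reduced (a b c s0 s1 : C) : toeplitz_contraction a b c -> Cmod a < 1 ->
  Cmod (a * s0) ^ 2 + Cmod (b * s0 + a * s1) ^ 2 + Cmod (c * s0 + b * s1) ^ 2 / (1 - Cmod a ^ 2)
    <= Cmod s0 ^ 2 + Cmod s1 ^ 2.
Proof.
  intros h ha; set (w := (c * s0 + b * s1)%C); assert (ha0 := Cmod_ge_0 a).
  set (x := Cmod a ^ 2); assert (hx : 0 <= x < 1) by (unfold x; simpl; nra).
  assert (hne : (1 - RtoC x)%C <> 0%C) by (intros he; injection he; lra).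
  pose proof (h s0 s1 (Cconj a * w / (1 - RtoC x))%C) as h2.
  assert (hx' : RtoC x = (a * Cconj a)%C) by (unfold x; rewrite <- Cmod2_conj; reflexivity).
  fold w in h2.
  replace (w + a * (Cconj a * w / (1 - RtoC x)))%C with (w / (1 - RtoC x))%C in h2.
  2:{ replace (a * (Cconj a * w / (1 - RtoC x)))%C with ((a * Cconj a) * w / (1 - RtoC x))%C by (unfold Cdiv; ring).
      rewrite <- hx'; field; exact hne. }
  assert (hm : Cmod (1 - RtoC x) = 1 - x).
  { rewrite <- RtoC_minus, Cmod_R, Rabs_pos_eq; lra. }
  rewrite !(Cmod_div _ _ hne), (Cmod_mult (Cconj a)), Cmod_conj, hm in h2.
  assert (he : (Cmod w / (1 - x)) ^ 2 - (Cmod a * Cmod w / (1 - x)) ^ 2 = Cmod w ^ 2 / (1 - x)).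
  { replace ((Cmod a * Cmod w / (1 - x)) ^ 2) with (x * (Cmod w) ^ 2 / (1 - x) ^ 2) by (unfold x; field; fold x; lra).
    field; lra. }
  lra.
Qed.

(** The vector [(0, 1)] in the reduced inequality gives [|a|^2 + |b|^2 / (1 - |a|^2) <= 1]. *)
Lemma toeplitz_bound_b (a b c : C) : toeplitz_contraction a b c -> Cmod a < 1 ->
  Cmod b <= 1 - Cmod a ^ 2.
Proof.
  intros h ha; pose proof (toeplitz_contraction_reduced a b c 0 1 h ha) as h1.
  replace (a * 0)%C with (RtoC 0) in h1 by ring; replace (b * 0 + a * 1)%C with a in h1 by ring.
  replace (c * 0 + b * 1)%C with b in h1 by ring.
  rewrite Cmod_0, Cmod_1 in h1; assert (ha0 := Cmod_ge_0 a); assert (hb0 := Cmod_ge_0 b).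
  set (u := 1 - Cmod a ^ 2) in *; assert (hu : 0 < u) by (unfold u; simpl; nra).
  assert (h2 : Cmod b ^ 2 / u <= u) by (unfold u in *; simpl in *; lra).
  apply (Rmult_le_compat_r u) in h2; [|lra].
  unfold Rdiv in h2; rewrite Rmult_assoc, Rinv_l in h2 by lra.
  apply Rnot_lt_le; intros hlt; simpl in h2; nra.
Qed.

(** The vector is [(1, tau k)]: the rotation [k] aligns [b] with [c], and [tau] solves
    [|b| - |a| tau = tau]. The middle term is then at least [tau^2] and cancels the contribution of
    the second entry, leaving [|a|^2 + (|c| + tau |b|)^2 / (1 - |a|^2) <= 1]. *)
Lemma toeplitz_bound_c (a b c : C) : toeplitz_contraction a b c -> Cmod a < 1 ->
  Cmod c + Cmod b ^ 2 / (1 + Cmod a) <= 1 - Cmod a ^ 2.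
Proof.
  intros h ha; assert (ha0 := Cmod_ge_0 a); assert (hb0 := Cmod_ge_0 b); assert (hc0 := Cmod_ge_0 c).
  destruct (exists_rotation (Cconj c * b)%C) as [k [hk hkz]].
  set (tau := Cmod b / (1 + Cmod a)).
  assert (htau : 0 <= tau) by (apply Rmult_le_pos; [exact hb0|left; apply Rinv_0_lt_compat; lra]).
  pose proof (toeplitz_contraction_reduced a b c 1 (RtoC tau * k)%C h ha) as h1.
  replace (a * 1)%C with a in h1 by ring; replace (b * 1 + a * (RtoC tau * k))%C with (b + a * RtoC tau * k)%C in h1 by ring.
  replace (c * 1 + b * (RtoC tau * k))%C with (c + RtoC tau * (k * b))%C in h1 by ring.
  rewrite Cmod_1, Cmod_mult, Cmod_R, hk, (Rabs_pos_eq tau), Rmult_1_r in h1 by exact htau.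
  assert (hb : tau <= Cmod (b + a * RtoC tau * k)).
  { pose proof (Cmod_triangle (b + a * RtoC tau * k) (- (a * RtoC tau * k))) as ht.
    rewrite Cmod_opp, !Cmod_mult, Cmod_R, hk, Rabs_pos_eq in ht by exact htau.
    replace (b + a * RtoC tau * k + - (a * RtoC tau * k))%C with b in ht by ring.
    assert (he : Cmod b = tau * (1 + Cmod a)) by (unfold tau; field; lra); lra. }
  assert (hc : Cmod (c + RtoC tau * (k * b)) ^ 2 = (Cmod c + tau * Cmod b) ^ 2).
  { rewrite Cmod_sq, Cplus_conj, !Cmult_conj.
    assert (hkz' := f_equal Cconj hkz); rewrite !Cmult_conj, Cconj_conj in hkz'.
    assert (hr : forall t : R, Cconj (RtoC t) = RtoC t)
      by (intros t; apply injective_projections; simpl; ring).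
    rewrite !hr in *; rewrite Cmod_mult, Cmod_conj in hkz, hkz'.
    replace ((c + RtoC tau * (k * b)) * (Cconj c + RtoC tau * (Cconj k * Cconj b)))%C with
      (c * Cconj c + RtoC tau * (Cconj k * (c * Cconj b)) + RtoC tau * (k * (Cconj c * b))
        + RtoC tau * RtoC tau * ((k * Cconj k) * (b * Cconj b)))%C by ring.
    rewrite hkz, hkz', <- !Cmod2_conj, hk; rewrite <- !RtoC_mult, <- !RtoC_plus; simpl; ring. }
  rewrite hc in h1.
  replace (Cmod c + Cmod b ^ 2 / (1 + Cmod a)) with (Cmod c + tau * Cmod b) by (unfold tau; field; lra).
  set (u := 1 - Cmod a ^ 2) in *; assert (hu : 0 < u) by (unfold u; simpl; nra).
  set (g := Cmod c + tau * Cmod b) in *.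
  assert (hg : 0 <= g) by (unfold g; nra).
  assert (h2 : g ^ 2 / u <= u).
  { assert (hsq : tau ^ 2 <= Cmod (b + a * RtoC tau * k) ^ 2) by (apply pow_incr; lra).
    unfold u in *; lra. }
  apply (Rmult_le_compat_r u) in h2; [|lra].
  unfold Rdiv in h2; rewrite Rmult_assoc, Rinv_l in h2 by lra.
  apply Rnot_lt_le; intros hlt; simpl in h2; nra.
Qed.

Definition hankel_form (mu : R) (a b c : C) : C :=
  (3 * a * c + RtoC (2 + mu) * (a * a) * b - 2 * (b * b) + RtoC (1 + mu - 2 * mu ^ 2) * (a * a * a * a))%C.

Lemma hankel_form_bound (mu : R) (a b c : C) : 1 <= mu <= 3 / 2 ->
  toeplitz_contraction a b c -> Cmod a < 1 ->
  Cmod (hankel_form mu a b c) <= 3 * (11 - 5 * mu) / (8 * (2 - mu)).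
Proof.
  intros hmu h ha.
  pose proof (toeplitz_bound_b a b c h ha) as hb; pose proof (toeplitz_bound_c a b c h ha) as hc.
  set (al := Cmod a) in *; set (y := Cmod b) in *; set (g := Cmod c) in *.
  assert (hal : 0 <= al) by apply Cmod_ge_0; assert (hy : 0 <= y) by apply Cmod_ge_0.
  assert (h1 : Cmod (hankel_form mu a b c) <=
    3 * al * g + (2 + mu) * al ^ 2 * y + 2 * y ^ 2 + (2 * mu ^ 2 - mu - 1) * al ^ 4).
  { unfold hankel_form, Cminus.
    eapply Rle_trans; [apply Cmod_triangle|].
    eapply Rle_trans; [apply Rplus_le_compat_r, Cmod_triangle|].
    eapply Rle_trans; [apply Rplus_le_compat_r, Rplus_le_compat_r, Cmod_triangle|].
    (* The last coefficient factors as [(1 - mu) (1 + 2 mu)] and is nonpositive because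
       [mu >= 1]. *)
    rewrite Cmod_opp, !Cmod_mult, !Cmod_R; fold al y g.
    rewrite (Rabs_pos_eq (2 + mu)), (Rabs_pos_eq 3), (Rabs_pos_eq 2), (Rabs_left1 (1 + mu - 2 * mu ^ 2)) by (simpl; nra).
    right; ring. }
  eapply Rle_trans; [exact h1|].
  set (u := 1 - al ^ 2) in *.
  assert (hf : 3 * al * g + (2 + mu) * al ^ 2 * y + 2 * y ^ 2
     <= 3 * al * (u - u ^ 2 / (1 + al)) + (2 + mu) * al ^ 2 * u + 2 * u ^ 2).
  { apply Rle_trans with (3 * al * (u - y ^ 2 / (1 + al)) + (2 + mu) * al ^ 2 * y + 2 * y ^ 2).
    - apply Rplus_le_compat_r, Rplus_le_compat_r, Rmult_le_compat_l; lra.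
    (* Monotonicity in [y]: the coefficient of [y^2] is [2 - 3 al / (1 + al) = (2 - al) / (1 + al)],
       positive since [al < 1]. *)
    - apply Rminus_le.
      replace (_ - _) with (- ((u - y) * ((2 + mu) * al ^ 2 + (2 - al) / (1 + al) * (u + y)))) by (field; lra).
      assert (0 <= (2 - al) / (1 + al)) by (apply Rmult_le_pos; [lra|left; apply Rinv_0_lt_compat; lra]).
      assert (0 <= (2 + mu) * al ^ 2) by (apply Rmult_le_pos; [lra|apply pow_le; exact hal]).
      assert (0 <= (2 - al) / (1 + al) * (u + y)) by (apply Rmult_le_pos; lra).
      assert (0 <= (u - y) * ((2 + mu) * al ^ 2 + (2 - al) / (1 + al) * (u + y))) by (apply Rmult_le_pos; lra).
      lra. }
  apply Rle_trans with (3 * al * (u - u ^ 2 / (1 + al)) + (2 + mu) * al ^ 2 * u + 2 * u ^ 2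
     + (2 * mu ^ 2 - mu - 1) * al ^ 4); [lra|].
  (* With [y = u] the bound is a quadratic polynomial in [al^2], and completing the square shows its
     maximum. *)
  apply Rminus_le.
  replace (_ - _) with (- (2 * (2 - mu) * (1 + mu) * (al ^ 2 - 1 / (4 * (2 - mu))) ^ 2))
    by (unfold u; field; lra).
  assert (0 <= 2 * (2 - mu) * (1 + mu) * (al ^ 2 - 1 / (4 * (2 - mu))) ^ 2).
  { apply Rmult_le_pos; [apply Rmult_le_pos; lra|apply pow2_ge_0]. }
  lra.
Qed.

(** The primitive of [exp (i k t)] takes equal values at both ends; stating this by [cos] and [sin]
    treats both signs of [k] alike. *)
Lemma is_Cint_circ_mult (k : R) : k <> 0 -> cos (k * (2 * PI)) = 1 -> sin (k * (2 * PI)) = 0 ->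
  is_Cint (fun t => circ 1 (k * t)) 0 (2 * PI) 0%C.
Proof.
  intros hk hc hs; split.
  - replace (Re 0%C) with (minus (sin (k * (2 * PI)) / k) (sin (k * 0) / k))
      by (rewrite hs, Rmult_0_r, sin_0; unfold minus, plus, opp; simpl; unfold Rdiv; ring).
    apply (is_RInt_derive (V := R_CompleteNormedModule) (fun t => sin (k * t) / k)); intros t _.
    + unfold circ; simpl; auto_derive; [exact I|]; field; exact hk.
    + apply (ex_derive_continuous (K := R_AbsRing) (V := R_NormedModule)); unfold circ; simpl; auto_derive; exact I.
  - replace (Im 0%C) with (minus (- cos (k * (2 * PI)) / k) (- cos (k * 0) / k))
      by (rewrite hc, Rmult_0_r, cos_0; unfold minus, plus, opp; simpl; unfold Rdiv; ring).
    apply (is_RInt_derive (V := R_CompleteNormedModule) (fun t => - cos (k * t) / k)); intros t _.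
    + unfold circ; simpl; auto_derive; [exact I|]; field; exact hk.
    + apply (ex_derive_continuous (K := R_AbsRing) (V := R_NormedModule)); unfold circ; simpl; auto_derive; exact I.
Qed.

(** * Fourier coefficients and the Toeplitz matrix *)

Section Means.

Let e (t : R) : C := circ 1 t.
Let f (t : R) : C := circ 1 (- t).

Lemma circ_inverse t : (circ 1 t * circ 1 (- t))%C = 1%C.
Proof.
  unfold circ; rewrite cos_neg, sin_neg; pose proof (sin2_cos2 t) as h; unfold Rsqr in h.
  apply injective_projections; simpl; [|ring].
  replace (1 * cos t * (1 * cos t) - 1 * sin t * (1 * - sin t)) with (sin t * sin t + cos t * cos t) by ring.
  exact h.
Qed.

Lemma circ_double t : circ 1 (2 * t) = (circ 1 t * circ 1 t)%C.
Proof. unfold circ; rewrite cos_2a, sin_2a; apply injective_projections; simpl; ring. Qed.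

Lemma circ_conj t : Cconj (circ 1 t) = circ 1 (- t).
Proof. unfold circ; rewrite cos_neg, sin_neg; apply injective_projections; simpl; ring. Qed.

Lemma circ_scal r t : circ r t = (RtoC r * circ 1 t)%C.
Proof. unfold circ; apply injective_projections; simpl; ring. Qed.

Lemma is_Cint_basis :
  is_Cint e 0 (2 * PI) 0%C /\ is_Cint (fun t => e t * e t)%C 0 (2 * PI) 0%C /\
  is_Cint f 0 (2 * PI) 0%C /\ is_Cint (fun t => f t * f t)%C 0 (2 * PI) 0%C.
Proof.
  assert (hp : 0 <= 2 * PI) by (pose proof PI_RGT_0; lra).
  assert (c2 : cos (2 * (2 * PI)) = 1) by (rewrite cos_2a, cos_2PI, sin_2PI; ring).
  assert (s2 : sin (2 * (2 * PI)) = 0) by (rewrite sin_2a, cos_2PI, sin_2PI; ring).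
  split; [|split; [|split]].
  - apply is_Cint_ext with (fun t => circ 1 (1 * t)); [exact hp|intros; unfold e; f_equal; ring|].
    apply is_Cint_circ_mult; [lra| |]; rewrite Rmult_1_l; [apply cos_2PI|apply sin_2PI].
  - apply is_Cint_ext with (fun t => circ 1 (2 * t)); [exact hp|intros; apply circ_double|].
    apply is_Cint_circ_mult; [lra|exact c2|exact s2].
  - apply is_Cint_ext with (fun t => circ 1 (-1 * t)); [exact hp|intros; unfold f; f_equal; ring|].
    apply is_Cint_circ_mult; [lra| |].
    + replace (-1 * (2 * PI)) with (- (2 * PI)) by ring; rewrite cos_neg; apply cos_2PI.
    + replace (-1 * (2 * PI)) with (- (2 * PI)) by ring; rewrite sin_neg, sin_2PI; ring.
  - apply is_Cint_ext with (fun t => circ 1 (-2 * t)); [exact hp| |].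
    + intros t _; unfold f; rewrite <- circ_double; f_equal; ring.
    + apply is_Cint_circ_mult; [lra| |].
      * replace (-2 * (2 * PI)) with (- (2 * (2 * PI))) by ring; rewrite cos_neg; exact c2.
      * replace (-2 * (2 * PI)) with (- (2 * (2 * PI))) by ring; rewrite sin_neg, s2; ring.
Qed.

Lemma is_Cint_comb5 (u1 u2 u3 u4 u5 : R -> C) (k1 k2 k3 k4 k5 l1 l2 l3 l4 l5 : C) a b :
  is_Cint u1 a b l1 -> is_Cint u2 a b l2 -> is_Cint u3 a b l3 -> is_Cint u4 a b l4 -> is_Cint u5 a b l5 ->
  is_Cint (fun t => k1 * u1 t + (k2 * u2 t + (k3 * u3 t + (k4 * u4 t + k5 * u5 t))))%C a b
    (k1 * l1 + (k2 * l2 + (k3 * l3 + (k4 * l4 + k5 * l5))))%C.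
Proof.
  intros; apply is_Cint_plus; [apply is_Cint_scal; assumption|].
  apply is_Cint_plus; [apply is_Cint_scal; assumption|].
  apply is_Cint_plus; [apply is_Cint_scal; assumption|].
  apply is_Cint_plus; apply is_Cint_scal; assumption.
Qed.

Lemma Re_mult_le (w q t : C) : Cmod w <= 1 ->
  Re (2 * (w * (q * Cconj t)))%C <= Re (q * Cconj q + t * Cconj t)%C.
Proof.
  intros hw; change (Re (q * Cconj q + t * Cconj t)%C) with (Re (q * Cconj q)%C + Re (t * Cconj t)%C).
  rewrite <- !Cmod_sq; eapply Rle_trans; [apply Re_le_Cmod|].
  rewrite !Cmod_mult, Cmod_conj, Cmod_R, Rabs_pos_eq by lra.
  assert (hq := Cmod_ge_0 q); assert (ht := Cmod_ge_0 t); assert (hw0 := Cmod_ge_0 w).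
  assert (hqt : 0 <= Cmod q * Cmod t) by (apply Rmult_le_pos; assumption).
  assert (Cmod w * (Cmod q * Cmod t) <= Cmod q * Cmod t).
  { rewrite <- (Rmult_1_l (Cmod q * Cmod t)) at 2; apply Rmult_le_compat_r; assumption. }
  pose proof (pow2_ge_0 (Cmod q - Cmod t)); simpl in *; lra.
Qed.

(* The Toeplitz matrix of the first Fourier coefficients of a function bounded
   by one is a compression of a multiplication operator. *)
Lemma toeplitz_of_means (w : R -> C) (a b c : C) :
  (forall t, Cmod (w t) <= 1) ->
  is_Cint w 0 (2 * PI) (RtoC (2 * PI) * a)%C ->
  is_Cint (fun t => w t * f t)%C 0 (2 * PI) (RtoC (2 * PI) * b)%C ->
  is_Cint (fun t => w t * (f t * f t))%C 0 (2 * PI) (RtoC (2 * PI) * c)%C ->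
  is_Cint (fun t => w t * e t)%C 0 (2 * PI) 0%C ->
  is_Cint (fun t => w t * (e t * e t))%C 0 (2 * PI) 0%C ->
  toeplitz_contraction a b c.
Proof.
  intros hw ha hb hc he hee s0 s1 s2.
  assert (hp : 0 <= 2 * PI) by (pose proof PI_RGT_0; lra).
  destruct is_Cint_basis as [be [bee [bf bff]]].
  set (t0 := (a * s0)%C); set (t1 := (b * s0 + a * s1)%C); set (t2 := (c * s0 + b * s1 + a * s2)%C).
  set (q := fun t => (s0 + s1 * e t + s2 * (e t * e t))%C).
  (* Since the modes [-1] and [-2] of [w] vanish, [g] is the projection of [w q] onto the modes [0],
     [1], [2], and the mean of [w q] against [g] is the sum of the squared moduli of [t0], [t1],
     [t2]. *)
  set (g := fun t => (t0 + t1 * e t + t2 * (e t * e t))%C).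
  assert (hef : forall t, (e t * f t)%C = 1%C) by (intros t; apply circ_inverse).
  assert (hconj : forall x0 x1 x2 t, Cconj (x0 + x1 * e t + x2 * (e t * e t))%C =
            (Cconj x0 + Cconj x1 * f t + Cconj x2 * (f t * f t))%C).
  { intros x0 x1 x2 t; rewrite !Cplus_conj, !Cmult_conj; unfold e, f; rewrite circ_conj; reflexivity. }
  assert (hone : is_Cint (fun _ => 1%C) 0 (2 * PI) (RtoC (2 * PI))).
  { pose proof (is_Cint_const 1%C 0 (2 * PI)) as h; rewrite Rminus_0_r, Cmult_1_r in h; exact h. }
  assert (hprod : forall x0 x1 x2 y0 y1 y2 t,
    ((x0 + x1 * e t + x2 * (e t * e t)) * (y0 + y1 * f t + y2 * (f t * f t)))%C =
    (x0 * y2 * (f t * f t) + ((x0 * y1 + x1 * y2) * f t + ((x0 * y0 + x1 * y1 + x2 * y2) * 1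
      + ((x1 * y0 + x2 * y1) * e t + x2 * y0 * (e t * e t)))))%C).
  { intros x0 x1 x2 y0 y1 y2 t; pose proof (hef t) as h; set (E := e t) in *; set (G := f t) in *.
    replace ((x0 + x1 * E + x2 * (E * E)) * (y0 + y1 * G + y2 * (G * G)))%C with
      (x0 * y0 + x0 * y1 * G + x0 * y2 * (G * G) + x1 * y0 * E + x1 * y1 * (E * G) + x1 * y2 * (E * G) * G
       + x2 * y0 * (E * E) + x2 * y1 * (E * G) * E + x2 * y2 * (E * G) * (E * G))%C by ring.
    rewrite h; ring. }
  assert (hnorm : forall x0 x1 x2, exists l,
    is_Cint (fun t => (x0 + x1 * e t + x2 * (e t * e t)) * Cconj (x0 + x1 * e t + x2 * (e t * e t)))%C
      0 (2 * PI) l /\ Re l = 2 * PI * (Cmod x0 ^ 2 + Cmod x1 ^ 2 + Cmod x2 ^ 2)).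
  { intros x0 x1 x2; eexists; split.
    - eapply is_Cint_ext; [exact hp| |apply is_Cint_comb5; [exact bff|exact bf|exact hone|exact be|exact bee]].
      intros t _; cbv beta; rewrite hconj; symmetry; apply hprod.
    - rewrite !Cmult_0_r, !Cplus_0_r, !Cplus_0_l.
      rewrite <- !Cmod2_conj, <- !RtoC_plus, <- RtoC_mult; simpl; ring. }
  destruct (hnorm s0 s1 s2) as [lq [hq1 hq2]], (hnorm t0 t1 t2) as [lt [ht1 ht2]].
  assert (hcross : is_Cint (fun t => 2 * (w t * (q t * Cconj (g t))))%C 0 (2 * PI)
    (2 * (s0 * Cconj t2 * (RtoC (2 * PI) * c) + ((s0 * Cconj t1 + s1 * Cconj t2) * (RtoC (2 * PI) * b)
      + ((s0 * Cconj t0 + s1 * Cconj t1 + s2 * Cconj t2) * (RtoC (2 * PI) * a)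
      + ((s1 * Cconj t0 + s2 * Cconj t1) * 0 + s2 * Cconj t0 * 0)))))%C).
  { apply is_Cint_scal; eapply is_Cint_ext; [exact hp| |apply is_Cint_comb5; [exact hc|exact hb|exact ha|exact he|exact hee]].
    intros t _; cbv beta; unfold q, g; rewrite hconj, hprod; ring. }
  (* Integrating [2 Re (w q conj g) <= |q|^2 + |g|^2] gives twice the energy of [g] on the left and
     its energy once on the right; what remains is the contraction property. *)
  pose proof (is_Cint_Re_le _ _ 0 (2 * PI) _ _ hp hcross (is_Cint_plus _ _ _ _ _ _ hq1 ht1)) as h.
  assert (h' : Re (2 * (s0 * Cconj t2 * (RtoC (2 * PI) * c) + ((s0 * Cconj t1 + s1 * Cconj t2) * (RtoC (2 * PI) * b)
      + ((s0 * Cconj t0 + s1 * Cconj t1 + s2 * Cconj t2) * (RtoC (2 * PI) * a)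
      + ((s1 * Cconj t0 + s2 * Cconj t1) * 0 + s2 * Cconj t0 * 0)))))%C <= Re (lq + lt)%C).
  { apply h; intros t _; apply Re_mult_le, hw. }
  replace (2 * (s0 * Cconj t2 * (RtoC (2 * PI) * c) + ((s0 * Cconj t1 + s1 * Cconj t2) * (RtoC (2 * PI) * b)
      + ((s0 * Cconj t0 + s1 * Cconj t1 + s2 * Cconj t2) * (RtoC (2 * PI) * a)
      + ((s1 * Cconj t0 + s2 * Cconj t1) * 0 + s2 * Cconj t0 * 0)))))%C
    with (RtoC (2 * PI) * (2 * (t0 * Cconj t0 + t1 * Cconj t1 + t2 * Cconj t2)))%C in h'
    by (unfold t0, t1, t2; ring).
  change (Re (lq + lt)%C) with (Re lq + Re lt) in h'.
  rewrite hq2, ht2, <- !Cmod2_conj, <- !RtoC_plus, <- !RtoC_mult in h'.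
  change (2 * PI * (2 * (Cmod t0 ^ 2 + Cmod t1 ^ 2 + Cmod t2 ^ 2)) <=
    2 * PI * (Cmod s0 ^ 2 + Cmod s1 ^ 2 + Cmod s2 ^ 2) + 2 * PI * (Cmod t0 ^ 2 + Cmod t1 ^ 2 + Cmod t2 ^ 2)) in h'.
  rewrite <- Rmult_plus_distr_l in h'; apply Rmult_le_reg_l in h'; [lra|pose proof PI_RGT_0; lra].
Qed.

End Means.

(** * The Hankel determinant in one variable *)

Section TaylorCoefficients.

Context (v v1 : C -> C) (c : C).
Hypothesis hv : forall z, Cmod z < 1 -> hasdC v z (v1 z).
Hypothesis hv1 : hasdC v1 0 (2 * c)%C.

(** The mean value bound on the segment from [0] to [z] turns the first-order accuracy of [v1] at
    the origin into second-order accuracy of [v]. *)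
Lemma taylor_two : forall e, 0 < e -> exists d, 0 < d /\ forall z, Cmod z < d ->
  Cmod (v z - v 0 - v1 0 * z - c * (z * z))%C <= e * (Cmod z * Cmod z).
Proof.
  intros e he; destruct (proj1 (hasd_iff _ _ _) hv1 e he) as [d [hd k]].
  exists (Rmin d 1); split; [apply Rmin_pos; lra|]; intros z hz.
  pose proof (Rmin_l d 1); pose proof (Rmin_r d 1); assert (hz0 := Cmod_ge_0 z).
  pose proof (segment_bound (V := C_NormedModule) (fun s => (v (0 + s * z) - v1 0 * (s * z) - c * ((s * z) * (s * z)))%C)
    (fun t => (z * (v1 (RtoC t * z) - v1 0 - (RtoC t * z) * (2 * c)))%C) (e * (Cmod z * Cmod z))) as hs.
  cbv beta in hs.
  change (Cmod (v z - v 0 - v1 0 * z - c * (z * z)) <= e * (Cmod z * Cmod z)).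
  replace (v z - v 0 - v1 0 * z - c * (z * z))%C with
    ((v (0 + 1 * z) - v1 0 * (1 * z) - c * ((1 * z) * (1 * z)))
     - (v (0 + 0 * z) - v1 0 * (0 * z) - c * ((0 * z) * (0 * z))))%C.
  2:{ replace (0 + 1 * z)%C with z by ring; replace (0 + 0 * z)%C with (RtoC 0) by ring; ring. }
  apply hs; intros t ht.
  - assert (hsz : hasdC (fun s => (s * z)%C) (RtoC t) z).
    { eapply hasd_eq; [apply hasd_mult; [apply hasd_id|apply hasd_const]|cring]. }
    eapply hasd_eq; [apply hasd_minus; [apply hasd_minus|]|].
    + apply hasd_line, hv; rewrite Cplus_0_l, Cmod_mult, Cmod_R, Rabs_pos_eq by lra; nra.
    + apply hasd_scal, hsz.
    + apply hasd_scal, hasd_mult; exact hsz.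
    + replace (0 + t * z)%C with (t * z)%C by ring; cring.
  - change (Cmod (z * (v1 (RtoC t * z) - v1 0 - (RtoC t * z) * (2 * c)))%C <= e * (Cmod z * Cmod z)).
    assert (htz : Cmod (t * z) <= Cmod z) by (rewrite Cmod_mult, Cmod_R, Rabs_pos_eq by lra; nra).
    specialize (k (RtoC t * z)%C ltac:(lra)); rewrite Cplus_0_l in k.
    rewrite Cmod_mult, (Rmult_comm e), Rmult_assoc; apply Rmult_le_compat_l; [exact hz0|].
    eapply Rle_trans; [exact k|]; rewrite Rmult_comm; apply Rmult_le_compat_r; lra.
Qed.

Hypothesis hbound : forall z, Cmod z < 1 -> Cmod (z * v z) <= 1.

Lemma neq_0_of_Cmod (z : C) (d : R) : 0 < Cmod z < d -> z <> 0%C.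
Proof. intros hz h; rewrite h, Cmod_0 in hz; lra. Qed.

(** On the circle of radius [r] the hypothesis on [z * v z] reads [|r v| <= 1]. The function [r v]
    has Fourier coefficients [r a], [r^2 b], [r^3 c], which are obtained as means of difference
    quotients of [v]. *)
Lemma toeplitz_of_schwarz (r : R) : 0 < r < 1 ->
  toeplitz_contraction (RtoC r * v 0)%C (RtoC (r * r) * v1 0)%C (RtoC (r * r * r) * c)%C.
Proof.
  intros hr; assert (hp : 0 <= 2 * PI) by (pose proof PI_RGT_0; lra).
  assert (hr0 : RtoC r <> 0%C) by (intros h; injection h; lra).
  destruct is_Cint_basis as [_ [_ [bf bff]]].
  assert (hdisc : forall z, 0 < Cmod z < 1 -> exists l, hasdC v z l) by (intros z hz; exists (v1 z); apply hv; lra).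
  assert (hcont : forall e, 0 < e -> exists d, 0 < d /\ forall z, 0 < Cmod z < d -> Cmod (v z - v 0) <= e).
  { intros e he; destruct (hasd_cont v 0 _ (hv 0%C ltac:(rewrite Cmod_0; lra)) e he) as [d [hd k]].
    exists d; split; [exact hd|]; intros z hz; specialize (k z ltac:(lra)); rewrite Cplus_0_l in k; exact k. }
  assert (m0 := circle_mean v 1 hdisc (v 0) r hr hcont).
  (* Both products tend to [0] at the origin, so the modes [-1] and [-2] vanish. *)
  assert (hlim0 : forall h : C -> C, (forall z, h z = (v z * z)%C) \/ (forall z, h z = (v z * (z * z))%C) ->
    forall e, 0 < e -> exists d, 0 < d /\ forall z, 0 < Cmod z < d -> Cmod (h z - 0) <= e).
  { intros h hh e he; destruct (hcont 1 Rlt_0_1) as [d [hd k]].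
    assert (hq : 0 < e / (Cmod (v 0) + 1)) by (apply Rdiv_lt_0_compat; [exact he|pose proof (Cmod_ge_0 (v 0)); lra]).
    exists (Rmin (Rmin d 1) (e / (Cmod (v 0) + 1))); split; [repeat apply Rmin_pos; lra|]; intros z hz.
    set (m := Rmin (Rmin d 1) _) in hz.
    assert (hm : m <= d /\ m <= 1 /\ m <= e / (Cmod (v 0) + 1)).
    { unfold m; pose proof (Rmin_l (Rmin d 1) (e / (Cmod (v 0) + 1))); pose proof (Rmin_r (Rmin d 1) (e / (Cmod (v 0) + 1)));
      pose proof (Rmin_l d 1); pose proof (Rmin_r d 1); lra. }
    specialize (k z ltac:(lra)).
    assert (hvz : Cmod (v z) <= Cmod (v 0) + 1).
    { replace (v z) with ((v z - v 0) + v 0)%C by ring; eapply Rle_trans; [apply Cmod_triangle|]; lra. }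
    assert (hvz2 : Cmod (v z) * Cmod z <= e).
    { apply Rle_trans with ((Cmod (v 0) + 1) * (e / (Cmod (v 0) + 1))).
      - apply Rmult_le_compat; try apply Cmod_ge_0; lra.
      - right; field; pose proof (Cmod_ge_0 (v 0)); lra. }
    replace (h z - 0)%C with (h z) by ring.
    destruct hh as [hh|hh]; rewrite hh, !Cmod_mult; [exact hvz2|].
    pose proof (Cmod_ge_0 (v z)); pose proof (Cmod_ge_0 z).
    rewrite <- Rmult_assoc; rewrite <- (Rmult_1_r e); apply Rmult_le_compat; try lra.
    apply Rmult_le_pos; lra. }
  assert (m1 : is_Cint (fun t => (v (circ r t) * circ r t)%C) 0 (2 * PI) (RtoC (2 * PI) * 0)%C).
  { apply (circle_mean (fun z => (v z * z)%C) 1); [|exact hr|apply hlim0; left; reflexivity].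
    intros z hz; eexists; apply hasd_mult; [apply hv; lra|apply hasd_id]. }
  assert (m2 : is_Cint (fun t => (v (circ r t) * (circ r t * circ r t))%C) 0 (2 * PI) (RtoC (2 * PI) * 0)%C).
  { apply (circle_mean (fun z => (v z * (z * z))%C) 1); [|exact hr|apply hlim0; right; reflexivity].
    intros z hz; eexists; apply hasd_mult; [apply hv; lra|apply hasd_mult; apply hasd_id]. }
  assert (m3 : is_Cint (fun t => ((v (circ r t) - v 0) / circ r t)%C) 0 (2 * PI) (RtoC (2 * PI) * v1 0)%C).
  { apply (circle_mean (fun z => ((v z - v 0) / z)%C) 1); [|exact hr|].
    - intros z hz; eexists; apply hasd_div; [apply hasd_minus; [apply hv; lra|apply hasd_const]|apply hasd_id|].
      exact (neq_0_of_Cmod z _ hz).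
    - intros e he; destruct (proj1 (hasd_iff _ _ _) (hv 0%C ltac:(rewrite Cmod_0; lra)) e he) as [d [hd k]].
      exists d; split; [exact hd|]; intros z hz; specialize (k z ltac:(lra)); rewrite Cplus_0_l in k.
      assert (hz0 := neq_0_of_Cmod z _ hz).
      replace ((v z - v 0) / z - v1 0)%C with ((v z - v 0 - z * v1 0) / z)%C by (field; exact hz0).
      rewrite Cmod_div by exact hz0; apply Rmult_le_reg_r with (Cmod z); [lra|].
      unfold Rdiv; rewrite Rmult_assoc, Rinv_l, Rmult_1_r by lra; exact k. }
  assert (m4 : is_Cint (fun t => ((v (circ r t) - v 0 - v1 0 * circ r t) / (circ r t * circ r t))%C) 0 (2 * PI)
     (RtoC (2 * PI) * c)%C).
  { apply (circle_mean (fun z => ((v z - v 0 - v1 0 * z) / (z * z))%C) 1); [|exact hr|].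
    - intros z hz; eexists; apply hasd_div.
      + apply hasd_minus; [apply hasd_minus; [apply hv; lra|apply hasd_const]|apply hasd_scal, hasd_id].
      + apply hasd_mult; apply hasd_id.
      + apply Cmult_neq_0; exact (neq_0_of_Cmod z _ hz).
    - intros e he; destruct (taylor_two e he) as [d [hd k]].
      exists d; split; [exact hd|]; intros z hz; specialize (k z ltac:(lra)).
      assert (hz0 := neq_0_of_Cmod z _ hz).
      replace ((v z - v 0 - v1 0 * z) / (z * z) - c)%C with ((v z - v 0 - v1 0 * z - c * (z * z)) / (z * z))%C
        by (field; exact hz0).
      rewrite Cmod_div, (Cmod_mult z z) by (apply Cmult_neq_0; exact hz0).
      apply Rmult_le_reg_r with (Cmod z * Cmod z); [apply Rmult_lt_0_compat; lra|].
      unfold Rdiv; rewrite Rmult_assoc, Rinv_l, Rmult_1_r by (apply Rgt_not_eq, Rmult_lt_0_compat; lra); exact k. }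
  assert (hinv : forall t, circ r t <> 0%C) by (intros t; apply circ_neq_0; lra).
  (* Turns the Fourier factors on the unit circle into powers of the point on the circle of radius
     [r]. *)
  assert (hf : forall t, circ 1 (- t) = (RtoC r / circ r t)%C).
  { intros t; rewrite (circ_scal r t).
    assert (h1 : circ 1 t <> 0%C) by (apply circ_neq_0; lra).
    replace (circ 1 (- t)) with (circ 1 t * circ 1 (- t) / circ 1 t)%C by (field; exact h1).
    rewrite circ_inverse; field; split; assumption. }
  assert (he : forall t, circ 1 t = (circ r t / RtoC r)%C).
  { intros t; rewrite (circ_scal r t); field; exact hr0. }
  apply (toeplitz_of_means (fun t => (RtoC r * v (circ r t))%C)).
  - intros t; pose proof (hbound (circ r t)) as h; rewrite Cmod_circ in h by lra.
    specialize (h ltac:(lra)); rewrite Cmod_mult, Cmod_circ in h by lra.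
    rewrite Cmod_mult, Cmod_R, Rabs_pos_eq by lra; exact h.
  - replace (RtoC (2 * PI) * (RtoC r * v 0))%C with (RtoC r * (RtoC (2 * PI) * v 0))%C by ring.
    apply is_Cint_scal; exact m0.
  - replace (RtoC (2 * PI) * (RtoC (r * r) * v1 0))%C
      with (RtoC (r * r) * (RtoC (2 * PI) * v1 0) + (RtoC r * v 0) * 0)%C by ring.
    eapply is_Cint_ext; [exact hp| |apply is_Cint_plus; [apply is_Cint_scal; exact m3|apply is_Cint_scal; exact bf]].
    intros t _; cbv beta; rewrite hf, RtoC_mult; field; apply hinv.
  - replace (RtoC (2 * PI) * (RtoC (r * r * r) * c))%C
      with (RtoC (r * r * r) * (RtoC (2 * PI) * c) + ((RtoC r * v 0) * 0 + (RtoC (r * r) * v1 0) * 0))%C by ring.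
    eapply is_Cint_ext; [exact hp| |apply is_Cint_plus; [apply is_Cint_scal; exact m4|
      apply is_Cint_plus; [apply is_Cint_scal; exact bff|apply is_Cint_scal; exact bf]]].
    intros t _; cbv beta; rewrite hf, !RtoC_mult; field; apply hinv.
  - replace (RtoC 0) with (RtoC (2 * PI) * 0)%C by ring.
    eapply is_Cint_ext; [exact hp| |exact m1].
    intros t _; cbv beta; rewrite he; field; exact hr0.
  - replace (RtoC 0) with (/ RtoC r * (RtoC (2 * PI) * 0))%C by ring.
    eapply is_Cint_ext; [exact hp| |apply is_Cint_scal; exact m2].
    intros t _; cbv beta; rewrite he; field; exact hr0.
Qed.

(** The form has weight four when [a], [b], [c] scale by [r], [r^2], [r^3]; the bound therefore
    holds for [r^4] times its value, and [r] tends to [1]. Shrinking also supplies the strict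
    inequality [r |a| < 1]. *)
Lemma hankel_form_schwarz_bound (mu : R) : 1 <= mu <= 3 / 2 ->
  Cmod (hankel_form mu (v 0) (v1 0) c) <= 3 * (11 - 5 * mu) / (8 * (2 - mu)).
Proof.
  intros hmu; set (B := 3 * (11 - 5 * mu) / (8 * (2 - mu))); set (N := Cmod _).
  assert (hN : 0 <= N) by apply Cmod_ge_0.
  (* The vector [(0, 0, 1)] gives [r * Cmod (v 0) <= 1], which fails for [r] midway between
     [/ Cmod (v 0)] and [1] if [Cmod (v 0) > 1]. *)
  assert (ha1 : Cmod (v 0) <= 1).
  { apply Rnot_lt_le; intros hlt.
    set (r := (/ Cmod (v 0) + 1) / 2).
    assert (hi : / Cmod (v 0) < 1) by (rewrite <- Rinv_1; apply Rinv_lt_contravar; lra).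
    assert (hi0 : 0 < / Cmod (v 0)) by (apply Rinv_0_lt_compat; lra).
    pose proof (toeplitz_of_schwarz r ltac:(unfold r; lra) 0%C 0%C 1%C) as h.
    rewrite !Cmult_0_r, !Cplus_0_l, !Cmult_1_r, Cmod_0, Cmod_1, Cmod_mult, Cmod_R, Rabs_pos_eq in h by (unfold r; lra).
    assert (hr : 1 < r * Cmod (v 0)).
    { apply Rmult_lt_reg_r with (/ Cmod (v 0)); [exact hi0|].
      rewrite Rmult_assoc, Rinv_r by lra; unfold r; lra. }
    simpl in h; nra. }
  assert (h : forall r, 0 < r < 1 -> r ^ 4 * N <= B).
  { intros r hr.
    pose proof (hankel_form_bound mu _ _ _ hmu (toeplitz_of_schwarz r hr)) as h.
    rewrite Cmod_mult, Cmod_R, Rabs_pos_eq in h by lra.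
    replace (hankel_form mu (r * v 0) ((r * r)%R * v1 0) ((r * r * r)%R * c))%C
      with (RtoC (r ^ 4) * hankel_form mu (v 0) (v1 0) c)%C in h.
    - rewrite Cmod_mult, Cmod_R, Rabs_pos_eq in h by (apply pow_le; lra); apply h.
      assert (0 <= Cmod (v 0)) by apply Cmod_ge_0; nra.
    - unfold hankel_form; rewrite RtoC_pow, !RtoC_mult; simpl; ring. }
  apply Rnot_lt_le; intros hlt.
  assert (hB : 0 < B) by (apply Rdiv_lt_0_compat; lra).
  assert (hq : 0 < B / N < 1).
  { split; [apply Rdiv_lt_0_compat; lra|]; apply Rmult_lt_reg_r with N; [lra|].
    unfold Rdiv; rewrite Rmult_assoc, Rinv_l; lra. }
  set (q := B / N) in *.
  assert (hBN : B = q * N) by (unfold q; field; lra).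
  (* By Bernoulli's inequality the fourth power of this radius is at least [(1 + q) / 2], which
     exceeds [q]. *)
  specialize (h (1 - (1 - q) / 8) ltac:(lra)).
  rewrite hBN in h; apply Rmult_le_reg_r in h; [|lra].
  set (x := (1 - q) / 8) in *.
  assert (hx : 0 < x < 1) by (unfold x; lra).
  assert (h4 : 1 - 4 * x <= (1 - x) ^ 4).
  { replace ((1 - x) ^ 4) with (1 - 4 * x + x ^ 2 * (6 - 4 * x + x ^ 2)) by ring.
    assert (0 <= x ^ 2) by apply pow2_ge_0.
    assert (0 <= x ^ 2 * (6 - 4 * x + x ^ 2)) by (apply Rmult_le_pos; lra); lra. }
  unfold x in *; lra.
Qed.

End TaylorCoefficients.

(** * From the half-plane condition to a bounded function *)

Section HankelBound.

Context (p : nat -> C -> C) (mu : R) (hmu : 1 <= mu <= 3 / 2).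
Hypothesis hp : forall m s, (m <= 3)%nat -> Cmod s < 1 -> hasdC (p m) s (p (S m) s).
Hypothesis hp1 : p 1%nat 0%C = 1%C.
Hypothesis hp0 : forall s, Cmod s < 1 -> p 1%nat s <> 0%C.
Hypothesis hRe : forall s : C, s <> 0%C -> Cmod s < 1 -> - mu <= Re (s * (p 2%nat s / p 1%nat s))%C.

Let D (s : C) : C := (RtoC (2 * mu) * p 1%nat s + s * p 2%nat s)%C.
Let D1 (s : C) : C := (RtoC (2 * mu) * p 2%nat s + (p 2%nat s + s * p 3%nat s))%C.
Let v (s : C) : C := (p 2%nat s / D s)%C.
Let v1 (s : C) : C := ((p 3%nat s - v s * D1 s) / D s)%C.
Let w (s : C) : C := (s * (p 2%nat s / p 1%nat s))%C.

Let hRew s : Cmod s < 1 -> - mu <= Re (w s).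
Proof.
  intros hs; destruct (Ceq_dec s 0) as [->|hne]; [|apply hRe; assumption].
  unfold w; rewrite Cmult_0_l; simpl; lra.
Qed.

Let hD s : Cmod s < 1 -> D s = (p 1%nat s * (RtoC (2 * mu) + w s))%C.
Proof. intros hs; unfold D, w; field; apply hp0; exact hs. Qed.

Let hwne s : Cmod s < 1 -> (RtoC (2 * mu) + w s)%C <> 0%C.
Proof.
  intros hs h; apply (f_equal Re) in h; pose proof (hRew s hs).
  change (Re (RtoC (2 * mu) + w s)%C) with (2 * mu + Re (w s)) in h; change (Re 0%C) with 0 in h; lra.
Qed.

Let hDne s : Cmod s < 1 -> D s <> 0%C.
Proof. intros hs; rewrite hD by exact hs; apply Cmult_neq_0; [apply hp0|apply hwne]; exact hs. Qed.

Let hDd s : Cmod s < 1 -> hasdC D s (D1 s).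
Proof.
  intros hs; eapply hasd_eq.
  - apply hasd_plus; [apply hasd_scal, hp; [lia|exact hs]|].
    apply hasd_mult; [apply hasd_id|apply hp; [lia|exact hs]].
  - unfold D1; cring.
Qed.

Let hvd s : Cmod s < 1 -> hasdC v s (v1 s).
Proof.
  intros hs; apply hasd_div; [apply hp; [lia|exact hs]|apply hDd; exact hs|apply hDne; exact hs].
Qed.

(** Here [s v = w / (2 mu + w)], and [|2 mu + w|^2 - |w|^2 = 4 mu (mu + Re w)] is nonnegative. *)
Let hvbound s : Cmod s < 1 -> Cmod (s * v s) <= 1.
Proof.
  intros hs.
  replace (s * v s)%C with (w s / (RtoC (2 * mu) + w s))%C.
  2:{ unfold v; rewrite hD by exact hs; unfold w; field; repeat split; first [apply hp0; exact hs|exact (hDne s hs)]. }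
  rewrite Cmod_div by (apply hwne; exact hs).
  assert (hpos : 0 < Cmod (RtoC (2 * mu) + w s)) by (apply Cmod_gt_0, hwne; exact hs).
  apply Rmult_le_reg_r with (Cmod (RtoC (2 * mu) + w s)); [exact hpos|].
  unfold Rdiv; rewrite Rmult_assoc, Rinv_l, Rmult_1_r, Rmult_1_l by lra.
  apply Rsqr_incr_0; [|apply Cmod_ge_0|lra].
  rewrite !Rsqr_pow2, !Cmod2_alt; pose proof (hRew s hs).
  change (Re (RtoC (2 * mu) + w s)%C) with (2 * mu + Re (w s)).
  replace (Im (RtoC (2 * mu) + w s)%C) with (Im (w s)) by (unfold Im; simpl; ring).
  nra.
Qed.

Theorem hankel_bound :
  Cmod (p 2%nat 0%C / 2 * (p 4%nat 0%C / 24) - p 3%nat 0%C / 6 * (p 3%nat 0%C / 6))%C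
    <= mu ^ 2 * (11 - 5 * mu) / (48 * (2 - mu)).
Proof.
  assert (h0 : Cmod 0 < 1) by (rewrite Cmod_0; lra).
  set (c1 := v 0%C); set (c2 := v1 0%C).
  set (D2 := (RtoC (2 * mu) * p 3%nat 0%C + (p 3%nat 0%C + p 3%nat 0%C))%C).
  (* Half of the second derivative of [v] at the origin, solved from the second derivative of
     [v D = p 2]. *)
  set (c3 := ((p 4%nat 0%C - (c2 * D1 0 + c1 * D2) - c2 * D1 0) / (2 * D 0))%C).
  assert (hmu0 : RtoC mu <> 0%C) by (intros h; injection h; lra).
  assert (hD0 : D 0 = RtoC (2 * mu)) by (unfold D; rewrite hp1; ring).
  assert (hv1d : hasdC v1 0 (2 * c3)%C).
  { assert (hD1 : hasdC D1 0 D2).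
    { eapply hasd_eq.
      - apply hasd_plus; [apply hasd_scal, hp; [lia|exact h0]|].
        apply hasd_plus; [apply hp; [lia|exact h0]|].
        apply hasd_mult; [apply hasd_id|apply hp; [lia|exact h0]].
      - unfold D2; cring. }
    eapply hasd_eq.
    - apply hasd_div; [|apply hDd; exact h0|apply hDne; exact h0].
      apply hasd_minus; [apply hp; [lia|exact h0]|].
      apply hasd_mult; [apply hvd; exact h0|exact hD1].
    - assert (hne := hDne 0%C h0).
      cbv beta; unfold c3; change ((p 3%nat 0%C - v 0 * D1 0) / D 0)%C with c2; fold c1 c2.
      cfield; exact hne. }
  pose proof (hankel_form_schwarz_bound v v1 c3 hvd hv1d hvbound mu hmu) as h.
  fold c1 c2 in h.
  replace (p 2%nat 0%C / 2 * (p 4%nat 0%C / 24) - p 3%nat 0%C / 6 * (p 3%nat 0%C / 6))%C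
    with (RtoC (mu ^ 2 / 18) * hankel_form mu c1 c2 c3)%C.
  - rewrite Cmod_mult, Cmod_R, Rabs_pos_eq by nra.
    replace (mu ^ 2 * (11 - 5 * mu) / (48 * (2 - mu)))
      with (mu ^ 2 / 18 * (3 * (11 - 5 * mu) / (8 * (2 - mu)))) by (field; lra).
    apply Rmult_le_compat_l; [nra|exact h].
  (* The relation [v D = p 2] and its first two derivatives at the origin express the derivatives of
     [p 0] through the coefficients of [v]. *)
  - assert (e2 : p 2%nat 0%C = (2 * RtoC mu * c1)%C).
    { unfold c1, v; rewrite hD0, RtoC_mult; field; exact hmu0. }
    assert (e3 : p 3%nat 0%C = (2 * RtoC mu * c2 + c1 * ((2 * RtoC mu + 1) * p 2%nat 0%C))%C).
    { unfold c2, v1; rewrite hD0; fold c1; unfold D1; rewrite !RtoC_mult; field; exact hmu0. }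
    assert (e4 : p 4%nat 0%C = (4 * RtoC mu * c3 + 2 * c2 * ((2 * RtoC mu + 1) * p 2%nat 0%C)
        + c1 * ((2 * RtoC mu + 2) * p 3%nat 0%C))%C).
    { unfold c3; rewrite hD0; unfold D1, D2; rewrite !RtoC_mult; field; exact hmu0. }
    rewrite e4, e3, e2; unfold hankel_form; rewrite RtoC_div by lra; rewrite RtoC_minus, RtoC_plus, RtoC_mult, RtoC_plus, !RtoC_pow.
    simpl; field.
Qed.

End HankelBound.

(** * The upper bound *)

Lemma H22_eq {X : NormedModule C_AbsRing} (F : X -> X) (x0 : X) (T : Lop X C_NormedModule) (p : nat -> C) :
  (forall m, (2 <= m <= 4)%nat -> T (radial F x0 m 0) = p m) ->
  H22 F x0 T = (p 2%nat / 2 * (p 4%nat / 24) - p 3%nat / 6 * (p 3%nat / 6))%C.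
Proof.
  intros hp.
  assert (h : forall m, (2 <= m <= 4)%nat -> coef F x0 T m = (RtoC (/ INR (fact m)) * p m)%C).
  { intros m hm; unfold coef; rewrite <- (hp m hm); unfold radial.
    replace (scal (RtoC 0 : C_AbsRing) x0) with (zero : X) by modv X; reflexivity. }
  unfold H22; rewrite !h by lia.
  replace (INR (fact 2)) with 2 by (simpl; ring); replace (INR (fact 3)) with 6 by (simpl; ring).
  replace (INR (fact 4)) with 24 by (simpl; ring); rewrite !RtoC_inv by lra.
  unfold Cdiv; ring.
Qed.

Theorem hankel_upper_bound (X : NormedModule C_AbsRing) (hX : banach X) (lambda : R)
    (g : X -> C) (F : X -> X) (x0 : X) (T : Lop X C_NormedModule) : 1 / 2 <= lambda <= 1 ->
  (forall x : X, norm x < 1 -> F x = scal (g x : C_AbsRing) x) -> class_F lambda F ->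
  norm x0 = 1 -> support_functional x0 T ->
  Cmod (H22 F x0 T) <= (1 + 2 * lambda) ^ 2 * (17 - 10 * lambda) / (192 * (3 - 2 * lambda)).
Proof.
  intros hl hg hF hx0 hT.
  set (p := fun (m : nat) (s : C) => T (radial F x0 m s) : C).
  assert (hhol : holomorphic_on_ball F) by apply hF.
  assert (hTx : T x0 = RtoC 1) by (rewrite (proj1 hT), hx0; reflexivity).
  assert (hp : forall m s, Cmod s < 1 -> hasdC (p m) s (p (S m) s)).
  { intros m s hs; apply (hasd_comp_linear (radial F x0 m) T), hasd_radial; try assumption.
    rewrite hx0; lra. }
  (* Since [F (s x0) = s g (s x0) x0], every derivative along the ray is a multiple of [x0]; the
     factor is its image under [T] because [T x0 = 1]. *)
  assert (hsc : forall m s, Cmod s < 1 -> radial F x0 m s = scal (p m s : C_AbsRing) x0).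
  { intros m s hs; apply (radial_scalar hX F hhol x0 p m); try lia; try (rewrite hx0; lra).
    - intros k t _ ht; apply hp; rewrite hx0 in ht; lra.
    - intros t ht; rewrite hx0, Rmult_1_r in ht.
      assert (hn : norm (scal (t : C_AbsRing) x0) < 1) by (rewrite_norm_scal; rewrite hx0; lra).
      unfold p, radial; simpl; rewrite (hg _ hn).
      rewrite !(linear_scal _ (Lop_is_linear T)), hTx.
      match goal with |- context [scal (scal ?a (scal ?b ?c)) x0] =>
        change (scal a (scal b c) : C_NormedModule) with (Cmult a (Cmult b c)) end.
      module_with (NormedModule.ModuleSpace C_AbsRing X) ltac:(c_unfold; ring). }
  assert (h10 : p 1%nat 0%C = 1%C).
  { unfold p, radial; simpl; replace (scal (RtoC 0 : C_AbsRing) x0) with (zero : X) by modv X.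
    destruct hF as [[_ hd] _]; rewrite hd; exact hTx. }
  assert (hray : forall s, Cmod s < 1 -> p 1%nat s <> 0%C /\
     (s <> 0%C -> 1 / 2 - lambda <= Re (s * (p 2%nat s / p 1%nat s) + 1)%C)).
  { intros s hs; apply (class_F_ray F lambda x0 T p s); try assumption.
    intros m _; apply hsc; exact hs. }
  rewrite (H22_eq F x0 T (fun m => p m 0%C)) by reflexivity.
  replace ((1 + 2 * lambda) ^ 2 * (17 - 10 * lambda) / (192 * (3 - 2 * lambda)))
    with ((lambda + 1 / 2) ^ 2 * (11 - 5 * (lambda + 1 / 2)) / (48 * (2 - (lambda + 1 / 2)))) by (field; lra).
  apply hankel_bound; [lra|intros m s _; apply hp|exact h10|intros s hs; apply (hray s hs)|].
  intros s hs0 hs; pose proof (proj2 (hray s hs) hs0) as h.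
  change (Re (s * (p 2%nat s / p 1%nat s) + 1)%C) with (Re (s * (p 2%nat s / p 1%nat s))%C + 1) in h; lra.
Qed.

(** * Primitives and the logarithm *)

Section OrientedIntegral.

Implicit Types (u : R -> C) (a b c : R).

Definition between a b (t : R) : Prop := Rmin a b <= t <= Rmax a b.

Lemma between_sym a b t : between a b t -> between b a t.
Proof. unfold between; rewrite Rmin_comm, Rmax_comm; exact (fun h => h). Qed.

Lemma ex_RInt_ccont u a b : (forall t, between a b t -> ccont u t) ->
  ex_RInt (fun t => Re (u t)) a b /\ ex_RInt (fun t => Im (u t)) a b.
Proof.
  intros h; split; apply (ex_RInt_continuous (V := R_CompleteNormedModule)); intros t ht;
    [apply ccont_Re|apply ccont_Im]; apply h; exact ht.
Qed.

Lemma Cint_swap u a b : (forall t, between a b t -> ccont u t) -> Cint u b a = (- Cint u a b)%C.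
Proof.
  intros h; destruct (ex_RInt_ccont u a b h) as [h1 h2].
  unfold Cint; apply injective_projections; simpl; symmetry;
    apply (opp_RInt_swap (V := R_CompleteNormedModule)); assumption.
Qed.

Lemma Cint_Chasles u a b c : (forall t, between a b t -> ccont u t) -> (forall t, between b c t -> ccont u t) ->
  (Cint u a b + Cint u b c)%C = Cint u a c.
Proof.
  intros h1 h2; destruct (ex_RInt_ccont u a b h1) as [r1 i1], (ex_RInt_ccont u b c h2) as [r2 i2].
  unfold Cint; apply injective_projections; simpl; apply (RInt_Chasles (V := R_CompleteNormedModule)); assumption.
Qed.

Lemma Cint_near_const u a b (k : C) (e : R) : (forall t, between a b t -> ccont u t) ->
  (forall t, between a b t -> Cmod (u t - k)%C <= e) ->
  Cmod (Cint u a b - RtoC (b - a) * k)%C <= e * Rabs (b - a).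
Proof.
  assert (hle : forall a b, a <= b -> (forall t, between a b t -> ccont u t) ->
    (forall t, between a b t -> Cmod (u t - k)%C <= e) ->
    Cmod (Cint u a b - RtoC (b - a) * k)%C <= e * Rabs (b - a)).
  { clear a b; intros a b hab hc he; rewrite Rabs_pos_eq by lra.
    unfold between in *; rewrite Rmin_left, Rmax_right in * by lra.
    apply (is_Cint_bound (fun t => (u t - k)%C) a b); [exact hab| |exact he].
    apply is_Cint_minus; [exact hab|apply is_Cint_cont; assumption|apply is_Cint_const]. }
  intros hc he; destruct (Rle_dec a b) as [hab|hab]; [apply hle; assumption|].
  rewrite (Cint_swap u b a) by (intros t ht; apply hc, between_sym; exact ht).
  replace (- Cint u b a - RtoC (b - a) * k)%C with (- (Cint u b a - RtoC (a - b) * k))%C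
    by (rewrite !RtoC_minus; ring).
  rewrite Cmod_opp, (Rabs_minus_sym b a).
  apply hle; [lra| |]; intros t ht; [apply hc|apply he]; apply between_sym; exact ht.
Qed.

End OrientedIntegral.

(** * Primitives on open rectangles *)

Section Primitive.

Context (I J : R -> Prop) (f : C -> C).
Hypothesis convI : forall a b t, I a -> I b -> between a b t -> I t.
Hypothesis convJ : forall a b t, J a -> J b -> between a b t -> J t.
Hypothesis openI : forall x, I x -> exists d, 0 < d /\ forall s, Rabs s < d -> I (x + s).
Hypothesis openJ : forall x, J x -> exists d, 0 < d /\ forall s, Rabs s < d -> J (x + s).
Hypothesis hf : forall x y, I x -> J y -> exists l, hasdC f (x, y) l.

Lemma ccont_row x y : I x -> J y -> ccont (fun t => f (t, y)) x.
Proof. intros hx hy; destruct (hf x y hx hy) as [l hl]; exact (ccont_horizontal _ _ _ l hl). Qed.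

Lemma ccont_col x y : I x -> J y -> ccont (fun t => f (x, t)) y.
Proof. intros hx hy; destruct (hf x y hx hy) as [l hl]; exact (ccont_vertical _ _ _ l hl). Qed.

Lemma Jrect_swap_x a b c d : I a -> I b -> J c -> J d -> Jrect f b a c d = (- Jrect f a b c d)%C.
Proof.
  intros ha hb hc hd; unfold Jrect.
  rewrite (Cint_swap (fun x => f (x, c)) a b), (Cint_swap (fun x => f (x, d)) a b); [ring| |];
    intros t ht; apply ccont_row; try assumption; apply (convI a b); assumption.
Qed.

Lemma Jrect_swap_y a b c d : I a -> I b -> J c -> J d -> Jrect f a b d c = (- Jrect f a b c d)%C.
Proof.
  intros ha hb hc hd; unfold Jrect.
  rewrite (Cint_swap (fun y => f (b, y)) c d), (Cint_swap (fun y => f (a, y)) c d); [ring| |];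
    intros t ht; apply ccont_col; try assumption; apply (convJ c d); assumption.
Qed.

Lemma goursat_oriented a b c d : I a -> I b -> J c -> J d -> Jrect f a b c d = 0%C.
Proof.
  assert (h1 : forall a b c d, a <= b -> c <= d -> I a -> I b -> J c -> J d -> Jrect f a b c d = 0%C).
  { clear a b c d; intros a b c d hab hcd ha hb hc hd; apply goursat; try assumption.
    intros x y hx hy; apply hf; [apply (convI a b)|apply (convJ c d)]; try assumption;
      unfold between; rewrite Rmin_left, Rmax_right by lra; assumption. }
  assert (h2 : forall a b c d, a <= b -> I a -> I b -> J c -> J d -> Jrect f a b c d = 0%C).
  { clear a b c d; intros a b c d hab ha hb hc hd; destruct (Rle_dec c d); [apply h1; assumption|].
    rewrite (Jrect_swap_y a b d c), h1 by (assumption || lra); ring. }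
  intros ha hb hc hd; destruct (Rle_dec a b); [apply h2; assumption|].
  rewrite (Jrect_swap_x b a c d), h2 by (assumption || lra); ring.
Qed.

(** Integration along a horizontal and then a vertical segment. The intervals [I] and [J] may be
    unbounded, which covers the half-plane and the strip used below. *)
Definition path_primitive (x0 y0 : R) (z : C) : C :=
  (Cint (fun t => f (t, y0)) x0 (Re z) + Ci * Cint (fun t => f (Re z, t)) y0 (Im z))%C.

Lemma primitive_base x0 y0 : path_primitive x0 y0 (x0, y0) = 0%C.
Proof.
  assert (h : forall u a, Cint u a a = 0%C).
  { intros u a; unfold Cint; rewrite !(RInt_point (V := R_CompleteNormedModule)); reflexivity. }
  unfold path_primitive; simpl; rewrite !h; ring.
Qed.

(** Goursat's theorem on the rectangle with opposite corners [(x, y0)] and [(x + s, y)] lifts the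
    new piece of the horizontal path to height [y]. The increment becomes an integral over two short
    segments at the point, where [f] is nearly constant. *)
Lemma hasd_primitive x0 y0 x y : I x0 -> J y0 -> I x -> J y ->
  hasdC (path_primitive x0 y0) (x, y) (f (x, y)).
Proof.
  intros hx0 hy0 hx hy; apply hasd_iff; intros e he.
  destruct (hf x y hx hy) as [l hl].
  destruct (hasd_cont _ _ _ hl (e / 2) ltac:(lra)) as [r [hr k]].
  destruct (openI x hx) as [d1 [hd1 k1]], (openJ y hy) as [d2 [hd2 k2]].
  exists (Rmin (r / 2) (Rmin d1 d2)); split; [repeat apply Rmin_pos; lra|]; intros [s t] hh.
  set (m := Rmin _ _) in hh.
  assert (hm : m <= r / 2 /\ m <= d1 /\ m <= d2).
  { unfold m; pose proof (Rmin_l (r / 2) (Rmin d1 d2)); pose proof (Rmin_r (r / 2) (Rmin d1 d2));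
    pose proof (Rmin_l d1 d2); pose proof (Rmin_r d1 d2); lra. }
  pose proof (re_le_Cmod (s, t)) as hs; pose proof (im_le_Cmod (s, t)) as ht.
  change (Re (s, t)) with s in hs; change (Im (s, t)) with t in ht.
  assert (hx' : I (x + s)) by (apply k1; lra); assert (hy' : J (y + t)) by (apply k2; lra).
  pose proof (goursat_oriented x (x + s) y0 y hx hx' hy0 hy) as hg; unfold Jrect in hg.
  assert (rows : forall b a a', I a -> I a' -> J b -> forall t, between a a' t -> ccont (fun t => f (t, b)) t)
    by (intros b a a' ha ha' hb t' ht'; apply ccont_row; [apply (convI a a')|]; assumption).
  assert (cols : forall b a a', J a -> J a' -> I b -> forall t, between a a' t -> ccont (fun t => f (b, t)) t)
    by (intros b a a' ha ha' hb t' ht'; apply ccont_col; [|apply (convJ a a')]; assumption).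
  assert (hsm : forall a b : R, Rabs (a - x) <= Rabs s -> Rabs (b - y) <= Rabs t -> Cmod (f (a, b) - f (x, y)) <= e / 2).
  { intros a b ha hb.
    replace ((a, b) : C) with ((x, y) + ((a - x)%R, (b - y)%R))%C by (apply injective_projections; simpl; ring).
    apply k; eapply Rle_lt_trans; [apply Cmod_pair_le|]; lra. }
  assert (hbt : forall a d b, between a (a + d) b -> Rabs (b - a) <= Rabs d).
  { intros a d b; unfold between, Rmin, Rmax; destruct (Rle_dec a (a + d)); intros hb.
    - rewrite !Rabs_pos_eq by lra; lra.
    - rewrite !Rabs_left1 by lra; lra. }
  assert (e1 : Cmod (Cint (fun t => f (t, y)) x (x + s)%R - RtoC (x + s - x)%R * f (x, y)) <= e / 2 * Rabs (x + s - x)).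
  { apply Cint_near_const; [apply rows; assumption|]; intros a ha; apply hsm; [apply hbt; exact ha|].
    rewrite Rminus_diag, Rabs_R0; apply Rabs_pos. }
  assert (e2 : Cmod (Cint (fun t => f ((x + s)%R, t)) y (y + t)%R - RtoC (y + t - y) * f (x, y)) <= e / 2 * Rabs (y + t - y)).
  { apply Cint_near_const; [apply cols; assumption|]; intros a ha; apply hsm; [|apply hbt; exact ha].
    replace (x + s - x) with s by ring; lra. }
  replace (x + s - x) with s in e1 by ring; replace (y + t - y) with t in e2 by ring.
  replace (path_primitive x0 y0 ((x, y) + (s, t)) - path_primitive x0 y0 (x, y) - (s, t) * f (x, y))%C with
    ((Cint (fun t => f (t, y)) x (x + s)%R - RtoC s * f (x, y))
     + Ci * (Cint (fun t => f ((x + s)%R, t)) y (y + t)%R - RtoC t * f (x, y)))%C.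
  - eapply Rle_trans; [apply Cmod_triangle|]; rewrite Cmod_mult, Cmod_Ci, Rmult_1_l.
    apply Rle_trans with (e / 2 * Rabs s + e / 2 * Rabs t); [lra|].
    assert (e / 2 * Rabs s <= e / 2 * Cmod (s, t)) by (apply Rmult_le_compat_l; lra).
    assert (e / 2 * Rabs t <= e / 2 * Cmod (s, t)) by (apply Rmult_le_compat_l; lra); lra.
  - unfold path_primitive.
    change (Re ((x, y) + (s, t))%C) with (x + s); change (Im ((x, y) + (s, t))%C) with (y + t).
    change (Re (x, y)) with x; change (Im (x, y)) with y.
    rewrite <- (Cint_Chasles (fun t => f (t, y0)) x0 x (x + s)) by (apply rows; assumption).
    rewrite <- (Cint_Chasles (fun t => f ((x + s)%R, t)) y0 y (y + t)) by (apply cols; assumption).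
    replace ((s, t) : C) with (RtoC s + Ci * RtoC t)%C by (apply injective_projections; simpl; ring).
    set (a1 := Cint (fun t => f (t, y)) x (x + s)) in *.
    set (a2 := Cint (fun t => f (t, y0)) x (x + s)) in *.
    set (a3 := Cint (fun t => f ((x + s)%R, t)) y0 y) in *.
    set (a4 := Cint (fun t => f (x, t)) y0 y) in *.
    assert (hg' : a1 = (a2 + Ci * (a3 - a4))%C)
      by (replace a1 with (a1 + (a2 - a1 + Ci * (a3 - a4)))%C by (rewrite hg; ring); ring).
    rewrite hg'; ring.
Qed.

End Primitive.

Lemma constant_of_derivative_0 (f : C -> C) (z w : C) :
  (forall t, 0 <= t <= 1 -> hasdC f (z + RtoC t * (w - z))%C (RtoC 0)) -> f w = f z.
Proof.
  intros h.
  pose proof (segment_bound (V := C_NormedModule) (fun s => f (z + s * (w - z))%C) (fun _ => RtoC 0) 0) as hs.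
  cbv beta in hs; apply Cminus_eq_0, Cmod_eq_0, Rle_antisym; [|apply Cmod_ge_0].
  replace w with (z + 1 * (w - z))%C at 1 by ring; replace (f z) with (f (z + 0 * (w - z))%C) by (f_equal; ring).
  apply hs; intros t ht.
  - eapply hasd_eq; [apply hasd_line, h; exact ht|cring].
  - right; exact Cmod_0.
Qed.

(** * The logarithm on the right half-plane *)

Section Logarithm.

Definition Clog : C -> C := path_primitive (fun w => (/ w)%C) 1 0.

Lemma neq_0_of_Re (z : C) : 0 < Re z -> z <> 0%C.
Proof. intros h h0; rewrite h0 in h; simpl in h; lra. Qed.

Lemma hasd_Clog (z : C) : 0 < Re z -> hasdC Clog z (/ z)%C.
Proof.
  destruct z as [x y]; intros hx; simpl in hx.
  apply (hasd_primitive (fun a => 0 < a) (fun _ => True) (fun w => (/ w)%C)); try exact Logic.I; try lra.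
  - intros a b t ha hb [ht _]; apply Rlt_le_trans with (2 := ht); apply Rmin_pos; assumption.
  - intros; exact Logic.I.
  - intros a ha; exists a; split; [exact ha|]; intros s hs; apply Rabs_def2 in hs; lra.
  - intros a _; exists 1; split; [lra|]; intros; exact Logic.I.
  - intros a b ha _; eexists; apply hasd_inv, neq_0_of_Re; exact ha.
Qed.

Lemma Clog_1 : Clog 1 = 0%C.
Proof. exact (primitive_base (fun w => (/ w)%C) 1 0). Qed.

(** The quotient [Cexp (Clog w) / w] has derivative zero along the segment from [1] to [z]. *)
Lemma Cexp_Clog (z : C) : 0 < Re z -> Cexp (Clog z) = z.
Proof.
  intros hz; assert (hz0 := neq_0_of_Re z hz).
  assert (h : (Cexp (Clog z) / z)%C = (Cexp (Clog 1) / 1)%C).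
  { apply (constant_of_derivative_0 (fun w => (Cexp (Clog w) / w)%C)); intros t ht.
    assert (hw : 0 < Re (1 + RtoC t * (z - 1))%C) by (destruct z as [x y]; simpl in *; nra).
    set (w := (1 + RtoC t * (z - 1))%C) in *; assert (hw0 := neq_0_of_Re w hw).
    eapply hasd_eq; [apply hasd_div; [apply (hasd_comp Clog Cexp); [apply hasd_Clog; exact hw|apply hasd_Cexp]|apply hasd_id|exact hw0]|].
    cbv beta; cfield; exact hw0. }
  rewrite Clog_1, Cexp_0 in h.
  replace (Cexp (Clog z)) with (Cexp (Clog z) / z * z)%C by (field; exact hz0); rewrite h; field.
Qed.

(** On the segment from [1] to [z] the cosine of the imaginary part stays positive. This part starts
    at [0], so by the intermediate value theorem it cannot reach a zero of the cosine. *)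
Lemma Im_Clog_bound (z : C) : 0 < Re z -> - (PI / 2) < Im (Clog z) < PI / 2.
Proof.
  intros hz.
  set (u := fun t : R => Im (Clog (1 + RtoC t * (z - 1))%C)).
  assert (hre : forall t, 0 <= t <= 1 -> 0 < Re (1 + RtoC t * (z - 1))%C)
    by (intros t ht; destruct z as [x y]; simpl in *; nra).
  assert (hcont : forall t, 0 <= t <= 1 -> continuity_pt u t).
  { intros t ht; apply continuity_pt_filterlim.
    apply (ex_derive_continuous (K := R_AbsRing) (V := R_NormedModule)); eexists.
    apply (hasd_derive_Im (fun s => Clog (1 + s * (z - 1))%C)); apply hasd_line, hasd_Clog, hre; exact ht. }
  assert (hcos : forall t, 0 <= t <= 1 -> 0 < cos (u t)).
  { intros t ht; pose proof (Cexp_Clog _ (hre t ht)) as h; apply (f_equal Re) in h.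
    pose proof (hre t ht) as h2; rewrite <- h in h2; unfold Cexp in h2; simpl in h2; fold (u t) in h2.
    apply Rmult_lt_reg_l with (exp (Re (Clog (1 + RtoC t * (z - 1))%C))); [apply exp_pos|].
    rewrite Rmult_0_r; exact h2. }
  assert (hu0 : u 0 = 0).
  { unfold u; replace (1 + 0 * (z - 1))%C with (RtoC 1) by ring; rewrite Clog_1; reflexivity. }
  assert (hu1 : u 1 = Im (Clog z)) by (unfold u; do 2 f_equal; ring).
  rewrite <- hu1; pose proof PI_RGT_0.
  assert (hno : forall y, cos y = 0 -> 0 < Rabs y -> ~ (between 0 (u 1) y)).
  { intros y hy hy0 hb.
    assert (hiv : exists t, 0 <= t <= 1 /\ u t = y).
    { unfold between, Rmin, Rmax in hb; destruct (Rle_dec 0 (u 1)).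
      - destruct (IVT_interv (fun t => u t - y) 0 1) as [t [ht he]].
        + intros t ht; apply continuity_pt_minus; [apply hcont; exact ht|apply continuity_pt_const; intros ? ?; reflexivity].
        + lra.
        + rewrite hu0; rewrite Rabs_pos_eq in hy0; lra.
        + destruct (Req_dec (u 1) y) as [he|he]; [exfalso|lra].
          pose proof (hcos 1 ltac:(lra)); rewrite he in *; lra.
        + exists t; split; [exact ht|lra].
      - destruct (IVT_interv (fun t => y - u t) 0 1) as [t [ht he]].
        + intros t ht; apply continuity_pt_minus; [apply continuity_pt_const; intros ? ?; reflexivity|apply hcont; exact ht].
        + lra.
        + rewrite hu0; rewrite Rabs_left1 in hy0; lra.
        + destruct (Req_dec (u 1) y) as [he|he]; [exfalso|lra].
          pose proof (hcos 1 ltac:(lra)); rewrite he in *; lra.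
        + exists t; split; [exact ht|lra]. }
    destruct hiv as [t [ht he]]; pose proof (hcos t ht); rewrite he in *; lra. }
  split; apply Rnot_le_lt; intros hle.
  - apply (hno (- (PI / 2))); [rewrite cos_neg; apply cos_PI2|rewrite Rabs_left1; lra|].
    unfold between; rewrite Rmin_right, Rmax_left; lra.
  - apply (hno (PI / 2)); [apply cos_PI2|rewrite Rabs_pos_eq; lra|].
    unfold between; rewrite Rmin_left, Rmax_right; lra.
Qed.

End Logarithm.

(** * The extremal function *)

Section ExtremalFunction.

Context (mu al : R) (hmu : 1 <= mu <= 3 / 2) (hal : 0 < al < PI / 2).

Definition ext_e : C := (cos al, sin al).
Definition ext_e' : C := (cos al, - sin al).
Notation e := ext_e.
Notation e' := ext_e'.

Lemma sin_al : 0 < sin al.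
Proof. apply sin_gt_0; pose proof PI_RGT_0; lra. Qed.

Lemma ee' : (e * e')%C = 1%C.
Proof.
  pose proof (sin2_cos2 al) as h; unfold Rsqr in h.
  apply injective_projections; simpl; [|ring]; lra.
Qed.

Lemma Cmod_e : Cmod e = 1 /\ Cmod e' = 1.
Proof.
  pose proof (sin2_cos2 al) as h; unfold Rsqr in h.
  split; (transitivity (sqrt 1); [unfold Cmod; f_equal; simpl; lra|apply sqrt_1]).
Qed.

Lemma e_sub_neq_0 : (e - e')%C <> 0%C.
Proof. pose proof sin_al; intros h; apply (f_equal Im) in h; unfold Im in h; simpl in h; lra. Qed.

Lemma Re_1_sub (z u : C) : Cmod z < 1 -> Cmod u = 1 -> 0 < Re (1 - z * u)%C.
Proof.
  intros hz hu; pose proof (Re_le_Cmod (z * u)) as h; rewrite Cmod_mult, hu in h.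
  change (Re (1 - z * u)%C) with (1 + - Re (z * u)%C); lra.
Qed.

(** A difference of logarithms, because each factor lies in the right half-plane while their
    quotient may leave it. *)
Definition zeta (z : C) : C := (Clog (1 - z * e') - Clog (1 - z * e))%C.
Definition Qext (z : C) : C := ((1 - z * e) * (1 - z * e'))%C.

Lemma Qext_eq (z : C) : Qext z = (1 - 2 * RtoC (cos al) * z + z * z)%C.
Proof.
  unfold Qext; replace ((1 - z * e) * (1 - z * e'))%C with (1 - (e + e') * z + (e * e') * (z * z))%C by ring.
  rewrite ee'; replace (e + e')%C with (2 * RtoC (cos al))%C by (apply injective_projections; simpl; ring); ring.
Qed.

Lemma factor_neq_0 (z : C) : Cmod z < 1 -> (1 - z * e)%C <> 0%C /\ (1 - z * e')%C <> 0%C.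
Proof. intros hz; split; apply neq_0_of_Re, Re_1_sub; try apply Cmod_e; exact hz. Qed.

Lemma Qext_neq_0 (z : C) : Cmod z < 1 -> Qext z <> 0%C.
Proof. intros hz; apply Cmult_neq_0; apply factor_neq_0; exact hz. Qed.

Lemma zeta_0 : zeta 0 = 0%C.
Proof. unfold zeta; rewrite !Cmult_0_l; ring. Qed.

Lemma hasd_1_sub (u z : C) : hasdC (fun s => (1 - s * u)%C) z (- u)%C.
Proof.
  eapply hasd_eq; [apply hasd_minus; [apply hasd_const|apply hasd_mult; [apply hasd_id|apply hasd_const]]|cring].
Qed.

Lemma hasd_zeta (z : C) : Cmod z < 1 -> hasdC zeta z ((e - e') / Qext z)%C.
Proof.
  intros hz; destruct (factor_neq_0 z hz) as [h1 h2]; destruct Cmod_e as [he he'].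
  eapply hasd_eq.
  - apply hasd_minus; (eapply (hasd_comp _ Clog); [apply hasd_1_sub|apply hasd_Clog, Re_1_sub; assumption]).
  - unfold Qext; cfield; split; assumption.
Qed.

Lemma Cexp_zeta (z : C) : Cmod z < 1 -> Cexp (zeta z) = ((1 - z * e') / (1 - z * e))%C.
Proof.
  intros hz; destruct (factor_neq_0 z hz) as [h1 h2]; destruct Cmod_e as [he he'].
  pose proof (Cexp_Clog _ (Re_1_sub z e hz he)) as k1; pose proof (Cexp_Clog _ (Re_1_sub z e' hz he')) as k2.
  unfold zeta, Cminus at 1; rewrite Cexp_plus, k2.
  pose proof (Cexp_opp (Clog (1 - z * e))) as h; rewrite k1 in h.
  replace (Cexp (- Clog (1 - z * e))) with ((1 - z * e) * Cexp (- Clog (1 - z * e)) / (1 - z * e))%C by (field; exact h1).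
  rewrite h; field; exact h1.
Qed.

Lemma zeta_neq_0 (z : C) : Cmod z < 1 -> z <> 0%C -> zeta z <> 0%C.
Proof.
  intros hz hz0 h; pose proof (Cexp_zeta z hz) as hE; rewrite h, Cexp_0 in hE.
  destruct (factor_neq_0 z hz) as [h1 h2].
  assert (h3 : (z * (e - e'))%C = 0%C).
  { replace (z * (e - e'))%C with ((1 - z * e') - (1 - z * e))%C by ring.
    replace (1 - z * e')%C with ((1 - z * e') / (1 - z * e) * (1 - z * e))%C by (field; exact h1).
    rewrite <- hE; ring. }
  revert h3; apply Cmult_neq_0; [exact hz0|apply e_sub_neq_0].
Qed.

(* [exp (zeta z) * e = (e - z) / (1 - z e)] lies in the upper half-plane. *)
Lemma Im_zeta (z : C) : Cmod z < 1 -> - al < Im (zeta z) < PI - al.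
Proof.
  intros hz; destruct (factor_neq_0 z hz) as [h1 h2]; destruct Cmod_e as [he he'].
  pose proof PI_RGT_0.
  pose proof (Im_Clog_bound _ (Re_1_sub z e hz he)) as b1; pose proof (Im_Clog_bound _ (Re_1_sub z e' hz he')) as b2.
  (* Confines the angle to one period, so that positivity of the sine of [Im (zeta z) + al] places
     this sum between [0] and [PI]. *)
  assert (hb : - PI < Im (zeta z) < PI).
  { change (Im (zeta z)) with (Im (Clog (1 - z * e')%C) + - Im (Clog (1 - z * e)%C)); lra. }
  assert (hs : 0 < sin (Im (zeta z) + al)).
  { assert (hE : (Cexp (zeta z) * e)%C = ((e - z) / (1 - z * e))%C).
    { rewrite Cexp_zeta by exact hz.
      replace ((1 - z * e') / (1 - z * e) * e)%C with ((e - z * (e * e')) / (1 - z * e))%C by (field; exact h1).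
      rewrite ee'; field; exact h1. }
    assert (hpos : 0 < Im ((e - z) / (1 - z * e))%C).
    { assert (hq : 0 < Cmod (1 - z * e) ^ 2) by (apply pow_lt, Cmod_gt_0; exact h1).
      assert (hq0 : RtoC (Cmod (1 - z * e) ^ 2) <> 0%C) by (intros h; injection h; lra).
      assert (hcj : Cconj (1 - z * e) <> 0%C).
      { intros h; apply h1; rewrite <- (Cconj_conj (1 - z * e)), h; apply injective_projections; simpl; ring. }
      replace ((e - z) / (1 - z * e))%C with (RtoC (/ Cmod (1 - z * e) ^ 2) * ((e - z) * Cconj (1 - z * e)))%C.
      - replace (Im (RtoC (/ Cmod (1 - z * e) ^ 2) * ((e - z) * Cconj (1 - z * e)))%C)
          with (/ Cmod (1 - z * e) ^ 2 * Im ((e - z) * Cconj (1 - z * e))%C)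
          by (unfold Im; simpl; ring).
        apply Rmult_lt_0_compat; [apply Rinv_0_lt_compat; exact hq|].
        assert (hm : Cmod z ^ 2 < 1) by (pose proof (Cmod_ge_0 z); simpl; nra).
        rewrite Cmod2_alt in hm; destruct z as [x y]; unfold Re, Im in *; simpl in *.
        pose proof sin_al; pose proof (sin2_cos2 al) as h; unfold Rsqr in h.
        match goal with |- 0 < ?g => replace g with (sin al * (1 - (x * (x * 1) + y * (y * 1)))
           + y * (cos al * cos al + sin al * sin al - 1)) by ring end.
        replace (cos al * cos al + sin al * sin al - 1) with 0 by lra.
        rewrite Rmult_0_r, Rplus_0_r; apply Rmult_lt_0_compat; lra.
      - rewrite RtoC_inv by lra; rewrite Cmod2_conj; field; split; assumption. }
    rewrite <- hE in hpos.
    replace (Im (Cexp (zeta z) * e)%C) with (exp (Re (zeta z)) * sin (Im (zeta z) + al)) in hpos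
      by (rewrite sin_plus; unfold Cexp, Im; simpl; ring).
    apply Rmult_lt_reg_l with (exp (Re (zeta z))); [apply exp_pos|rewrite Rmult_0_r; exact hpos]. }
  split; apply Rnot_le_lt; intros hle.
  - pose proof (sin_ge_0 (- (Im (zeta z) + al)) ltac:(lra) ltac:(lra)) as h; rewrite sin_neg in h; lra.
  - pose proof (sin_le_0 (Im (zeta z) + al) ltac:(lra) ltac:(lra)); lra.
Qed.

Definition strip (w : C) : Prop := - al < Im w < PI - al.
Definition half_shift (w : C) : C := (w / 2 + (0, al))%C.
(** This is [- 2 i sinh] of [half_shift w]. On the strip the imaginary part of [half_shift w] lies
    between [0] and [PI], and the factor [- i] turns the values into the right half-plane, the
    domain of [Clog]. *)
Definition sg (w : C) : C := (- Ci * (Cexp (half_shift w) - Cexp (- half_shift w)))%C.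
Definition ch (w : C) : C := (- Ci * (Cexp (half_shift w) + Cexp (- half_shift w)))%C.
(** The power [sg ^ (2 mu - 2)]. As the square of [sg (zeta z)] is a constant over [Qext z], and the
    derivative of [zeta] is another one, [kext (zeta z)] times this derivative is a multiple of
    [Qext z ^ (- mu)]. *)
Definition kext (w : C) : C := Cexp (RtoC (2 * mu - 2) * Clog (sg w)).
Definition Kext : C -> C := path_primitive kext 0 0.

Lemma C2_neq_0 : RtoC 2 <> 0%C.
Proof. intros h; injection h; lra. Qed.

Lemma Re_sg (w : C) : strip w -> 0 < Re (sg w).
Proof.
  intros hw; pose proof PI_RGT_0.
  assert (hi : Im (half_shift w) = Im w / 2 + al) by (unfold half_shift, Im; simpl; field).
  replace (Re (sg w)) with ((exp (Re (half_shift w)) + exp (- Re (half_shift w))) * sin (Im (half_shift w))).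
  - apply Rmult_lt_0_compat; [pose proof (exp_pos (Re (half_shift w))); pose proof (exp_pos (- Re (half_shift w))); lra|].
    rewrite hi; unfold strip in hw; apply sin_gt_0; lra.
  - unfold sg, Cexp; generalize (half_shift w); intros [a b]; unfold Re, Im; simpl.
    rewrite cos_neg, sin_neg; ring.
Qed.

Lemma hasd_half_shift (w : C) : hasdC half_shift w (/ 2)%C.
Proof.
  eapply hasd_eq; [apply hasd_plus; [apply hasd_mult; [apply hasd_id|apply hasd_const]|apply hasd_const]|].
  cring.
Qed.

Lemma hasd_sg (w : C) : hasdC sg w (ch w / 2)%C.
Proof.
  eapply hasd_eq.
  - apply hasd_scal, hasd_minus; (eapply (hasd_comp _ Cexp); [|apply hasd_Cexp]).
    + apply hasd_half_shift.
    + apply hasd_opp, hasd_half_shift.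
  - unfold ch, Cdiv; cring.
Qed.

Lemma hasd_kext (w : C) : strip w ->
  hasdC kext w (kext w * (RtoC (2 * mu - 2) * (ch w / 2 / sg w)))%C.
Proof.
  intros hw; pose proof (Re_sg w hw) as hs; eapply hasd_eq.
  - eapply (hasd_comp _ Cexp); [|apply hasd_Cexp].
    apply hasd_scal; eapply (hasd_comp _ Clog); [apply hasd_sg|apply hasd_Clog; exact hs].
  - fold (kext w); unfold Cdiv; cring.
Qed.

Lemma Re_kext (w : C) : strip w -> 0 < Re (kext w).
Proof.
  intros hw; pose proof (Im_Clog_bound _ (Re_sg w hw)) as hb; pose proof PI_RGT_0.
  unfold kext; set (L := Clog (sg w)) in *.
  change (0 < exp (Re (RtoC (2 * mu - 2) * L)%C) * cos (Im (RtoC (2 * mu - 2) * L)%C)).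
  apply Rmult_lt_0_compat; [apply exp_pos|].
  replace (Im (RtoC (2 * mu - 2) * L)%C) with ((2 * mu - 2) * Im L) by (unfold Im; simpl; ring).
  apply cos_gt_0; nra.
Qed.

Lemma hasd_Kext (w : C) : strip w -> hasdC Kext w (kext w).
Proof.
  destruct w as [x y]; intros hw; unfold strip in hw; simpl in hw; pose proof PI_RGT_0.
  apply (hasd_primitive (fun _ => True) (fun b => - al < b < PI - al) kext); try exact Logic.I; try lra.
  - intros; exact Logic.I.
  - intros a b t ha hb [h1 h2]; split.
    + apply Rlt_le_trans with (2 := h1); apply Rmin_glb_lt; lra.
    + apply Rle_lt_trans with (1 := h2); apply Rmax_lub_lt; lra.
  - intros a _; exists 1; split; [lra|]; intros; exact Logic.I.
  - intros b hb; exists (Rmin (b + al) (PI - al - b)); split; [apply Rmin_pos; lra|].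
    intros s hs; pose proof (Rmin_l (b + al) (PI - al - b)); pose proof (Rmin_r (b + al) (PI - al - b)).
    apply Rabs_def2 in hs; lra.
  - intros a b _ hb; eexists; apply hasd_kext; exact hb.
Qed.

Lemma Kext_0 : Kext 0 = 0%C.
Proof. exact (primitive_base kext 0 0). Qed.

(* [Kext w / w] is the mean of [kext], which takes values in the right
   half-plane, over the segment from [0] to [w]. *)
Lemma Kext_neq_0 (w : C) : strip w -> w <> 0%C -> Kext w <> 0%C.
Proof.
  intros hw hw0 h; unfold strip in hw; pose proof PI_RGT_0.
  assert (hst : forall t, 0 <= t <= 1 -> strip (0 + RtoC t * w)%C).
  { intros t ht; unfold strip; replace (Im (0 + RtoC t * w)%C) with (t * Im w) by (unfold Im; simpl; ring).
    destruct (Rle_dec 0 (Im w)); split; nra. }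
  destruct (hasd_mean_value (fun s => (/ w * Kext (0 + s * w))%C) (fun t => kext (0 + RtoC t * w)%C)) as [t [ht he]].
  - intros t ht; eapply hasd_eq; [apply hasd_scal, hasd_line, hasd_Kext, hst; exact ht|cfield; exact hw0].
  - replace (0 + 1 * w)%C with w in he by ring; replace (0 + 0 * w)%C with (RtoC 0) in he by ring.
    rewrite h, Kext_0, Cmult_0_r in he; pose proof (Re_kext _ (hst t ht)).
    rewrite <- he in *; lra.
Qed.

Definition kappa : C := (/ (kext 0 * (e - e')))%C.
Definition fext (z : C) : C := (kappa * Kext (zeta z))%C.
Definition fext1 (z : C) : C := (kappa * (kext (zeta z) * ((e - e') / Qext z)))%C.
(** The logarithmic derivative of [Qext ^ (- mu)], that is [f'' / f']. *)
Definition Aext (z : C) : C := (2 * RtoC mu * (RtoC (cos al) - z) / Qext z)%C.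

Lemma kext_neq_0 (w : C) : kext w <> 0%C.
Proof. apply Cexp_neq_0. Qed.

Lemma kappa_neq_0 : kappa <> 0%C.
Proof.
  unfold kappa; intros h; assert (hn : (kext 0 * (e - e'))%C <> 0%C) by (apply Cmult_neq_0; [apply kext_neq_0|apply e_sub_neq_0]).
  assert (h1 : (kext 0 * (e - e') * / (kext 0 * (e - e')))%C = 1%C) by (apply Cinv_r; exact hn).
  rewrite h, Cmult_0_r in h1; injection h1; lra.
Qed.

Lemma fext_0 : fext 0 = 0%C.
Proof. unfold fext; rewrite zeta_0, Kext_0; ring. Qed.

Lemma fext1_0 : fext1 0 = 1%C.
Proof.
  unfold fext1, kappa; rewrite zeta_0, Qext_eq.
  field; split; [apply e_sub_neq_0|apply kext_neq_0].
Qed.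

Lemma hasd_fext (z : C) : Cmod z < 1 -> hasdC fext z (fext1 z).
Proof.
  intros hz; eapply hasd_eq.
  - apply hasd_scal; apply (hasd_comp zeta Kext); [apply hasd_zeta; exact hz|apply hasd_Kext, Im_zeta; exact hz].
  - unfold fext1; cring.
Qed.

Lemma fext1_neq_0 (z : C) : Cmod z < 1 -> fext1 z <> 0%C.
Proof.
  intros hz; unfold fext1, Cdiv; repeat apply Cmult_neq_0.
  - apply kappa_neq_0.
  - apply kext_neq_0.
  - apply e_sub_neq_0.
  - intros h; pose proof (Cinv_r _ (Qext_neq_0 z hz)) as h1; rewrite h, Cmult_0_r in h1; injection h1; lra.
Qed.

Lemma fext_neq_0 (z : C) : Cmod z < 1 -> z <> 0%C -> fext z <> 0%C.
Proof.
  intros hz hz0; apply Cmult_neq_0; [apply kappa_neq_0|].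
  apply Kext_neq_0; [apply Im_zeta; exact hz|apply zeta_neq_0; assumption].
Qed.

(** Makes the logarithmic derivative of [kext (zeta z)] rational in [z]. The quotient
    [(E^2 + 1) / (E^2 - 1)] with [E = Cexp W] involves only [E^2], so no branch of a square root
    occurs. *)
Lemma ch_div_sg (z : C) : Cmod z < 1 -> (ch (zeta z) / sg (zeta z))%C = (2 * (RtoC (cos al) - z) / (e - e'))%C.
Proof.
  intros hz; destruct (factor_neq_0 z hz) as [h1 h2].
  set (W := half_shift (zeta z)).
  assert (hCC : (Cexp W * Cexp W)%C = ((1 - z * e') / (1 - z * e) * (e * e))%C).
  { rewrite <- Cexp_plus; replace (W + W)%C with (zeta z + ((0, al) + (0, al)))%C.
    - rewrite !Cexp_plus, Cexp_zeta by exact hz; do 2 f_equal;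
        unfold Cexp; simpl; rewrite exp_0; apply injective_projections; simpl; ring.
    - unfold W, half_shift; field; exact C2_neq_0. }
  pose proof (Cexp_opp W) as hinv; pose proof (Cexp_neq_0 W) as hne.
  assert (hop : Cexp (- W) = (/ Cexp W)%C).
  { replace (Cexp (- W)) with (Cexp W * Cexp (- W) / Cexp W)%C by (field; exact hne); rewrite hinv; field; exact hne. }
  assert (hsg := neq_0_of_Re _ (Re_sg _ (Im_zeta z hz))).
  assert (hCi : Ci <> 0%C) by (intros h; injection h; lra).
  assert (hee := e_sub_neq_0).
  assert (hmain : (ch (zeta z) * (e - e'))%C = (2 * (RtoC (cos al) - z) * sg (zeta z))%C).
  { unfold ch, sg; fold W; rewrite hop.
    set (E := Cexp W) in *.
    replace (- Ci * (E + / E) * (e - e'))%C with (- Ci / E * ((E * E + 1) * (e - e')))%C by (field; exact hne).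
    replace (2 * (RtoC (cos al) - z) * (- Ci * (E - / E)))%C with (- Ci / E * ((E * E - 1) * (2 * RtoC (cos al) - 2 * z)))%C
      by (field; exact hne).
    f_equal; rewrite hCC.
    replace (2 * RtoC (cos al))%C with (e + e')%C by (apply injective_projections; simpl; ring).
    replace ((1 - z * e') / (1 - z * e) * (e * e))%C with ((e - z) * e / (1 - z * e))%C.
    2:{ replace (e - z)%C with (e - z * (e * e'))%C by (rewrite ee'; ring); field; exact h1. }
    assert (hx := ee'); set (a := e) in *; set (b := e') in *.
    replace ((a - z) * a / (1 - z * a) + 1)%C with ((a * a - 2 * z * a + 1) / (1 - z * a))%C by (field; exact h1).
    replace ((a - z) * a / (1 - z * a) - 1)%C with ((a * a - 1) / (1 - z * a))%C by (field; exact h1).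
    replace (a * a - 2 * z * a + 1)%C with (a * (a + b - 2 * z))%C by (rewrite <- hx; ring).
    replace (a * a - 1)%C with (a * (a - b))%C by (rewrite <- hx; ring).
    field; exact h1. }
  replace (ch (zeta z) / sg (zeta z))%C with (ch (zeta z) * (e - e') / (sg (zeta z) * (e - e')))%C by (field; split; assumption).
  rewrite hmain; field; split; assumption.
Qed.

Lemma hasd_Qext (z : C) : hasdC Qext z (2 * z - 2 * RtoC (cos al))%C.
Proof.
  eapply hasd_eq; [apply hasd_mult; apply hasd_1_sub|].
  replace (2 * z - 2 * RtoC (cos al))%C with (2 * (e * e') * z - (e + e'))%C.
  - cring.
  - rewrite ee'; replace (e + e')%C with (2 * RtoC (cos al))%C by (apply injective_projections; simpl; ring); ring.
Qed.

Lemma hasd_fext1 (z : C) : Cmod z < 1 -> hasdC fext1 z (fext1 z * Aext z)%C.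
Proof.
  intros hz; pose proof (Qext_neq_0 z hz) as hQ; eapply hasd_eq.
  - apply hasd_scal, hasd_mult.
    + apply (hasd_comp zeta kext); [apply hasd_zeta; exact hz|apply hasd_kext, Im_zeta; exact hz].
    + apply hasd_div; [apply hasd_const|apply hasd_Qext|exact hQ].
  - unfold fext1, Aext; cbv beta.
    replace (ch (zeta z) / 2 / sg (zeta z))%C with (ch (zeta z) / sg (zeta z) / 2)%C
      by (unfold Cdiv; ring).
    rewrite ch_div_sg by exact hz; rewrite RtoC_minus, RtoC_mult.
    assert (hee := e_sub_neq_0); cfield; split; assumption.
Qed.

(** The product [Aext Qext] is affine. Differentiating it once and twice gives this formula and that
    of [Aext2], without higher powers of [Qext]. *)
Definition Aext1 (z : C) : C := ((- (2 * RtoC mu) - Aext z * (2 * z - 2 * RtoC (cos al))) / Qext z)%C.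

Lemma hasd_Aext (z : C) : Cmod z < 1 -> hasdC Aext z (Aext1 z).
Proof.
  intros hz; eapply hasd_eq.
  - apply hasd_div; [|apply hasd_Qext|apply Qext_neq_0; exact hz].
    apply hasd_scal, hasd_minus; [apply hasd_const|apply hasd_id].
  - unfold Aext1, Aext; cbv beta; pose proof (Qext_neq_0 z hz); cfield; assumption.
Qed.

Definition Aext2 (z : C) : C :=
  ((- (2 * Aext1 z * (2 * z - 2 * RtoC (cos al))) - 2 * Aext z) / Qext z)%C.

Lemma hasd_Aext1 (z : C) : Cmod z < 1 -> hasdC Aext1 z (Aext2 z).
Proof.
  intros hz; eapply hasd_eq.
  - apply hasd_div; [|apply hasd_Qext|apply Qext_neq_0; exact hz].
    apply hasd_minus; [apply hasd_const|].
    apply hasd_mult; [apply hasd_Aext; exact hz|].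
    apply hasd_minus; [apply hasd_scal, hasd_id|apply hasd_const].
  - cbv beta; fold (Aext1 z); unfold Aext2; pose proof (Qext_neq_0 z hz); cfield; assumption.
Qed.

Definition fext2 (z : C) : C := (fext1 z * Aext z)%C.
Definition fext3 (z : C) : C := (fext2 z * Aext z + fext1 z * Aext1 z)%C.
Definition fext4 (z : C) : C := (fext3 z * Aext z + 2 * fext2 z * Aext1 z + fext1 z * Aext2 z)%C.

Lemma hasd_fext2 (z : C) : Cmod z < 1 -> hasdC fext2 z (fext3 z).
Proof. intros hz; apply hasd_mult; [apply hasd_fext1; exact hz|apply hasd_Aext; exact hz]. Qed.

Lemma hasd_fext3 (z : C) : Cmod z < 1 -> hasdC fext3 z (fext4 z).
Proof.
  intros hz; eapply hasd_eq.
  - apply hasd_plus; apply hasd_mult.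
    + apply hasd_fext2; exact hz.
    + apply hasd_Aext; exact hz.
    + apply hasd_fext1; exact hz.
    + apply hasd_Aext1; exact hz.
  - unfold fext4; fold (fext2 z); cring.
Qed.

Definition Gext (z : C) : C := if Ceq_dec z 0 then 1%C else (fext z / z)%C.

Lemma Gext_mult (z : C) : (z * Gext z)%C = fext z.
Proof.
  unfold Gext; destruct (Ceq_dec z 0) as [->|hz]; [rewrite fext_0; ring|field; exact hz].
Qed.

Lemma Gext_0 : Gext 0 = 1%C.
Proof. unfold Gext; destruct (Ceq_dec 0 0); [reflexivity|congruence]. Qed.

Lemma Gext_neq_0 (z : C) : Cmod z < 1 -> Gext z <> 0%C.
Proof.
  intros hz h; destruct (Ceq_dec z 0) as [->|hz0].
  - rewrite Gext_0 in h; injection h; lra.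
  - apply (fext_neq_0 z hz hz0); rewrite <- Gext_mult, h; ring.
Qed.

(** At the origin the derivative is [f'' (0) / 2] by the second-order expansion of [fext]. The
    accompanying identity is the derivative of [z Gext z = fext z]. *)
Lemma hasd_Gext (z : C) : Cmod z < 1 -> exists l, hasdC Gext z l /\ (Gext z + z * l)%C = fext1 z.
Proof.
  intros hz; destruct (Ceq_dec z 0) as [->|hz0].
  - exists (fext2 0 / 2)%C; split; [|rewrite Gext_0, fext1_0; ring].
    apply hasd_iff; intros eps heps.
    destruct (taylor_two fext fext1 (fext2 0 / 2)%C hasd_fext) with (e := eps) as [d [hd k]]; [|exact heps|].
    { eapply hasd_eq; [apply hasd_fext1; rewrite Cmod_0; lra|]; unfold fext2; cfield; exact C2_neq_0. }
    exists d; split; [exact hd|]; intros h hh; specialize (k h hh).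
    rewrite Cplus_0_l, Gext_0; rewrite fext_0, fext1_0 in k.
    destruct (Ceq_dec h 0) as [->|hh0].
    + rewrite Gext_0; replace (1 - 1 - 0 * (fext2 0 / 2))%C with (RtoC 0) by ring.
      rewrite Cmod_0; lra.
    + assert (hp : 0 < Cmod h) by (apply Cmod_gt_0; exact hh0).
      apply Rmult_le_reg_l with (Cmod h); [exact hp|].
      rewrite <- Cmod_mult.
      replace (h * (Gext h - 1 - h * (fext2 0 / 2)))%C with (fext h - 0 - 1 * h - fext2 0 / 2 * (h * h))%C
        by (rewrite <- Gext_mult; ring).
      eapply Rle_trans; [exact k|]; right; ring.
  - exists ((fext1 z - fext z / z * 1) / z)%C; split.
    + assert (hp : 0 < Cmod z) by (apply Cmod_gt_0; exact hz0).
      apply (hasd_ext_loc (fun s => (fext s / s)%C) _ _ _ (Cmod z) hp).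
      * intros h hh; unfold Gext; destruct (Ceq_dec (z + h) 0) as [h0|h0]; [|reflexivity].
        exfalso; replace z with (- h)%C in hh; [rewrite Cmod_opp in hh; lra|].
        replace z with ((z + h) - h)%C by ring; rewrite h0; ring.
      * apply hasd_div; [apply hasd_fext; exact hz|apply hasd_id|exact hz0].
    + rewrite <- Gext_mult; field; exact hz0.
Qed.

(** One has [z Aext z = mu ((1 - z^2) / Qext z - 1)], and [Re ((1 - z^2) conj (Qext z))] factors as
    [(1 - |z|^2) (1 + |z|^2 - 2 cos al Re z)], both factors being nonnegative. *)
Lemma Re_Aext (z : C) : Cmod z < 1 -> - mu <= Re (z * Aext z)%C.
Proof.
  intros hz; pose proof (Qext_neq_0 z hz) as hQ.
  assert (hne : 0 < Cmod (Qext z) ^ 2) by (apply pow_lt, Cmod_gt_0; exact hQ).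
  assert (hcj : Cconj (Qext z) <> 0%C).
  { intros h; apply hQ; rewrite <- (Cconj_conj (Qext z)), h; apply injective_projections; simpl; ring. }
  assert (he : (z * Aext z)%C = (RtoC mu * (RtoC (/ Cmod (Qext z) ^ 2) * ((1 - z * z) * Cconj (Qext z)) - 1))%C).
  { rewrite RtoC_inv by lra; rewrite Cmod2_conj.
    replace (/ (Qext z * Cconj (Qext z)) * ((1 - z * z) * Cconj (Qext z)) - 1)%C
      with ((1 - z * z - Qext z) / Qext z)%C by (field; split; assumption).
    rewrite Qext_eq in *; unfold Aext; rewrite Qext_eq; field; exact hQ. }
  rewrite he.
  replace (Re (RtoC mu * (RtoC (/ Cmod (Qext z) ^ 2) * ((1 - z * z) * Cconj (Qext z)) - 1))%C)
    with (mu * (/ Cmod (Qext z) ^ 2 * Re ((1 - z * z) * Cconj (Qext z))%C - 1)) by (unfold Re; simpl; ring).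
  assert (hpos : 0 <= Re ((1 - z * z) * Cconj (Qext z))%C).
  { assert (hm : Cmod z ^ 2 < 1) by (pose proof (Cmod_ge_0 z); simpl; nra).
    rewrite Cmod2_alt in hm; rewrite Qext_eq; pose proof (COS_bound al) as hc.
    set (c := cos al) in *; destruct z as [x y]; unfold Re, Im in *; simpl in *.
    match goal with |- 0 <= ?g => replace g with
      ((1 - (x * (x * 1) + y * (y * 1))) * (1 + (x * (x * 1) + y * (y * 1)) - 2 * c * x)) by ring end.
    apply Rmult_le_pos; [lra|].
    assert (hcc : c * c <= 1) by nra.
    pose proof (Rle_0_sqr (x - c)) as h1; pose proof (Rle_0_sqr y) as h2; unfold Rsqr in h1, h2; lra. }
  assert (0 <= / Cmod (Qext z) ^ 2 * Re ((1 - z * z) * Cconj (Qext z))%C)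
    by (apply Rmult_le_pos; [left; apply Rinv_0_lt_compat; exact hne|exact hpos]).
  nra.
Qed.

End ExtremalFunction.

(** * The extremal map *)

Ltac push_RtoC :=
  repeat first [rewrite RtoC_plus|rewrite RtoC_minus|rewrite RtoC_opp|rewrite RtoC_mult].

Section ExtremalMap.

Context {X : NormedModule C_AbsRing}.

Lemma is_linear_identity : is_linear (fun v : X => v).
Proof. split; [reflexivity|reflexivity|]; exists 1; split; [lra|]; intros x; lra. Qed.

Definition Lid : Lop X X := mkLop _ is_linear_identity.

(** The shape of the derivative of [g y * y] at [x] when [g x = a] and the derivative of [g] is
    [b l]. *)
Definition Lrank_one (a b : C) (l : Lop X C_NormedModule) (x : X) : Lop X X :=
  plus (scal (a : C_AbsRing) (Lid : Lop_NormedModule X X))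
    (scal (b : C_AbsRing) (Lcomp (Lray x) l : Lop_NormedModule X X)).

Lemma Lrank_one_apply (a b : C) l x v :
  Lrank_one a b l x v = plus (scal (a : C_AbsRing) v) (scal (b * l v : C_AbsRing)%C x).
Proof.
  change (plus (scal (a : C_AbsRing) v) (scal (b : C_AbsRing) (scal (l v : C_AbsRing) x)) =
    plus (scal (a : C_AbsRing) v) (scal (b * l v : C_AbsRing)%C x)).
  modv X.
Qed.

Lemma frechet_scal_id (g : X -> C) (x : X) (l : Lop X C_NormedModule) (d : C) :
  frechet (V := C_NormedModule) g x (scal (d : C_AbsRing) (l : Lop_NormedModule X C_NormedModule) : Lop X C_NormedModule) ->
  frechet (fun y => scal (g y : C_AbsRing) y) x (Lrank_one (g x) d l x).
Proof.
  intros hg e he; pose proof (norm_ge_0 x) as hx.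
  destruct (hg (e / (2 * (norm x + 1))) ltac:(apply Rdiv_lt_0_compat; lra)) as [d1 [hd1 k1]].
  destruct (frechet_continuous (V := C_NormedModule) g x _ hg (e / 2) ltac:(lra)) as [d2 [hd2 k2]].
  exists (Rmin d1 d2); split; [apply Rmin_pos; assumption|]; intros h hh.
  pose proof (Rmin_l d1 d2); pose proof (Rmin_r d1 d2).
  specialize (k1 h ltac:(lra)); specialize (k2 h ltac:(lra)).
  change (Cmod (g (plus x h) - g x - d * l h)%C <= e / (2 * (norm x + 1)) * norm h) in k1.
  change (Cmod (g (plus x h) - g x)%C <= e / 2) in k2.
  rewrite Lrank_one_apply.
  norm_lhs (plus (scal (g (plus x h) - g x - d * l h : C_AbsRing)%C x) (scal (g (plus x h) - g x : C_AbsRing)%C h)).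
  eapply Rle_trans; [apply norm_triangle|].
  apply Rle_trans with (Cmod (g (plus x h) - g x - d * l h)%C * norm x + Cmod (g (plus x h) - g x)%C * norm h).
  - right; f_equal; apply norm_scalC.
  - pose proof (norm_ge_0 h).
    assert (a1 : Cmod (g (plus x h) - g x - d * l h)%C * norm x <= e / 2 * norm h).
    { apply Rle_trans with (e / (2 * (norm x + 1)) * norm h * (norm x + 1)).
      - apply Rmult_le_compat; try lra; apply Cmod_ge_0.
      - right; field; lra. }
    assert (a2 : Cmod (g (plus x h) - g x)%C * norm h <= e / 2 * norm h) by (apply Rmult_le_compat_r; assumption).
    lra.
Qed.

(** The Sherman-Morrison formula. For the extremal map the two nonvanishing quantities are [Gext]
    and [fext1] at [l x]. *)
Lemma Lrank_one_inverse (a b : C) (l : Lop X C_NormedModule) (x : X) :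
  a <> 0%C -> (a + b * l x)%C <> 0%C ->
  is_inverse (Lrank_one a b l x) (Lrank_one (/ a) (- b / (a * (a + b * l x))) l x).
Proof.
  intros ha hab.
  assert (hl : forall s t v, l (plus (scal (s : C_AbsRing) v) (scal (t : C_AbsRing) x)) = (s * l v + t * l x)%C).
  { intros s t v; rewrite (linear_plus _ (Lop_is_linear l)), !(linear_scal _ (Lop_is_linear l)); reflexivity. }
  split; intros v; rewrite !Lrank_one_apply, hl;
    module_with (NormedModule.ModuleSpace C_AbsRing X) ltac:(c_unfold; cfield; try split; assumption).
Qed.

Context (hX : banach X) (mu al : R) (hmu : 1 <= mu <= 3 / 2) (hal : 0 < al < PI / 2).
Context (l : Lop X C_NormedModule) (hl : forall v, Cmod (l v) <= norm v).

Definition gmap (x : X) : C := Gext mu al (l x).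
Definition Fmap (x : X) : X := scal (gmap x : C_AbsRing) x.

Lemma Cmod_l_lt (x : X) : norm x < 1 -> Cmod (l x) < 1.
Proof. intros hx; pose proof (hl x); lra. Qed.

Lemma frechet_gmap (x : X) : norm x < 1 -> exists d : C,
  frechet (V := C_NormedModule) gmap x (scal (d : C_AbsRing) (l : Lop_NormedModule X C_NormedModule) : Lop X C_NormedModule)
  /\ (gmap x + d * l x)%C = fext1 mu al (l x).
Proof.
  intros hx; destruct (hasd_Gext mu al hal (l x) (Cmod_l_lt x hx)) as [d [hd he]].
  exists d; split.
  - pose proof (frechet_comp (V := C_NormedModule) l (Gext mu al) x l (Lray (V := C_NormedModule) d)
      (frechet_linear l x) hd) as h.
    replace (scal (d : C_AbsRing) (l : Lop_NormedModule X C_NormedModule) : Lop X C_NormedModule)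
      with (Lcomp (Lray (V := C_NormedModule) d) l); [exact h|].
    apply Lop_ext; intros v; change ((l v * d)%C = (d * l v)%C); ring.
  - rewrite <- he; unfold gmap; ring.
Qed.

Lemma holomorphic_gmap : holomorphic_on_ball (Y := C_NormedModule) gmap.
Proof.
  intros x hx; destruct (frechet_gmap x hx) as [d [hd _]]; eapply ex_filterdiff_frechet; exact hd.
Qed.

Lemma gmap_zero : gmap zero = 1%C.
Proof. unfold gmap; rewrite (linear_zero _ (Lop_is_linear l)); apply Gext_0. Qed.

Lemma frechet_Fmap (x : X) : norm x < 1 -> exists d : C,
  frechet Fmap x (Lrank_one (gmap x) d l x) /\ (gmap x + d * l x)%C = fext1 mu al (l x).
Proof.
  intros hx; destruct (frechet_gmap x hx) as [d [hd he]]; exists d; split; [|exact he].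
  apply frechet_scal_id; exact hd.
Qed.

Lemma holomorphic_Fmap : holomorphic_on_ball Fmap.
Proof.
  intros x hx; destruct (frechet_Fmap x hx) as [d [hd _]]; eapply ex_filterdiff_frechet; exact hd.
Qed.

Lemma normalized_Fmap : normalized Fmap.
Proof.
  split; [unfold Fmap; modv X|]; intros v.
  destruct (frechet_Fmap zero) as [d [hd _]]; [rewrite norm_zero; lra|].
  rewrite (fderiv_eq _ _ _ hd), Lrank_one_apply, gmap_zero; modv X.
Qed.

Lemma locally_biholomorphic_Fmap : locally_biholomorphic Fmap.
Proof.
  split; [exact holomorphic_Fmap|]; intros x hx; destruct (frechet_Fmap x hx) as [d [hd he]].
  eexists; rewrite (fderiv_eq _ _ _ hd); apply Lrank_one_inverse.
  - apply Gext_neq_0; first [exact hmu|exact hal|apply Cmod_l_lt; exact hx].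
  - rewrite he; apply fext1_neq_0; first [exact hal|apply Cmod_l_lt; exact hx].
Qed.

(* The derivatives of [s * Gext (s z)], where [Fmap (s x) = s * Gext (s z) * x]
   for [z = l x]. *)
Definition pext (z : C) (m : nat) (s : C) : C :=
  match m with
  | 0%nat => s * Gext mu al (s * z)
  | 1%nat => fext1 mu al (s * z)
  | 2%nat => z * fext2 mu al (s * z)
  | 3%nat => z * (z * fext3 mu al (s * z))
  | _ => z * (z * (z * fext4 mu al (s * z)))
  end%C.

Lemma hasd_pext (z : C) (m : nat) (s : C) : (m < 4)%nat -> Cmod (s * z) < 1 ->
  hasdC (pext z m) s (pext z (S m) s).
Proof.
  intros hm hs.
  assert (hz : hasdC (fun t => (t * z)%C) s z)
    by (eapply hasd_eq; [apply hasd_mult; [apply hasd_id|apply hasd_const]|cring]).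
  destruct m as [|[|[|[|m]]]]; [| | | |lia]; simpl.
  - destruct (hasd_Gext mu al hal (s * z)%C hs) as [d [hd he]].
    eapply hasd_eq.
    + apply hasd_mult; [apply hasd_id|apply (hasd_comp (fun t => (t * z)%C) (Gext mu al)); [exact hz|exact hd]].
    + cbv beta; rewrite <- he; cring.
  - apply (hasd_comp (fun t => (t * z)%C) (fext1 mu al)); [exact hz|].
    apply hasd_fext1; assumption.
  - apply hasd_scal, (hasd_comp (fun t => (t * z)%C) (fext2 mu al)); [exact hz|].
    apply hasd_fext2; assumption.
  - apply hasd_scal, hasd_scal, (hasd_comp (fun t => (t * z)%C) (fext3 mu al)); [exact hz|].
    apply hasd_fext3; assumption.
Qed.

Lemma radial_Fmap (y : X) (m : nat) (s : C) : (m <= 4)%nat -> Cmod s * norm y < 1 ->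
  radial Fmap y m s = scal (pext (l y) m s : C_AbsRing) y.
Proof.
  intros hm hs; apply (radial_scalar hX Fmap holomorphic_Fmap y (pext (l y)) 4); try assumption.
  - intros k t hk ht; apply hasd_pext; [exact hk|]; rewrite Cmod_mult.
    pose proof (hl y); pose proof (Cmod_ge_0 t); eapply Rle_lt_trans; [|exact ht].
    apply Rmult_le_compat_l; assumption.
  - intros t ht; unfold Fmap, gmap; rewrite (linear_scal _ (Lop_is_linear l)); simpl.
    change (scal (t : C_AbsRing) (l y)) with (t * l y)%C; modv X.
Qed.

(** Both [DF(x) x] and [D^2F(x)(x, x)] are multiples of [x]. Hence every supporting functional of
    [x] gives the same value, [Re (z Aext z + 1)] with [z = l x]. *)
Lemma class_F_Fmap : class_F (mu - 1 / 2) Fmap.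
Proof.
  split; [exact normalized_Fmap|]; split; [exact locally_biholomorphic_Fmap|].
  intros x hx hx0 T [hT _].
  destruct (proj2 locally_biholomorphic_Fmap x hx) as [B hB].
  set (z := l x); assert (hz : Cmod z < 1) by (apply Cmod_l_lt; exact hx).
  assert (h1x : Cmod 1 * norm x < 1) by (rewrite Cmod_1; lra).
  assert (hone : scal (RtoC 1 : C_AbsRing) x = x) by exact (scal_one x).
  (* Read off from the ray through [x] itself at parameter [1], which is admissible because
     [norm x < 1]. *)
  assert (e1 : fderiv Fmap x x = scal (fext1 mu al z : C_AbsRing) x).
  { pose proof (radial_Fmap x 1 1%C ltac:(lia) h1x) as h; unfold radial in h; rewrite hone in h.
    simpl in h; rewrite Cmult_1_l in h; exact h. }
  assert (e2 : diag 2 (nderiv Fmap 2 x) x = scal (z * fext2 mu al z : C_AbsRing)%C x).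
  { pose proof (radial_Fmap x 2 1%C ltac:(lia) h1x) as h; unfold radial in h; rewrite hone in h.
    unfold pext in h; rewrite Cmult_1_l in h; exact h. }
  assert (hf1 : fext1 mu al z <> 0%C) by (apply fext1_neq_0; assumption).
  assert (hn : 0 < norm x).
  { pose proof (norm_ge_0 x) as h; destruct (Req_dec (norm x) 0) as [h0|h0]; [|lra].
    exfalso; apply hx0, norm_eq_zero, h0. }
  assert (hne : RtoC (norm x) <> 0%C) by (intros h; injection h; lra).
  assert (e3 : plus (diag 2 (nderiv Fmap 2 x) x) (fderiv Fmap x x)
             = scal (z * fext2 mu al z + fext1 mu al z : C_AbsRing)%C x) by (rewrite e1, e2; modv X).
  rewrite e3, (Linv_apply _ B x _ _ hB hf1 e1), !(linear_scal _ (Lop_is_linear T)), hT.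
  change (Re (RtoC (/ norm x) * ((z * fext2 mu al z + fext1 mu al z) / fext1 mu al z * RtoC (norm x)))%C
    >= 1 / 2 - (mu - 1 / 2)).
  rewrite RtoC_inv by lra; unfold fext2.
  replace (/ RtoC (norm x) * ((z * (fext1 mu al z * Aext mu al z) + fext1 mu al z) / fext1 mu al z * RtoC (norm x)))%C
    with (z * Aext mu al z + 1)%C by (field; split; assumption).
  pose proof (Re_Aext mu al hmu z hz) as h.
  change (Re (z * Aext mu al z + 1)%C) with (Re (z * Aext mu al z)%C + 1); lra.
Qed.

Lemma H22_Fmap (x0 : X) : norm x0 = 1 -> l x0 = RtoC 1 -> (cos al) ^ 2 * (4 * (2 - mu)) = 1 ->
  Cmod (H22 Fmap x0 l) = mu ^ 2 * (11 - 5 * mu) / (48 * (2 - mu)).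
Proof.
  intros hx0 hlx hc.
  rewrite (H22_eq Fmap x0 l (fun m => pext 1 m 0)).
  2:{ intros m hm; rewrite radial_Fmap by (lia || (rewrite Cmod_0; lra)); rewrite hlx.
      rewrite (linear_scal _ (Lop_is_linear l)), hlx.
      change ((pext 1 m 0 * 1)%C = pext 1 m 0); ring. }
  set (c := cos al) in *.
  assert (hc2 : c ^ 2 = / (4 * (2 - mu))) by (field_simplify_eq; lra).
  assert (hA : Aext mu al 0 = RtoC (2 * mu * c)).
  { unfold Aext; rewrite Qext_eq; fold c; push_RtoC; field. }
  assert (hA1 : Aext1 mu al 0 = RtoC (- (2 * mu) + 4 * mu * (c * c))).
  { unfold Aext1; rewrite hA, Qext_eq; fold c; push_RtoC; field. }
  assert (hA2 : Aext2 mu al 0 = RtoC (4 * c * (- (2 * mu) + 4 * mu * (c * c)) - 4 * mu * c)).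
  { unfold Aext2; rewrite hA, hA1, Qext_eq; fold c; push_RtoC; field. }
  set (a := 2 * mu * c) in *; set (b := - (2 * mu) + 4 * mu * (c * c)) in *.
  set (d := 4 * c * b - 4 * mu * c) in *.
  assert (h1 := fext1_0 mu al hal).
  assert (h2 : fext2 mu al 0 = RtoC a) by (unfold fext2; rewrite h1, hA; ring).
  assert (h3 : fext3 mu al 0 = RtoC (a * a + b)).
  { unfold fext3; rewrite h1, h2, hA, hA1; push_RtoC; ring. }
  assert (h4 : fext4 mu al 0 = RtoC ((a * a + b) * a + 2 * a * b + d)).
  { unfold fext4; rewrite h1, h2, h3, hA, hA1, hA2; push_RtoC; ring. }
  unfold pext; rewrite Cmult_0_l, h2, h3, h4.
  replace (1 * RtoC a / 2 * (1 * (1 * (1 * RtoC ((a * a + b) * a + 2 * a * b + d))) / 24)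
     - 1 * (1 * RtoC (a * a + b)) / 6 * (1 * (1 * RtoC (a * a + b)) / 6))%C
    with (RtoC (a / 2 * (((a * a + b) * a + 2 * a * b + d) / 24) - (a * a + b) / 6 * ((a * a + b) / 6))).
  2:{ rewrite RtoC_minus, !RtoC_mult, !RtoC_div by lra; field. }
  rewrite Cmod_R.
  replace (a / 2 * (((a * a + b) * a + 2 * a * b + d) / 24) - (a * a + b) / 6 * ((a * a + b) / 6))
    with (- (mu ^ 2 * (11 - 5 * mu) / (48 * (2 - mu)))).
  - rewrite Rabs_Ropp, Rabs_pos_eq; [reflexivity|].
    apply Rmult_le_pos; [nra|left; apply Rinv_0_lt_compat; lra].
  (* A quadratic in [c^2] with vertex at [c^2 = 1 / (4 (2 - mu))]; its value there is negative,
     which explains the sign. *)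
  - unfold d, b, a.
    match goal with |- _ = ?g => replace g with (mu ^ 2 / 18 * (- 2 - (1 + mu) * c ^ 2 + 2 * (2 - mu) * (1 + mu) * (c ^ 2) ^ 2)) by field end.
    rewrite hc2; field; lra.
Qed.

End ExtremalMap.

(** The norming functional plays two parts: it defines the extremal map and it is the supporting
    functional at which equality is tested. *)
Lemma exists_unit_support {X : NormedModule C_AbsRing} : (exists u : X, u <> zero) ->
  exists (x0 : X) (l : Lop X C_NormedModule), norm x0 = 1 /\ l x0 = RtoC 1 /\
    (forall v, Cmod (l v) <= norm v) /\ support_functional x0 l.
Proof.
  intros [u hu].
  assert (hn : 0 < norm u).
  { pose proof (norm_ge_0 u) as h; destruct (Req_dec (norm u) 0) as [h0|h0]; [|lra].
    exfalso; apply hu, norm_eq_zero, h0. }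
  set (x0 := scal (RtoC (/ norm u) : C_AbsRing) u : X).
  assert (hx0 : norm x0 = 1).
  { unfold x0; rewrite_norm_scal; rewrite Cmod_R, Rabs_pos_eq by (left; apply Rinv_0_lt_compat; exact hn); field; lra. }
  destruct (hahn_banach_norming x0) as [l [h1 h2]].
  exists x0, l; split; [exact hx0|]; split; [rewrite h1, hx0; reflexivity|]; split; [exact h2|].
  split; [exact h1|]; apply Rle_antisym.
  - apply opnorm_le; [lra|]; intros v; rewrite Rmult_1_l; apply h2.
  - pose proof (opnorm_bound l x0) as h.
    assert (he : norm (l x0) = 1) by (rewrite h1, hx0; exact Cmod_1).
    rewrite he, hx0, Rmult_1_r in h; exact h.
Qed.

(** The maximizing value of [|a|^2] lies between [1 / 4] and [1 / 2], so it is the squared cosine of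
    an acute angle. *)
Lemma exists_extremal_angle (mu : R) : 1 <= mu <= 3 / 2 ->
  exists al, 0 < al < PI / 2 /\ (cos al) ^ 2 * (4 * (2 - mu)) = 1.
Proof.
  intros hmu; set (c := sqrt (/ (4 * (2 - mu)))).
  assert (hi : 0 < / (4 * (2 - mu))) by (apply Rinv_0_lt_compat; lra).
  assert (hi1 : / (4 * (2 - mu)) < 1) by (rewrite <- Rinv_1; apply Rinv_lt_contravar; lra).
  assert (hc : 0 < c) by (apply sqrt_lt_R0; exact hi).
  assert (hcc : c * c = / (4 * (2 - mu))) by (apply sqrt_sqrt; lra).
  assert (hc1 : c < 1) by nra.
  assert (he : cos (acos c) = c) by (apply cos_acos; lra).
  exists (acos c); split.
  - destruct (acos_bound c) as [h1 h2]; split.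
    + destruct h1 as [h1|h1]; [exact h1|exfalso]; rewrite <- h1, cos_0 in he; lra.
    + apply Rnot_le_lt; intros hle.
      pose proof (cos_le_0 (acos c) hle ltac:(pose proof PI_RGT_0; lra)); lra.
  - rewrite he; simpl; rewrite Rmult_1_r, hcc; field; lra.
Qed.

Theorem theorem3p1 (X : CompleteNormedModule C_AbsRing)
    (hX : exists u : X, u <> zero)
    (lambda : R) (hlambda : 1 / 2 <= lambda <= 1) :
  (forall (g : X -> C) (F : X -> X),
      holomorphic_on_ball (Y := C_NormedModule) g ->
      g zero = RtoC 1 ->
      (forall x : X, norm x < 1 -> F x = scal (g x : C_AbsRing) x) ->
      class_F lambda F ->
      forall x0 : X, norm x0 = 1 ->
      forall T : Lop X C_NormedModule, support_functional x0 T ->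
        Cmod (H22 F x0 T) <=
          (1 + 2 * lambda) ^ 2 * (17 - 10 * lambda) / (192 * (3 - 2 * lambda)))
  /\
  (exists (g : X -> C) (F : X -> X),
      holomorphic_on_ball (Y := C_NormedModule) g /\
      g zero = RtoC 1 /\
      (forall x : X, norm x < 1 -> F x = scal (g x : C_AbsRing) x) /\
      class_F lambda F /\
      exists (x0 : X) (T : Lop X C_NormedModule),
        norm x0 = 1 /\ support_functional x0 T /\
        Cmod (H22 F x0 T) =
          (1 + 2 * lambda) ^ 2 * (17 - 10 * lambda) / (192 * (3 - 2 * lambda))).
Proof.
  assert (hB : banach X) by apply complete_banach.
  split.
  - intros g F _ _ hg hF x0 hx0 T hT; apply (hankel_upper_bound X hB lambda g); assumption.
  - assert (hmu : 1 <= lambda + 1 / 2 <= 3 / 2) by lra.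
    destruct (exists_extremal_angle _ hmu) as [al [hal hc]].
    destruct (exists_unit_support (X := X) hX) as [x0 [l [hx0 [hlx [hl hsupp]]]]].
    exists (gmap (lambda + 1 / 2) al l), (Fmap (lambda + 1 / 2) al l).
    split; [apply holomorphic_gmap; assumption|].
    split; [exact (gmap_zero (X := X) _ _ l)|].
    split; [reflexivity|].
    split.
    + replace lambda with (lambda + 1 / 2 - 1 / 2) at 1 by ring.
      apply class_F_Fmap; assumption.
    + exists x0, l; split; [exact hx0|]; split; [exact hsupp|].
      rewrite (H22_Fmap hB (lambda + 1 / 2) al hmu hal l hl x0 hx0 hlx hc); field; lra.
Qed.
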